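(* Let $a,b>0$. The spectrum (with multiplicities) of the Hodge-Laplace operator $\Delta_1$ on $1$-forms of the Berger sphere $(\mathrm{SU}(2),g_{(a,b,b)})$ is the union over all integers $k\ge0$ of the multisets $\mathrm{Spec}(\Delta_1^{(k)})$, where $$\mathrm{Spec}(\Delta_1^{(0)})=\{4a^2,\,4a^2,\,4\tfrac{b^4}{a^2}\},$$ and for $k\ge1$, $\mathrm{Spec}(\Delta_1^{(k)})$ consists of - $\nu_{k,j}$, for each $0\le j\le k$, each repeated $k+1$ times; - $\mu_{k,j}$, for each $j\in\{-1,0,k,k+1\}$, each repeated $k+1$ times; - $\mu_{k,j}^+$ and $\mu_{k,j}^-$, for each $1\le j\le k-1$, each repeated $k+1$ times. Here $$\nu_{k,j}=a^2(k-2j)^2+b^2\big((4j+2)k-4j^2\big),\qquad \mu_{k,-1}=\mu_{k,k+1}=(k+2)^2a^2,$$ $$\mu_{k,0}=\mu_{k,k}=k^2a^2+4kb^2+4\tfrac{b^4}{a^2},\qquad \mu_{k,j}^\pm=\nu_{k,j}+2\tfrac{b^4}{a^2}\pm2\tfrac{b^2}{a^2}\sqrt{a^2\nu_{k,j}+b^4}.$$ For $(\mathrm{SO}(3),g_{(a,b,b)})$, the spectrum of $\Delta_1$ is the part corresponding to even weights, $\bigcup_{k\in2\mathbb N_0}\mathrm{Spec}(\Delta_1^{(k)})$.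
   Context: Basis of $\mathfrak{su}(2)$: $E_1=\begin{pmatrix}\mathrm i&0\\0&-\mathrm i\end{pmatrix}$, $E_2=\begin{pmatrix}0&1\\-1&0\end{pmatrix}$, $E_3=\begin{pmatrix}0&\mathrm i\\\mathrm i&0\end{pmatrix}$. For $a,b,c>0$, $g_{(a,b,c)}$ is the left-invariant metric on $\mathrm{SU}(2)$ for which $aE_1,bE_2,cE_3$ is orthonormal; the same notation is used for the induced left-invariant metric on $\mathrm{SO}(3)\cong\mathrm{SU}(2)/\{\pm\mathrm{Id}\}$. $\Delta_1=d\delta+\delta d$ acts on complex-valued $1$-forms. The index $k$ refers to the contribution of the isotypical component of $L^2$ $1$-forms (under left translation) of type the $(k+1)$-dimensional irreducible representation of $\mathrm{SU}(2)$. *)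

(* Defs.v *)
From HB Require Import structures.
From mathcomp Require Import all_boot all_order all_algebra.
From mathcomp Require Import all_classical all_reals all_analysis.
From mathcomp Require Import complex ring lra.
Set Implicit Arguments.
Unset Strict Implicit.
Unset Printing Implicit Defensive.
Import Order.TTheory GRing.Theory Num.Theory numFieldNormedType.Exports.
Local Open Scope ring_scope.
Local Open Scope complex_scope.

Section Smooth.
Variable R : realType.

(* On a finite-dimensional V, "continuous with all directional derivatives of
   class C^m" is the usual class C^(m+1). *)
Fixpoint Cn (V : normedModType R) (m : nat) (f : V -> R) : Prop :=
  continuous f /\
  if m is m'.+1 then
    forall v : V, (forall x, derivable f x v) /\ Cn m' (fun x => 'D_v f x)
  else True.

Variable d : nat.
Implicit Types (F : 'M[R[i]]_d.+1 -> R[i]) (x v : 'M[R[i]]_d.+1).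

(* The complex matrices are used as a real vector space, with coordinates the
   real and imaginary parts. *)
Definition of_coord (p : 'M[R]_d.+1 * 'M[R]_d.+1) : 'M[R[i]]_d.+1 :=
  \matrix_(i, j) (p.1 i j +i* p.2 i j).

Definition smooth F : Prop := forall m : nat,
  Cn m (fun p : 'M[R]_d.+1 * 'M[R]_d.+1 => complex.Re (F (of_coord p))) /\
  Cn m (fun p : 'M[R]_d.+1 * 'M[R]_d.+1 => complex.Im (F (of_coord p))).

(* The derivative of F at x in the real direction v. *)
Definition rderiv F v x : R[i] :=
  derive1 (fun t : R => complex.Re (F (x + t%:C *: v))) 0
  +i* derive1 (fun t : R => complex.Im (F (x + t%:C *: v))) 0.

End Smooth.

(* A three-dimensional closed matrix group [carrier] with a basis [frame] of
   its Lie algebra, of structure constants [struct].  It carries the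
   left-invariant Riemannian metric for which [frame] is orthonormal. *)
Record framedGroup (R : realType) := FramedGroup {
  deg : nat;
  carrier : 'M[R[i]]_deg.+1 -> Prop;
  frame : 'I_3 -> 'M[R[i]]_deg.+1;
  struct : 'I_3 -> 'I_3 -> 'I_3 -> R;
  structP : forall i j, frame i *m frame j - frame j *m frame i =
                        \sum_k (struct i j k)%:C *: frame k
}.

Section Hodge.
Variables (R : realType) (G : framedGroup R).
Local Notation C := R[i].
Local Notation M := 'M[C]_((deg G).+1).

(* The smooth functions on a closed submanifold are the restrictions of the
   smooth functions on the ambient space.  So functions are represented by
   functions on M, and compared on the group only.  A p-form is represented by
   its values on the left-invariant orthonormal frame. *)
Definition form0 := M -> C.
Definition form1 := 'I_3 -> M -> C.
Definition form2 := 'I_3 -> 'I_3 -> M -> C.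
Definition form3 := 'I_3 -> 'I_3 -> 'I_3 -> M -> C.

Definition smooth1 (w : form1) : Prop := forall i, smooth (w i).

Definition eq1 (w w' : form1) : Prop :=
  forall x, carrier x -> forall i, w i x = w' i x.

(* The left-invariant vector field X_i has value x e_i at x. *)
Definition lfield (i : 'I_3) (f : form0) : form0 :=
  fun x => rderiv f (x *m frame G i) x.

(* Exterior derivative, by the invariant formula on X_0, X_1, X_2, where
   [X_i, X_j] = \sum_l struct i j l X_l. *)
Definition d0 (f : form0) : form1 := fun i => lfield i f.

Definition d1 (w : form1) : form2 := fun i j x =>
  lfield i (w j) x - lfield j (w i) x
  - \sum_l (struct G i j l)%:C * w l x.

Definition d2 (h : form2) : form3 := fun i j k x =>
  lfield i (h j k) x - lfield j (h i k) x + lfield k (h i j) x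
  - (\sum_l (struct G i j l)%:C * h l k x)
  + (\sum_l (struct G i k l)%:C * h l j x)
  - (\sum_l (struct G j k l)%:C * h l i x).

End Hodge.

(* The Levi-Civita symbol of {0, 1, 2}. *)
Definition epsZ (i j k : nat) : int :=
  if (i, j, k) \in [:: (0, 1, 2); (1, 2, 0); (2, 0, 1)]%N then 1
  else if (i, j, k) \in [:: (0, 2, 1); (1, 0, 2); (2, 1, 0)]%N then -1
  else 0.

Definition eps (R : realType) (i j k : 'I_3) : R := (epsZ i j k)%:~R.

Section Laplace.
Variables (R : realType) (G : framedGroup R).
Local Notation C := R[i].
Local Notation M := 'M[C]_((deg G).+1).

(* The Hodge star of the metric, for the orientation given by the frame. *)
Definition star1 (w : form1 G) : form2 G := fun i j x =>
  \sum_k (eps R i j k)%:C * w k x.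

Definition star2 (h : form2 G) : form1 G := fun k x =>
  2^-1 * \sum_i \sum_j (eps R i j k)%:C * h i j x.

Definition star3 (t : form3 G) : form0 G :=
  t (inord 0) (inord 1) (inord 2).

(* delta = (-1)^(n(p+1)+1) * d * on p-forms, with n = 3. *)
Definition delta1 (w : form1 G) : form0 G :=
  fun x => - star3 (d2 (star1 w)) x.

Definition delta2 (h : form2 G) : form1 G := star2 (d1 (star2 h)).

Definition Delta1 (w : form1 G) : form1 G :=
  fun i x => d0 (delta1 w) i x + delta2 (d1 w) i x.

Definition lincomb (m : nat) (c : 'I_m -> C) (B : 'I_m -> form1 G) : form1 G :=
  fun i x => \sum_r c r * B r i x.

Definition eigenform (lambda : C) (w : form1 G) : Prop :=
  smooth1 w /\ eq1 (Delta1 w) (fun i x => lambda * w i x).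

(* E, up to equality on the group, is a complex vector space of dimension m. *)
Definition has_dim (E : form1 G -> Prop) (m : nat) : Prop :=
  exists B : 'I_m -> form1 G,
    [/\ forall r, E (B r),
        forall c, eq1 (lincomb c B) (fun _ _ => 0) -> forall r, c r = 0 &
        forall w, E w -> exists c, eq1 w (lincomb c B)].

(* The restriction of Delta_1 to the invariant subspace E has spectrum the
   finite multiset s. *)
Definition spectrum_on (E : form1 G -> Prop) (s : seq R) : Prop :=
  forall lambda : C,
    has_dim (fun w => E w /\ eigenform lambda w)
            (count_mem lambda [seq r%:C | r <- s]).

(* The spectrum of Delta_1 on all 1-forms is the multiset union of the S k for
   k in P: each multiplicity \sum_(k | P k) count_mem lambda (S k) is finite
   and is the dimension of the eigenspace. *)
Definition spectrum_is_union (P : pred nat) (S : nat -> seq R) : Prop :=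
  forall lambda : C, exists m : nat,
    has_dim (eigenform lambda) m /\
    exists N : nat, forall K : nat, (N <= K)%N ->
      (\sum_(k < K | P k) count_mem lambda [seq r%:C | r <- S k])%N = m.

End Laplace.

Section Groups.
Variable R : realType.
Local Notation C := R[i].

Definition SU2 (x : 'M[C]_2) : Prop := x \is unitarymx /\ \det x = 1.

(* SO(3) inside the complex matrices. *)
Definition SO3 (x : 'M[C]_3) : Prop :=
  exists y : 'M[R]_3, [/\ x = map_mx (real_complex R) y,
                          y *m y^T = 1%:M & \det y = 1].

Definition mx22 (p q r s : C) : 'M[C]_2 :=
  \matrix_(i, j) if i == 0 then (if j == 0 then p else q)
                 else (if j == 0 then r else s).

Definition suE (i : 'I_3) : 'M[C]_2 :=
  nth 0 [:: mx22 (0 +i* 1) 0 0 (0 -i* 1);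
            mx22 0 1 (- 1) 0;
            mx22 0 (0 +i* 1) (0 +i* 1) 0] i.

(* The image of E_i under the differential ad of the covering
   Ad : SU(2) -> SO(3) of kernel {1, -1}, in the basis E_1, E_2, E_3 (see
   [soE_ad]). *)
Definition soE (i : 'I_3) : 'M[C]_3 :=
  \matrix_(j, l) (2 * eps R i l j)%:C.

Definition scal (a b c : R) (i : 'I_3) : R := nth 0 [:: a; b; c] i.

Definition scal_struct (a b c : R) (i j k : 'I_3) : R :=
  2 * eps R i j k * scal a b c i * scal a b c j / scal a b c k.

Lemma eps2C i j k : (2 * eps R i j k)%:C = (2 * epsZ i j k)%:~R :> C.
Proof. by rewrite intrM /eps rmorphM rmorph_nat rmorph_int. Qed.

Lemma suE_bracket i j :
  suE i *m suE j - suE j *m suE i = \sum_k (2 * eps R i j k)%:C *: suE k.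
Proof.
have [u [v [uvE Hu Hv]]] : exists u v : nat -> nat -> nat -> int,
  [/\ forall (k : 'I_3) (p q : 'I_2),
        suE k p q = (u k p q)%:~R +i* (v k p q)%:~R :> C,
      forall (i j : 'I_3) (p q : 'I_2),
        u i p 0 * u j 0 q - v i p 0 * v j 0 q
        + (u i p 1 * u j 1 q - v i p 1 * v j 1 q)
        - (u j p 0 * u i 0 q - v j p 0 * v i 0 q
           + (u j p 1 * u i 1 q - v j p 1 * v i 1 q))
        = 2 * epsZ i j 0 * u 0 p q + (2 * epsZ i j 1 * u 1 p q
          + 2 * epsZ i j 2 * u 2 p q) &
      forall (i j : 'I_3) (p q : 'I_2),
        u i p 0 * v j 0 q + v i p 0 * u j 0 q
        + (u i p 1 * v j 1 q + v i p 1 * u j 1 q)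
        - (u j p 0 * v i 0 q + v j p 0 * u i 0 q
           + (u j p 1 * v i 1 q + v j p 1 * u i 1 q))
        = 2 * epsZ i j 0 * v 0 p q + (2 * epsZ i j 1 * v 1 p q
          + 2 * epsZ i j 2 * v 2 p q)].
  exists (fun i p q => nth 0 (nth [::]
    [:: [:: 0; 0; 0; 0]; [:: 0; 1; -1; 0]; [:: 0; 0; 0; 0]] i) (2 * p + q)%N).
  exists (fun i p q => nth 0 (nth [::]
    [:: [:: 1; 0; 0; -1]; [:: 0; 0; 0; 0]; [:: 0; 1; 1; 0]] i) (2 * p + q)%N).
  split.
  - case=> [[|[|[|k]]] Hk] //; rewrite /suE /= => p q; rewrite mxE;
    case: p => [[|[|p]] Hp] //; case: q => [[|[|q]] Hq] //=;
    by apply/eqP; rewrite eq_complex /= ?oppr0 !eqxx.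
  - by case=> [[|[|[|?]]] ?] //; case=> [[|[|[|?]]] ?] //;
       case=> [[|[|?]] ?] //; case=> [[|[|?]] ?].
  - by case=> [[|[|[|?]]] ?] //; case=> [[|[|[|?]]] ?] //;
       case=> [[|[|?]] ?] //; case=> [[|[|?]] ?].
apply/matrixP => p q; rewrite summxE !mxE.
under eq_bigr do rewrite !uvE; under [X in _ - X]eq_bigr do rewrite !uvE.
under [RHS]eq_bigr do rewrite mxE uvE.
have {}Hu := congr1 (fun z : int => z%:~R : R) (Hu i j p q).
have {}Hv := congr1 (fun z : int => z%:~R : R) (Hv i j p q).
rewrite !(intrM, intrD, mulrNz) in Hu Hv.
rewrite !big_ord_recl !big_ord0 !addr0.
apply/eqP; rewrite eq_complex; apply/andP; split; apply/eqP.
  by rewrite [LHS]Hu /= /eps !mul0r !subr0.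
by rewrite [LHS]Hv /= /eps !mul0r !addr0.
Qed.

Lemma soE_ad i l :
  suE i *m suE l - suE l *m suE i = \sum_j soE i j l *: suE j.
Proof. by rewrite suE_bracket; apply: eq_bigr => j _; rewrite mxE. Qed.

Lemma soE_bracket i j :
  soE i *m soE j - soE j *m soE i = \sum_k (2 * eps R i j k)%:C *: soE k.
Proof.
apply/matrixP => p q; rewrite summxE !mxE.
under eq_bigr do rewrite !mxE !eps2C -intrM.
under [X in _ - X]eq_bigr do rewrite !mxE !eps2C -intrM.
under [RHS]eq_bigr do rewrite !mxE !eps2C -intrM.
rewrite !big_ord_recl !big_ord0 !addr0 -!(intrD, intrB); congr (_%:~R).
by case: i => [[|[|[|i]]] Hi] //; case: j => [[|[|[|j]]] Hj] //;
   case: p => [[|[|[|p]]] Hp] //; case: q => [[|[|[|q]]] Hq] //; vm_compute.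
Qed.

Lemma scal_bracket n (a b c : R) (e : 'I_3 -> 'M[C]_n.+1) :
  0 < a -> 0 < b -> 0 < c ->
  (forall i j, e i *m e j - e j *m e i = \sum_k (2 * eps R i j k)%:C *: e k) ->
  let f i := (scal a b c i)%:C *: e i in
  forall i j,
    f i *m f j - f j *m f i = \sum_k (scal_struct a b c i j k)%:C *: f k.
Proof.
move=> a0 b0 c0 eE f i j; rewrite /f.
have s0 k : scal a b c k != 0.
  by case: k => [[|[|[|k]]] Hk] //; rewrite /scal /= gt_eqF.
rewrite -!scalemxAl -!scalemxAr !scalerA (mulrC (scal a b c j)%:C) -scalerBr eE.
rewrite scaler_sumr; apply: eq_bigr => k _; rewrite !scalerA -!rmorphM /=.
by congr (_%:C *: _); rewrite /scal_struct; field.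
Qed.

End Groups.

Section Metrics.
Variables (R : realType) (a b c : R).
Hypotheses (a0 : 0 < a) (b0 : 0 < b) (c0 : 0 < c).

(* The metric g_(a,b,c) on SU(2), with orthonormal frame a E_1, b E_2, c E_3,
   and the metric it induces on SO(3) = SU(2)/{1, -1}. *)
Definition gSU2 : framedGroup R :=
  @FramedGroup R 1 (@SU2 R) _ _ (scal_bracket a0 b0 c0 (@suE_bracket R)).

Definition gSO3 : framedGroup R :=
  @FramedGroup R 2 (@SO3 R) _ _ (scal_bracket a0 b0 c0 (@soE_bracket R)).

Local Notation C := R[i].

(* (g . w) = (L_(g^-1))^* w *)
Definition ltrans (g : 'M[C]_2) (w : form1 gSU2) : form1 gSU2 :=
  fun i x => w i (invmx g *m x).

(* The irreducible representation of SU(2) of dimension k + 1: the homogeneous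
   polynomials P of degree k on C^2, here given by their coefficients, with the
   action (g . P) z = P (z g), for z a row vector. *)
Definition hpoly (k : nat) (u : 'rV[C]_k.+1) (z : 'rV[C]_2) : C :=
  \sum_(i < k.+1) u 0 i * z 0 0 ^+ (k - i) * z 0 1 ^+ i.

Definition intertwiner (k : nat) (T : 'rV[C]_k.+1 -> form1 gSU2) : Prop :=
  [/\ forall u, smooth1 (T u),
      forall (s : C) u u',
        eq1 (T (s *: u + u')) (fun i x => s * T u i x + T u' i x) &
      forall g u u', SU2 g -> (forall z, hpoly u' z = hpoly u (z *m g)) ->
        eq1 (T u') (ltrans g (T u))].

(* The isotypical component of type hpoly k.  It is finite-dimensional, so that
   it is the same in L^2 and in smooth 1-forms. *)
Definition isotypic (k : nat) (w : form1 gSU2) : Prop :=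
  exists n (T : 'I_n -> 'rV[C]_k.+1 -> form1 gSU2) (u : 'I_n -> 'rV[C]_k.+1),
    (forall r, intertwiner (T r)) /\
    eq1 w (fun i x => \sum_r T r (u r) i x).

End Metrics.

Section Values.
Variables (R : realType) (a b : R).

(* As k and j are cast to R, the subtraction k - 2 j is not truncated. *)
Definition nu (k j : nat) : R :=
  a ^+ 2 * (k%:R - 2 * j%:R) ^+ 2
  + b ^+ 2 * ((4 * j%:R + 2) * k%:R - 4 * j%:R ^+ 2).

(* mu_(k,-1) = mu_(k,k+1) *)
Definition mu_out (k : nat) : R := (k%:R + 2) ^+ 2 * a ^+ 2.

(* mu_(k,0) = mu_(k,k) *)
Definition mu_end (k : nat) : R :=
  k%:R ^+ 2 * a ^+ 2 + 4 * k%:R * b ^+ 2 + 4 * (b ^+ 4 / a ^+ 2).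

Definition mu_plus (k j : nat) : R :=
  nu k j + 2 * (b ^+ 4 / a ^+ 2)
  + 2 * (b ^+ 2 / a ^+ 2) * Num.sqrt (a ^+ 2 * nu k j + b ^+ 4).

Definition mu_minus (k j : nat) : R :=
  nu k j + 2 * (b ^+ 4 / a ^+ 2)
  - 2 * (b ^+ 2 / a ^+ 2) * Num.sqrt (a ^+ 2 * nu k j + b ^+ 4).

Definition spec1 (k : nat) : seq R :=
  if k is 0 then [:: 4 * a ^+ 2; 4 * a ^+ 2; 4 * (b ^+ 4 / a ^+ 2)]
  else flatten [seq nseq k.+1 r | r <-
    [seq nu k j | j <- iota 0 k.+1]
    ++ [:: mu_out k; mu_end k; mu_end k; mu_out k]
    ++ [seq mu_plus k j | j <- iota 1 k.-1]
    ++ [seq mu_minus k j | j <- iota 1 k.-1]].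

End Values.

(* Main.v *)
Require Import Defs.
From HB Require Import structures.
From mathcomp Require Import all_boot all_order all_algebra.
From mathcomp Require Import all_classical all_reals all_analysis.
From mathcomp Require Import complex ring lra zify.
Set Implicit Arguments.
Unset Strict Implicit.
Unset Printing Implicit Defensive.
Import Order.TTheory GRing.Theory Num.Theory numFieldNormedType.Exports.
Local Open Scope ring_scope.
Local Open Scope complex_scope.

(** Left-invariant fields act on the matrix coefficients of the irreducible
    representations of SU(2), so in the left-invariant frame *d and the Hodge
    Laplacian preserve, for each weight, small blocks of functions.  Since b = c,
    the right action of the circle exp (t E_1) splits them further into blocks
    of dimension at most 3, in which *d has the kernel direction of an exact form
    (eigenvalue nu) and eigenvalues tau with tau^2 + 2 (b^2/a) tau = nu, or
    +-(k+2) a at the two ends; the Laplacian is tau^2 on the coexact ones.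
    An eigenform orthogonal to all these forms is orthogonal to every matrix
    coefficient, hence vanishes, because powers of 1 + tr (x0^* x) / 2 concentrate
    at x0.  Invariant integration is von Neumann's mean: the constant uniformly
    approximated by averages of right translates.  On SO(3) = Ad (SU(2)) one keeps
    the forms that are invariant under x |-> - x, which are those of even weight.
*)

(** * Functions of class C^n *)

(** The mean is applied to smooth functions, which are Lipschitz on the group. Left-invariant fields
    generate right translations, so invariance under these is what integration by parts asks for; it
    makes the curl symmetric and forms with different eigenvalues orthogonal. As eigenvalues grow
    with the weight, only finitely many explicit forms share a given one. Subtracting from an
    eigenform its projection onto their span leaves a form orthogonal to all explicit forms, within
    reach of the density argument. Multiplicities also need independence: the Casimir operator
    separates weights, the field of E_1 separates columns, and a Vandermonde computation separates
    the eigenvectors of a block. Two devices keep the case analysis small. Matrix coefficients are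
    padded by zeros, so that the truncated blocks at both ends obey the formulas of the full ones;
    and [mu_end] is [mu_plus] at j = 0 and j = k, so that four kinds of eigenforms suffice.
    Functions live on all matrices while only their restrictions matter, so the operators must be
    shown to depend on restrictions alone. *)

Section CnAlgebra.
Variables (R : realType) (V : normedModType R).
Implicit Types (f g : V -> R) (v x : V) (m : nat).

Lemma Cn_continuous m f : Cn m f -> continuous f.
Proof. by case: m => [|m] []. Qed.

Lemma Cn_derivable m f v x : Cn m.+1 f -> derivable f x v.
Proof. by case=> _ /(_ v)[]. Qed.

Lemma Cn_derive m f v : Cn m.+1 f -> Cn m ('D_v f).
Proof. by case=> _ /(_ v)[]. Qed.

Lemma CnW m f : Cn m.+1 f -> Cn m f.
Proof.
elim: m f => [|m IH] f [cf df]; first by [].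
by split=> // v; have [dfv /IH Dfv] := df v.
Qed.

Lemma Cn_cst m (c : R) : Cn m (fun _ : V => c).
Proof.
elim: m c => [|m IH] c; (split; first exact: cst_continuous) => // v.
split=> [x|]; first exact: derivable_cst.
rewrite (_ : 'D_v _ = (fun=> 0)); first exact: IH.
by apply/funext => x; rewrite (derive_cst c).
Qed.

Lemma CnD m f g : Cn m f -> Cn m g -> Cn m (fun x => f x + g x).
Proof.
elim: m f g => [|m IH] f g [cf df] [cg dg]; split => //.
- by move=> x; apply: continuousD; [apply: cf|apply: cg].
- by move=> x; apply: continuousD; [apply: cf|apply: cg].
- move=> v; have [dfv Dfv] := df v; have [dgv Dgv] := dg v; split=> [x|].
    exact: (derivableD (dfv x) (dgv x)).
  rewrite (_ : 'D_v _ = (fun x => 'D_v f x + 'D_v g x)); first exact: IH.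
  by apply/funext => x; rewrite (deriveD (dfv x) (dgv x)).
Qed.

Lemma CnM m f g : Cn m f -> Cn m g -> Cn m (fun x => f x * g x).
Proof.
elim: m f g => [|m IH] f g Cf Cg.
  by split=> // x; apply: continuousM; [apply: Cf.1|apply: Cg.1].
split; first by move=> x; apply: continuousM; [apply: Cf.1|apply: Cg.1].
move=> v; have [dfv Dfv] := Cf.2 v; have [dgv Dgv] := Cg.2 v; split=> [x|].
  exact: (derivableM (dfv x) (dgv x)).
rewrite (_ : 'D_v _ = (fun x => f x * 'D_v g x + g x * 'D_v f x)).
  by apply: CnD; apply: IH => //; apply: CnW.
by apply/funext => x; rewrite (deriveM (dfv x) (dgv x)).
Qed.

Lemma Cn_sum m (I : Type) (r : seq I) (P : pred I) (F : I -> V -> R) :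
  (forall i, Cn m (F i)) -> Cn m (fun x => \sum_(i <- r | P i) F i x).
Proof.
move=> CF; rewrite (_ : (fun _ => _) = \sum_(i <- r | P i) F i); last first.
  by apply/funext => x; rewrite fct_sumE.
by elim/big_rec: _ => [|i f _]; [apply: Cn_cst|apply: CnD].
Qed.

Lemma Cn_linear m (f : {linear V -> R}) : continuous f -> Cn m f.
Proof.
case: m => [//|m] cf; split=> // v; split=> [x|].
  exact/diff_derivable/linear_differentiable.
rewrite (_ : 'D_v _ = (fun=> f v)); first exact: Cn_cst.
apply/funext => x; rewrite deriveE; last exact: linear_differentiable.
by rewrite diff_lin.
Qed.

Lemma is_derive_line f v q (s : R) :
  derivable f (q + s *: v) v ->
  is_derive s 1 (fun t => f (q + t *: v)) ('D_v f (q + s *: v)).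
Proof.
move=> df.
have E : (fun h : R => h^-1 *: ((f \o shift (q + s *: v)) (h *: v)
                                - f (q + s *: v))) =
         (fun h : R => h^-1 *: (((fun t => f (q + t *: v)) \o shift s) (h *: 1)
                                - f (q + s *: v))).
  apply/funext => h; congr (_ *: (f _ - _)) => /=.
  by rewrite [h%:A]mulr1 scalerDl addrCA.
apply: DeriveDef; first by rewrite /derivable -E; exact: df.
by rewrite /derive -E.
Qed.

(** The increment [t] may have either sign, so the intermediate parameter is located up to absolute
    value, which suffices to keep it in a small ball. *)
Lemma MVT_line f v q (t : R) :
  (forall x, derivable f x v) ->
  exists2 s, `|s| <= `|t| & f (q + t *: v) - f q = t * 'D_v f (q + s *: v).
Proof.
move=> df; pose g s := f (q + s *: v).
have dg (s : R) : is_derive s 1 g ('D_v f (q + s *: v)) by apply: is_derive_line.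
have cg : continuous g.
  by move=> s; apply/differentiable_continuous/derivable1_diffP.
have g0 : g 0 = f q by rewrite /g scale0r addr0.
case: (leP 0 t) => t0.
  have [|c] := MVT_segment t0 (fun s _ => dg s).
    exact: continuous_subspaceT.
  rewrite in_itv /= => /andP[c0 ct] Ec; exists c; first by rewrite !ger0_norm.
  by rewrite -g0 -/(g t) Ec subr0 mulrC.
have [|c] := MVT_segment (ltW t0) (fun s _ => dg s).
  exact: continuous_subspaceT.
rewrite in_itv /= => /andP[c0 ct] Ec.
exists c; first by rewrite !ler0_norm ?lerN2 // ltW.
by rewrite -g0 -/(g t) -[LHS]opprB Ec sub0r mulrN opprK mulrC.
Qed.

End CnAlgebra.

Lemma continuous_bigsum (R : realType) (V W : normedModType R) (I : Type)
    (r : seq I) (P : pred I) (F : I -> V -> W) :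
  (forall i, continuous (F i)) ->
  continuous (fun x => \sum_(i <- r | P i) F i x).
Proof.
move=> cF; have -> : (fun x => \sum_(i <- r | P i) F i x) =
    \sum_(i <- r | P i) F i by apply/funext => x; rewrite fct_sumE.
elim/big_rec: _ => [|i g _ cg x]; first exact: cst_continuous.
by apply: continuousD; [apply: cF|apply: cg].
Qed.

(** * Continuous partial derivatives give a total derivative *)

Section FiniteDimension.
Variables (R : realType) (V : normedModType R) (I : finType).
Variables (e : I -> V) (crd : I -> {linear V -> R}).
Hypotheses (crdc : forall i, continuous (crd i))
  (crdE : forall v, v = \sum_i crd i v *: e i).

(** The coordinates of [h] are switched on one after the other. Each contributes an increment along
    a basis vector, which the mean value theorem turns into a partial derivative at a point near
    [p]; its continuity at [p] bounds the error. *)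
Lemma C1_littleo (f : V -> R) (p : V) (r : seq I) :
  (forall v x, derivable f x v) -> (forall v, continuous ('D_v f)) ->
  forall eps : R, 0 < eps -> \forall h \near (0 : V),
    `|f (p + \sum_(i <- r) crd i h *: e i) - f p
      - \sum_(i <- r) crd i h * 'D_(e i) f p| <= eps * `|h|.
Proof.
move=> df cDf; elim: r => [|i r IH] eps eps0.
  by near=> h; rewrite !big_nil addr0 subrr subr0 normr0 mulr_ge0 // ltW.
have [k k0 kP] : exists2 k : R, 0 < k & forall h, `|crd i h| <= k * `|h|.
  by have [k k0 kP] := linear_lipschitz (@crdc i); exists k.
have e20 : 0 < eps / 2 by rewrite divr_gt0.
have [d /= d0 dP] : exists2 d : R, 0 < d & forall y, `|y| < d ->
    `|'D_(e i) f (p + y) - 'D_(e i) f p| <= eps / 2 / k.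
  have /cvgrPdist_le /(_ (eps / 2 / k) (divr_gt0 e20 k0)) := cDf (e i) p.
  move=> /nbhs_ballP[d /= d0 dP]; exists d => // y yd.
  rewrite distrC; apply: dP; rewrite -ball_normE /= opprD addNKr normrN //.
have d20 : 0 < d / 2 by rewrite divr_gt0.
have cH (r' : seq I) : continuous (fun h : V => \sum_(j <- r') crd j h *: e j).
  apply: continuous_bigsum => j h.
  by apply: continuousZr_tmp; apply: crdc.
have cH0 (r' : seq I) : \forall h \near (0 : V),
    `|\sum_(j <- r') crd j h *: e j| < d / 2.
  have /cvgrPdist_lt /(_ _ d20) := cH r' 0.
  rewrite big1; last by move=> j _; rewrite linear0 scale0r.
  by apply: filterS => h; rewrite sub0r normrN.
near=> h; rewrite !big_cons.
set H := \sum_(j <- r) crd j h *: e j.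
set S := \sum_(j <- r) crd j h * _.
have [s sc Es] := @MVT_line R V f (e i) (p + H) (crd i h) (df (e i)).
rewrite [_ + H]addrC (addrA p).
have -> : f (p + H + crd i h *: e i) - f p - (crd i h * 'D_(e i) f p + S) =
  crd i h * ('D_(e i) f (p + (H + s *: e i)) - 'D_(e i) f p)
  + (f (p + H) - f p - S).
  rewrite mulrBr (addrA p) -Es; ring.
apply: le_trans (ler_normD _ _) _.
have -> : eps * `|h| = eps / 2 * `|h| + eps / 2 * `|h| by field.
apply: lerD; last by rewrite /H /S; near: h; apply: IH.
rewrite normrM.
have -> : eps / 2 * `|h| = (k * `|h|) * (eps / 2 / k) by field; rewrite gt_eqF.
apply: ler_pM => //; apply: dP.
apply: le_lt_trans (ler_normD _ _) _.
rewrite [ltRHS]splitr; apply: ltrD; first by rewrite /H; near: h; apply: cH0.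
apply: (@le_lt_trans _ _ `|crd i h *: e i|).
  by rewrite !normrZ ler_wpM2r.
have : `|\sum_(j <- [:: i]) crd j h *: e j| < d / 2 by near: h; apply: cH0.
by rewrite big_seq1.
Unshelve. all: by end_near. Qed.

(** [Cn] speaks of directional derivatives only. Linearity in the direction and the chain rule need
    the total differential, obtained here from [C1_littleo] over all coordinates. *)
Lemma C1_differentiable m (f : V -> R) (p : V) : Cn m.+1 f ->
  is_diff p f (fun h => \sum_i crd i h * 'D_(e i) f p).
Proof.
move=> Cf; have df v x : derivable f x v by exact: Cn_derivable Cf.
have cDf v : continuous ('D_v f) by apply: Cn_continuous (Cn_derive v Cf).
pose d (h : V) := \sum_i crd i h * 'D_(e i) f p.
have lind : linear d.
  move=> a u v; rewrite /d scaler_sumr -big_split; apply: eq_bigr => i _ /=.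
  by rewrite linearP mulrDl scalerAl.
pose dM := GRing.isLinear.Build _ _ _ _ _ lind.
pose dL : {linear _ -> _} := HB.pack d dM.
have cd : continuous dL.
  apply: continuous_bigsum => i h.
  by apply: continuousM; [apply: crdc|apply: cst_continuous].
have dE : f \o shift p = cst (f p) + dL +o_ 0 id.
  apply/eqaddoP => eps eps0; near=> h.
  have : `|f (p + \sum_(i <- index_enum I) crd i h *: e i) - f p
      - \sum_(i <- index_enum I) crd i h * 'D_(e i) f p| <= eps * `|h|.
    by near: h; apply: C1_littleo.
  rewrite -crdE => Hh.
  rewrite [X in `|X|](_ : _ = f (p + h) - f p - d h) //.
  by rewrite !fctE /= opprD addrA [h + p]addrC.
have dd := diff_unique cd dE.
split; last exact: dd.
by apply/diff_locallyP; rewrite dd.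
Unshelve. all: by end_near. Qed.

End FiniteDimension.

(** * Chain rule and composition of functions of class C^n *)

Section Composition.
Variables (R : realType) (V W : normedModType R) (J I : finType).
Variables (e' : J -> V) (crd' : J -> {linear V -> R}).
Variables (e : I -> W) (crd : I -> {linear W -> R}).
Hypotheses (crdc' : forall i, continuous (crd' i))
  (crdE' : forall v, v = \sum_i crd' i v *: e' i).
Hypotheses (crdc : forall i, continuous (crd i))
  (crdE : forall v, v = \sum_i crd i v *: e i).
Implicit Types (f : W -> R).

Lemma diff_of_coord (U : normedModType R) (Q : U -> W) p :
  (forall i, differentiable (crd i \o Q) p) -> differentiable Q p.
Proof.
move=> dQ; have -> : Q = (fun x => \sum_i crd i (Q x) *: e i).
  by apply/funext => x; rewrite -crdE.
have -> : (fun x => \sum_i crd i (Q x) *: e i) =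
    \sum_i (fun x => crd i (Q x) *: e i).
  by apply/funext => x; rewrite fct_sumE.
elim/big_rec: _ => [|i g _ dg].
  exact: (differentiable_cst (0 : W)).
apply: differentiableD => //; apply: differentiableZl; exact: dQ.
Qed.

Lemma is_diff_C1_comp (U : normedModType R) m f (Q : U -> W) p : Cn m.+1 f ->
  (forall i, differentiable (crd i \o Q) p) ->
  is_diff p (f \o Q)
    (fun v => \sum_i 'd (crd i \o Q) p v * 'D_(e i) f (Q p)).
Proof.
move=> Cf dQ; have dQp := diff_of_coord dQ.
have df : is_diff (Q p) f (fun h => \sum_i crd i h * 'D_(e i) f (Q p)).
  exact: C1_differentiable Cf.
split; first exact: differentiable_comp.
rewrite diff_comp // [X in X \o _]diff_val; apply/funext => v /=.
apply: eq_bigr => i _; congr (_ * _).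
have dc : differentiable (crd i) (Q p).
  by apply: linear_differentiable; apply: crdc.
have -> : 'd (crd i \o Q) p = 'd (crd i) (Q p) \o 'd Q p :> (_ -> _).
  exact: diff_comp.
by rewrite diff_lin //; apply: crdc.
Qed.

(** A derivative of the composite is a sum of products of derivatives of the components of [Q] with
    partial derivatives of [f] at [Q]. The latter are again composites, of lower class, so the
    induction keeps [f] general. *)
Lemma Cn_comp m f (Q : V -> W) : Cn m f ->
  (forall i, Cn m (fun p => crd i (Q p))) -> Cn m (fun p => f (Q p)).
Proof.
elim: m f => [|m IH] f Cf CQ.
  split=> // p; apply: (@continuous_comp _ _ _ Q f); last exact: Cf.1.
  have -> : Q = (fun x => \sum_i crd i (Q x) *: e i).
    by apply/funext => x; rewrite -crdE.
  apply: (@continuous_bigsum _ _ _ _ _ _ (fun i x => crd i (Q x) *: e i)).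
  move=> i x; apply: (@continuousZr_tmp _ _ _ (fun x => crd i (Q x)) (e i) x).
  exact: (CQ i).1.
have dcQ i p : differentiable (crd i \o Q) p.
  have := C1_differentiable crdc' crdE' p (CQ i).
  by move=> D; exact: ex_diff.
have dfQ p := is_diff_C1_comp Cf (fun i => dcQ i p).
split=> [p|v].
  exact/differentiable_continuous/(@ex_diff _ _ _ _ _ _ _ (dfQ p)).
split=> [p|].
  exact/diff_derivable/(@ex_diff _ _ _ _ _ _ _ (dfQ p)).
rewrite (_ : 'D_v _ =
  fun p => \sum_i 'D_v (fun p => crd i (Q p)) p * 'D_(e i) f (Q p)).
  apply: Cn_sum => i; apply: CnM; first exact: Cn_derive (CQ i).
  apply: (IH ('D_(e i) f)); first exact: Cn_derive Cf.
  by move=> j; apply: CnW; apply: CQ.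
apply/funext => p; rewrite deriveE; last exact: (@ex_diff _ _ _ _ _ _ _ (dfQ p)).
rewrite (@diff_val _ _ _ _ _ _ _ (dfQ p)); apply: eq_bigr => i _.
by congr (_ * _); rewrite deriveE //; apply: dcQ.
Qed.

End Composition.

(** * Real coordinates on complex matrices *)

Section ComplexFunctions.
Variable R : realType.
Local Notation C := R[i].

Section Coordinates.
Variable d : nat.
Local Notation M := 'M[C]_d.+1.
Local Notation V := ('M[R]_d.+1 * 'M[R]_d.+1)%type.
Definition coord_index := (bool * ('I_d.+1 * 'I_d.+1))%type.
Local Notation I := coord_index.

Definition to_coord (x : M) : V :=
  (map_mx (@complex.Re R) x, map_mx (@complex.Im R) x).

Lemma to_coordK x : of_coord (to_coord x) = x.
Proof. by apply/matrixP => i j; rewrite !mxE; case: (x i j). Qed.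

Lemma of_coordK p : to_coord (of_coord p) = p.
Proof. by case: p => p q; congr pair; apply/matrixP => i j; rewrite !mxE. Qed.

Lemma of_coordD p q : of_coord (p + q) = of_coord p + of_coord q :> M.
Proof. by apply/matrixP => i j; rewrite !mxE. Qed.

Lemma of_coordZ t p : of_coord (t *: p) = t%:C *: of_coord p :> M.
Proof.
by apply/matrixP => i j; rewrite !mxE /=; apply/eqP; rewrite eq_complex /= !mul0r subr0 addr0 !eqxx.
Qed.

Lemma to_coordD x y : to_coord (x + y) = to_coord x + to_coord y.
Proof. by rewrite -[LHS]of_coordK -[RHS]of_coordK of_coordD !to_coordK. Qed.

Lemma to_coordZ t x : to_coord (t%:C *: x) = t *: to_coord x.
Proof. by rewrite -[LHS]of_coordK -[RHS]of_coordK of_coordZ !to_coordK. Qed.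

Definition crd_fun (i : I) (p : V) : R :=
  (if i.1 then p.1 else p.2) i.2.1 i.2.2.

Lemma crd_linear i : linear (crd_fun i).
Proof. by case: i => -[] [i j] a p q; rewrite /crd_fun /= !mxE. Qed.

HB.instance Definition _ (i : I) :=
  GRing.isLinear.Build R V R *%R (crd_fun i) (crd_linear i).

Definition crd (i : I) : {linear V -> R} := crd_fun i.

Definition crd_vec (i : I) : V :=
  if i.1 then (delta_mx i.2.1 i.2.2, 0) else (0, delta_mx i.2.1 i.2.2).

Lemma crd_continuous i : continuous (crd i).
Proof.
case: i => b [i j] p.
have c : {for p, continuous (fun q : V => if b then q.1 else q.2)}.
  by case: b; [apply: cvg_fst|apply: cvg_snd].
exact: (@continuous_comp _ _ _ (fun q : V => if b then q.1 else q.2)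
  (fun A : 'M[R]_d.+1 => A i j) p c (@coord_continuous R _ _ i j _)).
Qed.

Lemma crd_decomp p : p = \sum_i crd i p *: crd_vec i.
Proof.
have F (A : 'M[R]_d.+1) : \sum_(ij : 'I_d.+1 * 'I_d.+1)
    A ij.1 ij.2 *: delta_mx ij.1 ij.2 = A.
  by rewrite [RHS]matrix_sum_delta pair_bigA.
rewrite -(pair_bigA _ (fun b ij => crd (b, ij) p *: crd_vec (b, ij))) big_bool /=.
rewrite /crd_vec /=.
have -> : \sum_j crd (true, j) p *: ((delta_mx j.1 j.2, 0) : V) = (p.1, 0).
  rewrite -[in RHS](F p.1); elim/big_rec2: _ => // j y1 y2 _ ->.
  by congr pair; rewrite /= scaler0 addr0.
have -> : \sum_j crd (false, j) p *: ((0, delta_mx j.1 j.2) : V) = (0, p.2).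
  rewrite -[in RHS](F p.2); elim/big_rec2: _ => // j y1 y2 _ ->.
  by congr pair; rewrite /= scaler0 addr0.
by case: p => p q; congr pair; rewrite /= ?addr0 ?add0r.
Qed.

End Coordinates.
End ComplexFunctions.

(** * Smooth functions of complex matrices *)

Section SmoothFunctions.
Variable R : realType.
Local Notation C := R[i].

Section Fixed.
Variable d : nat.
Local Notation M := 'M[C]_d.+1.
Local Notation V := ('M[R]_d.+1 * 'M[R]_d.+1)%type.
Implicit Types (F G : M -> C) (x v : M).

Definition fRe F : V -> R := fun p => complex.Re (F (of_coord p)).
Definition fIm F : V -> R := fun p => complex.Im (F (of_coord p)).

Lemma cReD (y z : C) : @complex.Re R (y + z) = @complex.Re R y + @complex.Re R z.
Proof. by case: y z => [a b] [a' b']. Qed.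

Lemma cImD (y z : C) : @complex.Im R (y + z) = @complex.Im R y + @complex.Im R z.
Proof. by case: y z => [a b] [a' b']. Qed.

Lemma cRe_sum (I : Type) (r : seq I) (P : pred I) (F : I -> C) :
  @complex.Re R (\sum_(i <- r | P i) F i) = \sum_(i <- r | P i) @complex.Re R (F i).
Proof. exact: (big_morph _ cReD). Qed.

Lemma cIm_sum (I : Type) (r : seq I) (P : pred I) (F : I -> C) :
  @complex.Im R (\sum_(i <- r | P i) F i) = \sum_(i <- r | P i) @complex.Im R (F i).
Proof. exact: (big_morph _ cImD). Qed.

(** Existence of the derivative is part of the relation, whereas [rderiv] is total and has a junk
    value where the limit does not exist. The rules of calculus are proved for [is_rd] and
    transferred by [is_rd_rderiv]. *)
Definition is_rd F v x (l : C) : Prop :=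
  is_derive (to_coord x) (to_coord v) (fRe F) (complex.Re l) /\
  is_derive (to_coord x) (to_coord v) (fIm F) (complex.Im l).

Lemma rderivE F v x :
  rderiv F v x = 'D_(to_coord v) (fRe F) (to_coord x)
              +i* 'D_(to_coord v) (fIm F) (to_coord x).
Proof.
have E t : x + t%:C *: v = of_coord (t *: to_coord v + to_coord x).
  by rewrite of_coordD of_coordZ !to_coordK addrC.
rewrite /rderiv /derive1 /derive.
have L (f g : R -> R) : f =1 g ->
    (lim (f h @[h --> 0^']) = lim (g h @[h --> 0^']))%classic by move/funext->.
by congr Complex; apply: L => h /=; rewrite !addr0 scale0r addr0 /fRe /fIm -E to_coordK.
Qed.

Lemma is_rd_rderiv F v x l : is_rd F v x l -> rderiv F v x = l.
Proof. by case: l => a b [D1 D2]; rewrite rderivE !derive_val. Qed.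

Lemma smooth_rd F v x : smooth F -> is_rd F v x (rderiv F v x).
Proof.
move=> /(_ 1%N)[C1 C2]; rewrite rderivE; split; apply: derivableP.
  exact: Cn_derivable C1.
exact: Cn_derivable C2.
Qed.

Lemma is_rd_cst (c : C) v x : is_rd (fun=> c) v x 0.
Proof. by split; apply: is_derive_cst. Qed.

Lemma is_rdD F G v x l m : is_rd F v x l -> is_rd G v x m ->
  is_rd (fun y => F y + G y) v x (l + m).
Proof.
move=> [F1 F2] [G1 G2]; split.
  have -> : fRe (fun y => F y + G y) = fRe F + fRe G.
    by apply/funext => p; rewrite fctE /fRe cReD.
  by rewrite cReD; apply: is_deriveD.
have -> : fIm (fun y => F y + G y) = fIm F + fIm G.
  by apply/funext => p; rewrite fctE /fIm cImD.
by rewrite cImD; apply: is_deriveD.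
Qed.

Lemma cReM (y z : C) : @complex.Re R (y * z) =
  @complex.Re R y * @complex.Re R z - @complex.Im R y * @complex.Im R z.
Proof. by case: y z => [a b] [a' b']. Qed.

Lemma cImM (y z : C) : @complex.Im R (y * z) =
  @complex.Re R y * @complex.Im R z + @complex.Im R y * @complex.Re R z.
Proof. by case: y z => [a b] [a' b']. Qed.

Lemma is_rdM F G v x l m : is_rd F v x l -> is_rd G v x m ->
  is_rd (fun y => F y * G y) v x (l * G x + F x * m).
Proof.
move=> [F1 F2] [G1 G2]; split.
  have -> : fRe (fun y => F y * G y) = fRe F * fRe G - fIm F * fIm G.
    by apply/funext => p; rewrite !fctE /fRe /fIm cReM.
  apply: is_derive_eq.
  rewrite /fRe /fIm !to_coordK cReD !cReM /GRing.scale /=; ring.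
have -> : fIm (fun y => F y * G y) = fRe F * fIm G + fIm F * fRe G.
  by apply/funext => p; rewrite !fctE /fRe /fIm cImM.
apply: is_derive_eq.
rewrite /fRe /fIm !to_coordK cImD !cImM /GRing.scale /=; ring.
Qed.

Lemma is_rd_sum (I : Type) (r : seq I) (P : pred I) (F : I -> M -> C) v x l :
  (forall i, is_rd (F i) v x (l i)) ->
  is_rd (fun y => \sum_(i <- r | P i) F i y) v x (\sum_(i <- r | P i) l i).
Proof.
move=> H; elim: r => [|i r IH].
  rewrite big_nil (_ : (fun _ => _) = fun=> 0); first exact: is_rd_cst.
  by apply/funext => y; rewrite big_nil.
rewrite big_cons.
have -> : (fun y => \sum_(j <- i :: r | P j) F j y) =
   (fun y => if P i then F i y + \sum_(j <- r | P j) F j y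
             else \sum_(j <- r | P j) F j y).
  by apply/funext => y; rewrite big_cons.
by case: (P i) => //; apply: is_rdD.
Qed.

Lemma is_rd_entry i j v x : is_rd (fun y => y i j) v x (v i j).
Proof.
have L b : is_derive (to_coord x) (to_coord v) (crd R (b, (i, j)))
    (crd R (b, (i, j)) (to_coord v)).
  have dL : differentiable (crd R (b, (i, j))) (to_coord x).
    by apply: linear_differentiable; apply: crd_continuous.
  apply: DeriveDef; first exact: diff_derivable.
  by rewrite deriveE // diff_lin //; apply: crd_continuous.
split.
  have -> : fRe (fun y => y i j) = crd R (true, (i, j)).
    by apply/funext => p; rewrite /fRe mxE.
  by have := L true; rewrite {2}/crd /= /crd_fun /= mxE.
have -> : fIm (fun y => y i j) = crd R (false, (i, j)).
  by apply/funext => p; rewrite /fIm mxE.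
by have := L false; rewrite {2}/crd /= /crd_fun /= mxE.
Qed.

Lemma is_rd_conj F v x l : is_rd F v x l -> is_rd (fun y => conjc (F y)) v x (conjc l).
Proof.
move=> [F1 F2]; split.
  have -> : fRe (fun y => conjc (F y)) = fRe F.
    by apply/funext => p; rewrite /fRe; case: (F _).
  by case: l F1 F2.
have -> : fIm (fun y => conjc (F y)) = - fIm F.
  by apply/funext => p; rewrite fctE /fIm; case: (F _).
have -> : complex.Im (conjc l) = - complex.Im l by case: l F1 F2.
exact: is_deriveN.
Qed.

Lemma smooth_cst (c : C) : smooth (fun _ : M => c).
Proof. by move=> m; split; apply: Cn_cst. Qed.

Lemma smoothD F G : smooth F -> smooth G -> smooth (fun y => F y + G y).
Proof.
move=> sF sG m; have [F1 F2] := sF m; have [G1 G2] := sG m; split.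
  rewrite (_ : (fun _ => _) = (fun p => fRe F p + fRe G p)); first exact: CnD.
  by apply/funext => p; rewrite raddfD.
rewrite (_ : (fun _ => _) = (fun p => fIm F p + fIm G p)); first exact: CnD.
by apply/funext => p; rewrite raddfD.
Qed.

Lemma CnN m (f : V -> R) : Cn m f -> Cn m (fun p => - f p).
Proof.
move=> Cf; rewrite (_ : (fun _ => _) = (fun p => -1 * f p)).
  by apply: CnM => //; apply: Cn_cst.
by apply/funext => p; rewrite mulN1r.
Qed.

Lemma smoothM F G : smooth F -> smooth G -> smooth (fun y => F y * G y).
Proof.
move=> sF sG m; have [F1 F2] := sF m; have [G1 G2] := sG m; split.
  rewrite (_ : (fun _ => _) =
    (fun p => fRe F p * fRe G p + - (fIm F p * fIm G p))).
    by apply: CnD; [|apply: CnN]; apply: CnM.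
  by apply/funext => p; rewrite cReM.
rewrite (_ : (fun _ => _) = (fun p => fRe F p * fIm G p + fIm F p * fRe G p)).
  by apply: CnD; apply: CnM.
by apply/funext => p; rewrite cImM.
Qed.

Lemma smoothZ (c : C) F : smooth F -> smooth (fun y => c * F y).
Proof. by apply: smoothM; apply: smooth_cst. Qed.

Lemma smoothN F : smooth F -> smooth (fun y => - F y).
Proof.
move=> sF; rewrite (_ : (fun _ => _) = (fun y => -1 * F y)); first exact: smoothZ.
by apply/funext => y; rewrite mulN1r.
Qed.

Lemma smoothB F G : smooth F -> smooth G -> smooth (fun y => F y - G y).
Proof. by move=> sF sG; apply: smoothD => //; apply: smoothN. Qed.

Lemma smooth_sum (I : Type) (r : seq I) (P : pred I) (F : I -> M -> C) :
  (forall i, smooth (F i)) -> smooth (fun y => \sum_(i <- r | P i) F i y).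
Proof.
move=> sF; elim: r => [|i r IH].
  rewrite (_ : (fun _ => _) = fun=> 0); first exact: smooth_cst.
  by apply/funext => y; rewrite big_nil.
have -> : (fun y => \sum_(j <- i :: r | P j) F j y) =
   (fun y => if P i then F i y + \sum_(j <- r | P j) F j y
             else \sum_(j <- r | P j) F j y).
  by apply/funext => y; rewrite big_cons.
by case: (P i) => //; apply: smoothD.
Qed.

Lemma smoothX F n : smooth F -> smooth (fun y => F y ^+ n).
Proof.
move=> sF; elim: n => [|n IH]; first exact: smooth_cst.
by rewrite (_ : (fun _ => _) = (fun y => F y * F y ^+ n)); [apply: smoothM|
  apply/funext => y; rewrite exprS].
Qed.

Lemma smooth_conj F : smooth F -> smooth (fun y => conjc (F y)).
Proof.
move=> sF m; have [F1 F2] := sF m; split.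
  rewrite (_ : (fun _ => _) = fRe F) //.
  by apply/funext => p; rewrite /fRe; case: (F _).
rewrite (_ : (fun _ => _) = (fun p => - fIm F p)); first exact: CnN.
by apply/funext => p; rewrite /fIm; case: (F _).
Qed.

Lemma smooth_entry i j : smooth (fun y : M => y i j).
Proof.
move=> m; split.
  rewrite (_ : (fun _ => _) = crd R (true, (i, j))).
    by apply: Cn_linear; apply: crd_continuous.
  by apply/funext => p; rewrite mxE.
rewrite (_ : (fun _ => _) = crd R (false, (i, j))).
  by apply: Cn_linear; apply: crd_continuous.
by apply/funext => p; rewrite mxE.
Qed.

Lemma smooth_rderiv F v : smooth F -> smooth (rderiv F v).
Proof.
move=> sF m; have [F1 F2] := sF m.+1; split.
  rewrite (_ : (fun _ => _) = 'D_(to_coord v) (fRe F)).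
    exact: Cn_derive F1.
  by apply/funext => p; rewrite rderivE /= of_coordK.
rewrite (_ : (fun _ => _) = 'D_(to_coord v) (fIm F)).
  exact: Cn_derive F2.
by apply/funext => p; rewrite rderivE /= of_coordK.
Qed.

(** Linearity in the real direction [v], from total differentiability. It allows a direction that
    depends on the point, as for a left-invariant field: its coordinates become coefficients of
    derivatives in fixed directions. *)
Lemma rderiv_decomp F v x : smooth F ->
  rderiv F v x = \sum_i (crd R i (to_coord v))%:C
                        * rderiv F (of_coord (crd_vec R i)) x.
Proof.
move=> sF; have [F1 F2] := sF 1%N.
have D f : Cn 1 f -> 'D_(to_coord v) f (to_coord x) =
    \sum_i crd R i (to_coord v) * 'D_(crd_vec R i) f (to_coord x).
  move=> Cf; have D := C1_differentiable (@crd_continuous R d) (@crd_decomp R d)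
    (to_coord x) Cf.
  by rewrite deriveE; [rewrite diff_val|apply: ex_diff].
rewrite rderivE (D _ F1) (D _ F2); apply/eqP; rewrite eq_complex; apply/andP.
split; apply/eqP; rewrite /= ?cRe_sum ?cIm_sum; apply: eq_bigr => i _;
  rewrite rderivE of_coordK ?cReM ?cImM /=; ring.
Qed.

Lemma rderivZv F (t : R) v x : smooth F ->
  rderiv F (t%:C *: v) x = t%:C * rderiv F v x.
Proof.
move=> sF; rewrite !(rderiv_decomp _ _ sF) mulr_sumr; apply: eq_bigr => i _ /=.
by rewrite to_coordZ linearZ rmorphM mulrA.
Qed.

Lemma smooth_lderiv F (w : M -> M) : smooth F ->
  (forall i j, smooth (fun x => w x i j)) ->
  smooth (fun x => rderiv F (w x) x).
Proof.
move=> sF sw.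
rewrite (_ : (fun _ => _) = (fun x => \sum_i (crd R i (to_coord (w x)))%:C
                        * rderiv F (of_coord (crd_vec R i)) x)); last first.
  by apply/funext => x; apply: rderiv_decomp.
apply: smooth_sum => -[b [i j]]; apply: smoothM; last exact: smooth_rderiv.
move=> m; split; last exact: Cn_cst.
have [W1 W2] := sw i j m.
case: b.
  by rewrite (_ : (fun _ => _) = fRe (fun x => w x i j)) //; apply/funext => p;
    rewrite /fRe /crd /= /crd_fun /= mxE.
by rewrite (_ : (fun _ => _) = fIm (fun x => w x i j)) //; apply/funext => p;
  rewrite /fIm /crd /= /crd_fun /= mxE.
Qed.

Definition is_curve_derive (c : R -> M) (s : R) (w : M) : Prop :=
  forall i j, is_derive s 1 (fun t => complex.Re (c t i j)) (complex.Re (w i j))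
           /\ is_derive s 1 (fun t => complex.Im (c t i j)) (complex.Im (w i j)).

(** Only the velocity of the curve enters. Used for curves inside the group, this shows that
    tangential derivatives see only the restriction of [F]. *)
Lemma is_derive_curve F (c : R -> M) (s : R) w : smooth F ->
  is_curve_derive c s w ->
  is_derive s 1 (fun t => complex.Re (F (c t))) (complex.Re (rderiv F w (c s)))
  /\ is_derive s 1 (fun t => complex.Im (F (c t)))
       (complex.Im (rderiv F w (c s))).
Proof.
move=> sF cw; have [F1 F2] := sF 1%N.
pose Q t := to_coord (c t).
have DQ i : is_derive s 1 (crd R i \o Q) (crd R i (to_coord w)).
  case: i => -[] [i j]; have [D1 D2] := cw i j.
    rewrite (_ : _ \o _ = fun t => complex.Re (c t i j)); last first.
      by apply/funext => t; rewrite /= /crd_fun /= mxE.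
    by rewrite /crd /= /crd_fun /= mxE.
  rewrite (_ : _ \o _ = fun t => complex.Im (c t i j)); last first.
    by apply/funext => t; rewrite /= /crd_fun /= mxE.
  by rewrite /crd /= /crd_fun /= mxE.
have dQ i : differentiable (crd R i \o Q) s.
  by apply/derivable1_diffP; apply: ex_derive.
have D f : Cn 1 f -> is_derive s 1 (f \o Q) ('D_(to_coord w) f (Q s)).
  move=> Cf.
  have Df := is_diff_C1_comp (@crd_continuous R d) (@crd_decomp R d) Cf dQ.
  have df := C1_differentiable (@crd_continuous R d) (@crd_decomp R d) (Q s) Cf.
  apply: DeriveDef; first by apply: diff_derivable; apply: ex_diff.
  rewrite deriveE; last exact: ex_diff.
  rewrite deriveE; last exact: (@ex_diff _ _ _ _ _ _ _ df).
  rewrite (@diff_val _ _ _ _ _ _ _ df) diff_val; apply: eq_bigr => i _.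
  by congr (_ * _); rewrite -deriveE // derive_val.
rewrite rderivE; split.
  rewrite (_ : (fun _ => _) = fRe F \o Q); first exact: D.
  by apply/funext => t; rewrite /= /fRe to_coordK.
rewrite (_ : (fun _ => _) = fIm F \o Q); first exact: D.
by apply/funext => t; rewrite /= /fIm to_coordK.
Qed.

End Fixed.

Lemma smooth_comp (m n : nat) (F : 'M[C]_n.+1 -> C) (Q : 'M[C]_m.+1 -> 'M[C]_n.+1) :
  smooth F -> (forall i j, smooth (fun x => Q x i j)) -> smooth (fun x => F (Q x)).
Proof.
move=> sF sQ k; have [F1 F2] := sF k.
pose Q' (p : 'M[R]_m.+1 * 'M[R]_m.+1) := to_coord (Q (of_coord p)).
have CQ i : Cn k (fun p => crd R i (Q' p)).
  case: i => b [i j]; have [C1 C2] := sQ i j k; case: b.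
    by rewrite (_ : (fun _ => _) = fRe (fun x => Q x i j)) //; apply/funext => p;
      rewrite /fRe /crd /= /crd_fun /= mxE.
  by rewrite (_ : (fun _ => _) = fIm (fun x => Q x i j)) //; apply/funext => p;
    rewrite /fIm /crd /= /crd_fun /= mxE.
have E f : Cn k f -> Cn k (fun p => f (Q' p)).
  move=> Cf; apply: (Cn_comp (@crd_continuous R m) (@crd_decomp R m)
    (@crd_continuous R n) (@crd_decomp R n)) => //.
split.
  rewrite (_ : (fun _ => _) = (fun p => fRe F (Q' p))); first exact: E.
  by apply/funext => p; rewrite /fRe to_coordK.
rewrite (_ : (fun _ => _) = (fun p => fIm F (Q' p))); first exact: E.
by apply/funext => p; rewrite /fIm to_coordK.
Qed.

Lemma rderiv_comp (m n : nat) (F : 'M[C]_n.+1 -> C)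
    (Q : 'M[C]_m.+1 -> 'M[C]_n.+1) v x (w : 'M[C]_n.+1) :
  smooth F -> (forall i j, is_rd (fun y => Q y i j) v x (w i j)) ->
  rderiv (fun y => F (Q y)) v x = rderiv F w (Q x).
Proof.
move=> sF DQ.
have E : x + (0 : R)%:C *: v = x by rewrite scale0r addr0.
have : is_curve_derive (fun t => Q (x + t%:C *: v)) 0 w.
  move=> i j; have [D1 D2] := DQ i j.
  have L (f : 'M[C]_m.+1 -> R) l :
      is_derive (to_coord x) (to_coord v) (fun p => f (of_coord p)) l ->
      is_derive (0 : R) 1 (fun t => f (x + t%:C *: v)) l.
    move=> Df; have Df' := @is_derive_line R _ (fun p => f (of_coord p))
      (to_coord v) (to_coord x) 0.
    rewrite scale0r addr0 derive_val in Df'.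
    rewrite (_ : (fun _ => _) = (fun t =>
      f (of_coord (to_coord x + t *: to_coord v)))).
      by apply: Df'.
    by apply/funext => t; rewrite of_coordD of_coordZ !to_coordK.
  split; first exact: (L (fun y => complex.Re (Q y i j))).
  exact: (L (fun y => complex.Im (Q y i j))).
move=> /(is_derive_curve sF)[]; rewrite E => D1 D2.
by rewrite {1}/rderiv !derive1E !derive_val; case: (rderiv F w (Q x)).
Qed.

End SmoothFunctions.

(** * The invariant mean of Lipschitz functions on a totally bounded group *)

Section Mean.
Variables (R : realType) (T : Type).
Variables (mul : T -> T -> T) (one : T) (inv : T -> T).
Hypotheses (mulA : forall x y z, mul x (mul y z) = mul (mul x y) z)
  (mul1x : forall x, mul one x = x) (mulx1 : forall x, mul x one = x)
  (mulVx : forall x, mul (inv x) x = one) (mulxV : forall x, mul x (inv x) = one).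
Variables (D : T -> T -> R) (C : R).
Hypotheses (C0 : 0 < C) (DC : forall x y, D x y = D y x)
  (D_mulr : forall x y g, D (mul x g) (mul y g) <= C * D x y)
  (D_mull : forall x y g, D (mul g x) (mul g y) <= C * D x y)
  (D_net : forall e : R, 0 < e ->
     exists n (t : 'I_n -> T), forall x, exists i, D x (t i) <= e).
Implicit Types (f : T -> R) (s t : seq T) (x y z : T).

Definition lipschitz_fun f := exists2 L : R, 0 <= L &
  forall x y, `|f x - f y| <= L * D x y.

(** Right translates are averaged, because these are what left-invariant fields generate. *)
Definition avg s f x : R := (\sum_(h <- s) f (mul x h)) / (size s)%:R.

Let size_neq0 s : (0 < size s)%N -> (size s)%:R != 0 :> R.
Proof. by rewrite pnatr_eq0 lt0n. Qed.

Lemma avg_avg s t f x :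
  avg s (avg t f) x = avg [seq mul g h | g <- s, h <- t] f x.
Proof.
rewrite /avg size_allpairs natrM big_allpairs_dep /= -mulr_suml invfM.
rewrite mulrA mulrAC; congr (_ / _ / _).
by apply: eq_bigr => g _; apply: eq_bigr => h _; rewrite mulA.
Qed.

Lemma avg_size s t : (0 < size s)%N -> (0 < size t)%N ->
  (0 < size [seq mul g h | g <- s, h <- t])%N.
Proof. by rewrite size_allpairs muln_gt0 => -> ->. Qed.

Lemma avg_ge s f x (m : R) : (0 < size s)%N ->
  (forall h, m <= f (mul x h)) -> m <= avg s f x.
Proof.
move=> s0 mf; rewrite /avg ler_pdivlMr ?ltr0n //.
rewrite -[size s]sum1_size natr_sum mulr_sumr; apply: ler_sum => h _.
by rewrite mulr1.
Qed.

Lemma avg_le s f x (m : R) : (0 < size s)%N ->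
  (forall h, f (mul x h) <= m) -> avg s f x <= m.
Proof.
move=> s0 mf; rewrite /avg ler_pdivrMr ?ltr0n //.
rewrite -[size s]sum1_size natr_sum mulr_sumr; apply: ler_sum => h _.
by rewrite mulr1.
Qed.

Lemma avgD s f (g : T -> R) x : avg s (fun y => f y + g y) x = avg s f x + avg s g x.
Proof. by rewrite /avg big_split mulrDl. Qed.

Lemma avgZ s (k : R) f x : avg s (fun y => k * f y) x = k * avg s f x.
Proof. by rewrite /avg -mulr_sumr mulrA. Qed.

Lemma avg_cst s (k : R) x : (0 < size s)%N -> avg s (fun=> k) x = k.
Proof.
by move=> s0; apply/eqP; rewrite eq_le avg_le ?avg_ge.
Qed.

(** The constant [L * C] is the same for all [s]; this makes the contraction factor of
    [avg_contract] uniform. *)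
Lemma avg_lip s f (L : R) : (0 < size s)%N -> 0 <= L ->
  (forall x y, `|f x - f y| <= L * D x y) ->
  forall x y, `|avg s f x - avg s f y| <= L * C * D x y.
Proof.
move=> s0 L0 Lf x y; rewrite /avg -mulrBl -sumrB normrM normfV normr_nat.
rewrite ler_pdivrMr ?ltr0n //; apply: le_trans (ler_norm_sum _ _ _) _.
rewrite -[size s]sum1_size natr_sum mulr_sumr; apply: ler_sum => h _.
rewrite mulr1; apply: le_trans (Lf _ _) _.
by rewrite -mulrA ler_wpM2l.
Qed.

(** If the net point [t i] is near [x], then x (t i)^-1 y is near y. So the elements (t i)^-1 y
    serve, and their number does not depend on [y]. *)
Lemma net_at (e : R) : 0 < e -> exists2 n, (0 < n)%N &
  forall y, exists2 s, size s = n & forall x, exists i, (i < n)%N /\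
    D (mul x (nth one s i)) y <= e.
Proof.
move=> e0; have [n [t tP]] := D_net (divr_gt0 e0 C0).
have n0 : (0 < n)%N by have [i _] := tP one; apply: leq_ltn_trans (ltn_ord i).
exists n => // y; exists [seq mul (inv (t i)) y | i <- enum 'I_n].
  by rewrite size_map size_enum_ord.
move=> x; have [i ti] := tP x; exists i; split; first exact: ltn_ord.
rewrite (nth_map i) ?size_enum_ord // nth_ord_enum.
rewrite -{2}[y]mul1x -(mulxV (t i)) mulA -mulA -[X in D _ X]mulA.
apply: le_trans (D_mulr _ _ _) _.
by rewrite mulrC -ler_pdivlMr.
Qed.

Lemma lip_bounded f : lipschitz_fun f ->
  exists M : R, forall x, `|f x| <= M.
Proof.
case=> L L0 Lf; have [n [t tP]] := D_net ltr01.
exists (\sum_i `|f (t i)| + L) => x; have [i ti] := tP x.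
rewrite -[f x](subrK (f (t i))) addrC; apply: le_trans (ler_normD _ _) _.
apply: lerD.
  by rewrite (bigD1 i) //= lerDl sumr_ge0.
by apply: le_trans (Lf _ _) _; rewrite ler_piMr.
Qed.

(** Let F be an average with values in [m, M]. If F stays above the midpoint, m is raised to it.
    Otherwise F is at most the midpoint at some y, hence at most M - (M - m) / 4 near y, as it
    varies there by at most e / 4 <= (M - m) / 4. Averaging again over the n elements of [net_at]
    brings one of n values into that neighbourhood and lowers M by (M - m) / (4 n). *)
Lemma avg_contract f (e : R) : lipschitz_fun f -> 0 < e ->
  exists2 q : R, 0 <= q < 1 & forall s (m M : R), (0 < size s)%N ->
    (forall x, m <= avg s f x <= M) -> e <= M - m ->
    exists s' (m' M' : R), [/\ (0 < size s')%N,
      forall x, m' <= avg s' f x <= M' & M' - m' <= q * (M - m)].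
Proof.
move=> [L L0 Lf] e0.
have d0 : 0 < e / (4 * (L * C + 1)).
  by rewrite divr_gt0 // mulr_gt0 // ltr_wpDl // mulr_ge0 // ltW.
have [n n0 nP] := net_at d0.
have n0R : 0 < (4 * n%:R : R) by rewrite mulr_gt0 // ltr0n.
have n1R : 1 <= (n%:R : R) by rewrite ler1n.
have q1 : (4 * n%:R)^-1 <= (4^-1 : R).
  by rewrite lef_pV2 ?posrE // ler_peMr.
have q0 : 0 < (4 * n%:R)^-1 :> R by rewrite invr_gt0.
exists (1 - (4 * n%:R)^-1); first by apply/andP; split; lra.
move=> s m M s0 mM eM.
case: (pselect (exists y, avg s f y <= (m + M) / 2)) => [[y Fy]|nF]; last first.
  exists s, ((m + M) / 2), M; split=> // [x|].
    have /andP[_ ->] := mM x; rewrite andbT.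
    by rewrite leNgt; apply/negP => /ltW ?; apply: nF; exists x.
  have -> : M - (m + M) / 2 = 2^-1 * (M - m) by field.
  apply: ler_wpM2r; lra.
have [t tn tP] := nP y.
have t0 : (0 < size t)%N by rewrite tn.
exists [seq mul g h | g <- t, h <- s], m, (M - (4 * n%:R)^-1 * (M - m)).
split; first exact: avg_size; last first.
  rewrite mulrBl mul1r; lra.
move=> x; rewrite -avg_avg; apply/andP; split.
  by apply: avg_ge => // h; have /andP[] := mM (mul x h).
have [i [ilt iP]] := tP x.
have Fi : avg s f (mul x (nth one t i)) <= M - 4^-1 * (M - m).
  have LL := avg_lip s0 L0 Lf (mul x (nth one t i)) y.
  have : L * C * D (mul x (nth one t i)) y <= e / 4.
    apply: le_trans (ler_wpM2l _ iP) _; first by rewrite mulr_ge0 // ltW.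
    have LC1 : 0 < L * C + 1 by rewrite ltr_wpDl // mulr_ge0 // ltW.
    have -> : L * C * (e / (4 * (L * C + 1))) = e / 4 * (L * C / (L * C + 1)).
      by field; rewrite gt_eqF.
    apply: ler_piMr; first by rewrite divr_ge0 // ltW.
    by rewrite ler_pdivrMr // mul1r lerDl.
  move: LL; rewrite ler_norml => /andP[_ LL] LD; lra.
rewrite {1}/avg ler_pdivrMr ?ltr0n //.
have -> : (M - (4 * n%:R)^-1 * (M - m)) * (size t)%:R =
    M * (size t)%:R - 4^-1 * (M - m).
  rewrite tn; field; by rewrite gt_eqF // ltr0n.
have ilt' : (i < size t)%N by rewrite tn.
rewrite (big_nth one) big_mkord (bigD1 (Ordinal ilt')) //=.
apply: le_trans (lerD Fi _) _.
  by apply: (@ler_sum _ _ _ _ _ (fun=> M)) => j _; have /andP[] := mM (mul x (nth one t j)).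
rewrite sumr_const cardC1 card_ord tn.
have -> : n%:R = 1 + n.-1%:R :> R by rewrite -[1]/(1%:R) -natrD add1n prednK.
rewrite -mulr_natr; lra.
Qed.

Lemma avg_narrow f (e : R) : lipschitz_fun f -> 0 < e ->
  exists s (m : R), (0 < size s)%N /\ forall x, m <= avg s f x <= m + e.
Proof.
move=> Lf e0; have [q /andP[q0 q1] qP] := avg_contract Lf e0.
have [B fB] := lip_bounded Lf.
have B0 : 0 <= B by apply: le_trans (fB one).
have [N BN] : exists N, q ^+ N * (2 * B) < e.
  have B1 : 0 < 2 * B + 1 by lra.
  have : (GRing.exp q @ \oo --> (0 : R))%classic.
    by apply: cvg_expr; rewrite ger0_norm.
  move=> /cvgrPdist_lt /(_ _ (divr_gt0 e0 B1)) [].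
  move=> N _ /(_ N (leqnn N)); rewrite /= sub0r normrN ger0_norm ?exprn_ge0 //.
  rewrite ltr_pdivlMr // => H; exists N; apply: le_lt_trans H.
  by apply: ler_wpM2l; [apply: exprn_ge0|lra].
(* The contraction needs oscillation at least [e]; the first alternative records that the process
   has stopped. It starts from the oscillation [2 * B] of [f] itself. *)
have IH k : exists s (m M : R), [/\ (0 < size s)%N,
    forall x, m <= avg s f x <= M &
    (M - m <= e) \/ (M - m <= q ^+ k * (2 * B))].
  elim: k => [|k [s [m [M [s0 mM [Me|Mk]]]]]].
  - exists [:: one], (- B), B; split=> // [x|]; last by right; rewrite expr0; lra.
    by apply/andP; split; [apply: avg_ge|apply: avg_le] => // h;
       have := fB (mul x h); rewrite ler_norml => /andP[].
  - by exists s, m, M; split=> //; left.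
  - case: (leP (M - m) e) => Me; first by exists s, m, M; split=> //; left.
    have [s' [m' [M' [s0' mM' Mq]]]] := qP s m M s0 mM (ltW Me).
    exists s', m', M'; split=> //; right; apply: le_trans Mq _.
    by rewrite exprS -mulrA ler_wpM2l.
have [s [m [M [s0 mM Me]]]] := IH N.
exists s, m; split=> // x; have /andP[-> /= fM] := mM x.
by case: Me => Me; lra.
Qed.

Definition lavg s f x : R := (\sum_(h <- s) f (mul h x)) / (size s)%:R.

Lemma inv_mul x y : inv (mul x y) = mul (inv y) (inv x).
Proof.
have H : mul (mul x y) (mul (inv y) (inv x)) = one.
  by rewrite mulA -(mulA x) mulxV mulx1 mulxV.
by rewrite -[RHS]mul1x -(mulVx (mul x y)) -mulA H mulx1.
Qed.

Lemma inv_inv x : inv (inv x) = x.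
Proof. by rewrite -[RHS]mul1x -(mulVx (inv x)) -mulA mulVx mulx1. Qed.

(** Inversion exchanges left and right translations, so the right-sided result is applied to [f]
    after inversion. Inversion is Lipschitz because x^-1 and y^-1 are the translates of y and x by
    x^-1 on the left and y^-1 on the right. *)
Lemma lavg_narrow f (e : R) : lipschitz_fun f -> 0 < e ->
  exists s (m : R), (0 < size s)%N /\ forall x, m <= lavg s f x <= m + e.
Proof.
move=> [L L0 Lf] e0.
have Li : lipschitz_fun (fun x => f (inv x)).
  exists (L * (C * C)) => [|x y]; first by rewrite !mulr_ge0 // ltW.
  apply: le_trans (Lf _ _) _; rewrite -mulrA; apply: ler_wpM2l => //.
  have -> : D (inv x) (inv y) = D (mul (inv x) (mul y (inv y)))
                                  (mul (inv x) (mul x (inv y))).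
    by rewrite mulxV mulx1 mulA mulVx mul1x.
  apply: le_trans (D_mull _ _ _) _; rewrite -mulrA; apply: ler_wpM2l.
    exact: ltW.
  by rewrite DC.
have [s [m [s0 sP]]] := avg_narrow Li e0.
exists [seq inv h | h <- s], m; rewrite size_map; split=> // x.
rewrite /lavg size_map big_map.
rewrite (eq_bigr (fun h => f (inv (mul (inv x) h)))); first exact: sP.
by move=> h _; rewrite inv_mul inv_inv.
Qed.

(** This commutation, which is associativity, is the core of von Neumann's argument: a nearly
    constant left average and a nearly constant right average have a common refinement, so their
    constants nearly agree. *)
Lemma lavg_avg s t f x : lavg s (avg t f) x = avg t (lavg s f) x.
Proof.
rewrite /lavg /avg -mulr_suml -[in RHS]mulr_suml exchange_big /= mulrAC.
by congr (_ / _ / _); apply: eq_bigr => g _; apply: eq_bigr => h _; rewrite mulA.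
Qed.

Lemma lavg_bound s f x (m M : R) : (0 < size s)%N ->
  (forall y, m <= f y <= M) -> m <= lavg s f x <= M.
Proof.
move=> s0 mM; rewrite /lavg ler_pdivlMr ?ltr0n // ler_pdivrMr ?ltr0n //.
rewrite -[size s]sum1_size natr_sum !mulr_sumr.
by apply/andP; split; apply: ler_sum => h _; rewrite mulr1; have /andP[] := mM (mul h x).
Qed.

Definition is_mean f (c : R) := forall e : R, 0 < e ->
  exists2 s, (0 < size s)%N & forall x, `|avg s f x - c| <= e.

Lemma mean_uniq f c c' : lipschitz_fun f -> is_mean f c -> is_mean f c' -> c = c'.
Proof.
move=> Lf fc fc'; apply/eqP; rewrite -subr_eq0 -normr_le0; apply/ler_addgt0Pl => e e0.
rewrite addr0; have e3 : 0 < e / 3 by lra.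
have [s [m [s0 sP]]] := lavg_narrow Lf e3.
have K c1 : is_mean f c1 -> m - e / 3 <= c1 <= m + e / 3 + e / 3.
  move=> /(_ _ e3)[t t0 tP].
  have H1 : c1 - e / 3 <= lavg s (avg t f) one <= c1 + e / 3.
    by apply: lavg_bound => // y; have := tP y; rewrite ler_norml => /andP[A B];
       apply/andP; split; lra.
  have H2 : m <= lavg s (avg t f) one <= m + e / 3.
    rewrite lavg_avg; apply/andP; split; [apply: avg_ge|apply: avg_le] => // h;
      by have /andP[] := sP (mul one h).
  by move: H1 H2 => /andP[? ?] /andP[? ?]; apply/andP; split; lra.
by have /andP[? ?] := K _ fc; have /andP[? ?] := K _ fc'; rewrite ler_norml; apply/andP; split; lra.
Qed.

(** The mean is the supremum of the lower bounds of right averages. Comparison through a nearly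
    constant left average shows that each such lower bound is below each upper bound of any other
    right average; so the supremum lies in every interval found by [avg_narrow]. *)
Lemma mean_ex f : lipschitz_fun f -> exists c, is_mean f c.
Proof.
move=> Lf.
pose S : set R := fun m => exists s, (0 < size s)%N /\ forall x, m <= avg s f x.
have SM s (M m : R) : (0 < size s)%N -> (forall x, avg s f x <= M) -> S m -> m <= M.
  move=> s0 sM [t [t0 tm]]; apply/ler_addgt0Pl => e e0.
  have [r [p [r0 rP]]] := lavg_narrow Lf e0.
  have H1 : m <= p + e.
    have : lavg r (avg t f) one <= p + e.
      by rewrite lavg_avg; apply: avg_le => // h; have /andP[] := rP (mul one h).
    apply: le_trans; rewrite /lavg ler_pdivlMr ?ltr0n //.
    rewrite -[size r]sum1_size natr_sum !mulr_sumr.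
    by apply: ler_sum => h _; rewrite mulr1.
  have H2 : p <= M.
    have : p <= lavg r (avg s f) one.
      by rewrite lavg_avg; apply: avg_ge => // h; have /andP[] := rP (mul one h).
    move/le_trans; apply; rewrite /lavg ler_pdivrMr ?ltr0n //.
    rewrite -[size r]sum1_size natr_sum !mulr_sumr.
    by apply: ler_sum => h _; rewrite mulr1.
  lra.
exists (sup S) => e e0; have [s [m [s0 sP]]] := avg_narrow Lf e0.
have Sm : S m by exists s; split=> // x; have /andP[] := sP x.
have hs : has_sup S.
  split; first by exists m.
  by exists (m + e) => y; apply: (SM s) => // x; have /andP[] := sP x.
exists s => // x; have /andP[A B] := sP x.
have c1 : m <= sup S by apply: ub_le_sup => //; case: hs.
have c2 : sup S <= m + e.
  apply: ge_sup; first by exists m.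
  by move=> y; apply: (SM s) => // z; have /andP[] := sP z.
by rewrite ler_norml; apply/andP; split; lra.
Qed.

Definition mean f : R := xget 0 (is_mean f : set R).

Lemma meanP f : lipschitz_fun f -> is_mean f (mean f).
Proof. by move=> Lf; have [c fc] := mean_ex Lf; apply: (xgetPex 0); exists c. Qed.

Lemma meanE f c : lipschitz_fun f -> is_mean f c -> mean f = c.
Proof. by move=> Lf; apply: mean_uniq => //; apply: meanP. Qed.

Lemma lip_cst (k : R) : lipschitz_fun (fun=> k).
Proof. by exists 0 => // x y; rewrite subrr normr0 mul0r. Qed.

Lemma lipD f (g : T -> R) : lipschitz_fun f -> lipschitz_fun g ->
  lipschitz_fun (fun x => f x + g x).
Proof.
move=> [L L0 Lf] [K K0 Kg]; exists (L + K) => [|x y]; first exact: addr_ge0.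
rewrite opprD addrACA mulrDl; apply: le_trans (ler_normD _ _) _.
exact: lerD.
Qed.

Lemma lipM f (g : T -> R) : lipschitz_fun f -> lipschitz_fun g ->
  lipschitz_fun (fun x => f x * g x).
Proof.
move=> Lf Lg; have [B fB] := lip_bounded Lf; have [B' gB] := lip_bounded Lg.
case: Lf Lg => L L0 Lf [K K0 Kg].
have B0 : 0 <= B by apply: le_trans (fB one).
have B0' : 0 <= B' by apply: le_trans (gB one).
exists (B * K + L * B') => [|x y]; first by rewrite addr_ge0 // mulr_ge0.
have -> : f x * g x - f y * g y = f x * (g x - g y) + (f x - f y) * g y by ring.
apply: le_trans (ler_normD _ _) _; rewrite [leRHS]mulrDl !normrM; apply: lerD.
  by rewrite -mulrA ler_pM.
by rewrite mulrAC ler_pM.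
Qed.

Lemma lipZ (k : R) f : lipschitz_fun f -> lipschitz_fun (fun x => k * f x).
Proof. by apply: lipM; apply: lip_cst. Qed.

Lemma lip_shift f h : lipschitz_fun f -> lipschitz_fun (fun x => f (mul x h)).
Proof.
case=> L L0 Lf; exists (L * C) => [|x y]; first by rewrite mulr_ge0 // ltW.
by apply: le_trans (Lf _ _) _; rewrite -mulrA ler_wpM2l.
Qed.

Lemma lip_avg s f : (0 < size s)%N -> lipschitz_fun f -> lipschitz_fun (avg s f).
Proof.
move=> s0 [L L0 Lf]; exists (L * C); first by rewrite mulr_ge0 // ltW.
exact: avg_lip.
Qed.

Lemma mean_cst (k : R) : mean (fun=> k) = k.
Proof.
apply: meanE; first exact: lip_cst.
by move=> e e0; exists [:: one] => // x; rewrite avg_cst // subrr normr0 ltW.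
Qed.

Lemma meanZ (k : R) f : lipschitz_fun f -> mean (fun x => k * f x) = k * mean f.
Proof.
move=> Lf; apply: meanE; first exact: lipZ.
move=> e e0; have k1 : 0 < `|k| + 1 by rewrite ltr_wpDl.
have [s s0 sP] := meanP Lf (divr_gt0 e0 k1); exists s => // x.
rewrite avgZ -mulrBr normrM; apply: le_trans (ler_wpM2l (normr_ge0 _) (sP x)) _.
rewrite mulrCA ler_piMr ?(ltW e0) // ler_pdivrMr // mul1r.
by rewrite lerDl.
Qed.

Lemma mean_avg s f : (0 < size s)%N -> lipschitz_fun f -> mean (avg s f) = mean f.
Proof.
move=> s0 Lf; symmetry; apply: meanE => // e e0.
have [t t0 tP] := meanP (lip_avg s0 Lf) e0.
exists [seq mul g h | g <- t, h <- s]; first exact: avg_size.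
by move=> x; rewrite -avg_avg.
Qed.

(** The two functions have different averaging lists. The list for [f] is applied first, and a
    second list is chosen for the resulting average of [g], whose mean is that of [g]; the second
    averaging keeps the average of [f] close to its constant. *)
Lemma meanD f (g : T -> R) : lipschitz_fun f -> lipschitz_fun g ->
  mean (fun x => f x + g x) = mean f + mean g.
Proof.
move=> Lf Lg; apply: meanE; first exact: lipD.
move=> e e0; have e2 : 0 < e / 2 by lra.
have [s s0 sP] := meanP Lf e2.
have [t t0] := meanP (lip_avg s0 Lg) e2; rewrite mean_avg // => tP.
exists [seq mul g h | g <- t, h <- s]; first exact: avg_size.
move=> x; rewrite avgD -!avg_avg opprD addrACA.
apply: le_trans (ler_normD _ _) _; rewrite [leRHS]splitr; apply: lerD => //.
rewrite ler_norml; apply/andP; split.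
  rewrite lerBrDr; apply: avg_ge => // h; have := sP (mul x h).
  by rewrite ler_norml => /andP[]; lra.
rewrite lerBlDr; apply: avg_le => // h; have := sP (mul x h).
by rewrite ler_norml => /andP[]; lra.
Qed.

Lemma mean_ge0 f : lipschitz_fun f -> (forall x, 0 <= f x) -> 0 <= mean f.
Proof.
move=> Lf f0; apply/ler_addgt0Pl => e e0; have [s s0 sP] := meanP Lf e0.
have := sP one; rewrite ler_norml => /andP[_ A].
have : 0 <= avg s f one by apply: avg_ge.
lra.
Qed.

Lemma mean_le f (g : T -> R) : lipschitz_fun f -> lipschitz_fun g ->
  (forall x, f x <= g x) -> mean f <= mean g.
Proof.
move=> Lf Lg fg; rewrite -subr_ge0 -[- mean f]mulN1r -meanZ // -meanD //.
  by apply: mean_ge0 => [|x]; [apply: lipD => //; apply: lipZ|have := fg x; lra].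
exact: lipZ.
Qed.

Lemma mean_shift f h : lipschitz_fun f -> mean (fun x => f (mul x h)) = mean f.
Proof.
move=> Lf; apply: meanE; first exact: lip_shift.
move=> e e0; have [s s0 sP] := meanP Lf e0.
exists [seq mul g (inv h) | g <- s]; rewrite ?size_map // => x.
rewrite /avg size_map big_map; have := sP x; rewrite /avg.
by under [in X in _ -> X]eq_bigr do rewrite -mulA -mulA mulVx mulx1.
Qed.

Lemma lip_sum (I : Type) (r : seq I) (F : I -> T -> R) :
  (forall i, lipschitz_fun (F i)) -> lipschitz_fun (fun x => \sum_(i <- r) F i x).
Proof.
move=> LF; elim: r => [|i r IH].
  by rewrite (_ : (fun _ => _) = fun=> 0); [apply: lip_cst|
    apply/funext => x; rewrite big_nil].
rewrite (_ : (fun _ => _) = (fun x => F i x + \sum_(i <- r) F i x)).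
  exact: lipD.
by apply/funext => x; rewrite big_cons.
Qed.

Lemma mean_sum (I : Type) (r : seq I) (F : I -> T -> R) :
  (forall i, lipschitz_fun (F i)) ->
  mean (fun x => \sum_(i <- r) F i x) = \sum_(i <- r) mean (F i).
Proof.
move=> LF; elim: r => [|i r IH].
  rewrite big_nil (_ : (fun _ => _) = fun=> 0); first exact: mean_cst.
  by apply/funext => x; rewrite big_nil.
rewrite (_ : (fun _ => _) = (fun x => F i x + \sum_(i <- r) F i x)).
  by rewrite meanD ?IH ?big_cons //; apply: lip_sum.
by apply/funext => x; rewrite big_cons.
Qed.

(* The bound is uniform in f: n is the number of translates of the e-ball that
   are needed to cover the group. *)
Lemma mean_lower_bound (e : R) : 0 < e -> exists2 n, (0 < n)%N &
  forall f x0 (eta : R), lipschitz_fun f -> (forall x, 0 <= f x) ->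
    (forall x, D x x0 <= e -> eta <= f x) -> eta <= n%:R * mean f.
Proof.
move=> e0; have [n n0 nP] := net_at e0; exists n => // f x0 eta Lf f0 fe.
have [s sn sP] := nP x0.
have -> : n%:R * mean f = mean (fun x => \sum_(h <- s) f (mul x h)).
  rewrite mean_sum; last by move=> h; apply: lip_shift.
  under eq_bigr do rewrite mean_shift //.
  by rewrite big_const_seq count_predT sn iter_addr_0 mulr_natl.
rewrite -[eta]mean_cst; apply: mean_le; first exact: lip_cst.
  by apply: lip_sum => h; apply: lip_shift.
move=> x; have [i [ilt iP]] := sP x.
apply: le_trans (fe _ iP) _; rewrite (big_nth one) big_mkord.
have ilt' : (i < size s)%N by rewrite sn.
by rewrite (bigD1 (Ordinal ilt')) //= lerDl sumr_ge0.
Qed.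

End Mean.

Local Open Scope sesquilinear_scope.
(** * The group SU(2) *)

Section SU2Group.
Variable R : realType.
Local Notation C := R[i].
Local Notation M2 := 'M[C]_2.
Implicit Types (x y v : M2).

Definition o0 : 'I_2 := ord0.
Definition o1 : 'I_2 := ord_max.

Lemma ord2P (i : 'I_2) : i = o0 \/ i = o1.
Proof. by case: i => [[|[|i]] Hi] //; [left|right]; apply: val_inj. Qed.

Lemma sum2 (V : nmodType) (F : 'I_2 -> V) : \sum_i F i = F o0 + F o1.
Proof.
rewrite !big_ord_recl big_ord0 addr0; congr (F _ + F _); exact: val_inj.
Qed.

Lemma mx2P x y : x o0 o0 = y o0 o0 -> x o0 o1 = y o0 o1 -> x o1 o0 = y o1 o0 ->
  x o1 o1 = y o1 o1 -> x = y.
Proof.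
move=> H1 H2 H3 H4; apply/matrixP => i j.
by case: (ord2P i) => ->; case: (ord2P j) => ->.
Qed.

Lemma det2 x : \det x = x o0 o0 * x o1 o1 - x o0 o1 * x o1 o0.
Proof.
rewrite (expand_det_row x o0) sum2 /cofactor !det_mx11 !mxE /=.
rewrite expr0 mul1r expr1 mulN1r mulrN.
congr (_ * x _ _ - _ * x _ _); exact: val_inj.
Qed.

(** The adjugate is the inverse on SU(2), and it is linear in the entries on all matrices, so that
    it can be differentiated in the ambient space. *)
Definition adj2 x : M2 := mx22 (x o1 o1) (- x o0 o1) (- x o1 o0) (x o0 o0).

Lemma mul_adj2 x : x *m adj2 x = (\det x)%:M.
Proof.
rewrite det2; apply: mx2P; rewrite !mxE sum2 !mxE /= ?mulr1n ?mulr0n; ring.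
Qed.

Lemma adj2M x y : adj2 (x *m y) = adj2 y *m adj2 x.
Proof. by apply: mx2P; rewrite !mxE !sum2 !mxE /= ; ring. Qed.

Lemma conjE (z : C) : Num.conj z = conjc z.
Proof. by []. Qed.

Lemma conjcN (z : C) : conjc (- z) = - conjc z.
Proof. by case: z. Qed.

Lemma conjcD (y z : C) : conjc (y + z) = conjc y + conjc z.
Proof. exact: (raddfD (@conjc R)). Qed.

Lemma conjcM (y z : C) : conjc (y * z) = conjc y * conjc z.
Proof. exact: (rmorphM (@conjc R)). Qed.

Lemma SU2P x : SU2 x <-> [/\ x o1 o1 = conjc (x o0 o0), x o1 o0 = - conjc (x o0 o1) &
  x o0 o0 * conjc (x o0 o0) + x o0 o1 * conjc (x o0 o1) = 1].
Proof.
split.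
  case=> /unitarymxP xU xD.
  have E : adj2 x = x ^t*.
    have : x^t* *m (x *m adj2 x) = x^t* by rewrite mul_adj2 xD mulmx1.
    by rewrite mulmxA (mulmx1C xU) mul1mx.
  have H i j : adj2 x i j = conjc (x j i) by rewrite E !mxE.
  have H00 : x o1 o1 = conjc (x o0 o0) by rewrite -H mxE.
  have H01 : - x o1 o0 = conjc (x o0 o1) by rewrite -H mxE.
  split=> //.
    by have := congr1 -%R H01; rewrite opprK.
  by rewrite -H00 -H01 mulrN -det2.
case=> H1 H2 H3; have xD : \det x = 1 by rewrite det2 H1 H2 mulrN opprK.
split=> //; apply/unitarymxP.
have -> : x ^t* = adj2 x.
  apply: mx2P; rewrite !mxE /= ?H1 ?H2 // !conjE ?conjcK ?opprK //.
  by rewrite conjcN conjcK.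
by rewrite mul_adj2 xD.
Qed.

Lemma SU2_det x : SU2 x -> \det x = 1.
Proof. by case. Qed.

Lemma SU2_mulV x : SU2 x -> x *m adj2 x = 1%:M.
Proof. by move=> /SU2_det xD; rewrite mul_adj2 xD. Qed.

Lemma SU2_mulVx x : SU2 x -> adj2 x *m x = 1%:M.
Proof. by move=> /SU2_mulV /mulmx1C. Qed.

Lemma SU2_1 : SU2 (1%:M : M2).
Proof. by split; [apply/unitarymxP; rewrite trmx1 map_mx1 mulmx1|rewrite det1]. Qed.

Lemma SU2_mul x y : SU2 x -> SU2 y -> SU2 (x *m y).
Proof.
move=> [xU xD] [yU yD]; split; first exact: (mul_unitarymx xU yU).
by rewrite det_mulmx xD yD mulr1.
Qed.

Lemma adj2K x : adj2 (adj2 x) = x.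
Proof. by apply: mx2P; rewrite !mxE /= ?opprK. Qed.

Lemma det_adj2 x : \det (adj2 x) = \det x.
Proof. by rewrite !det2 !mxE /=; ring. Qed.

Lemma SU2_adj x : SU2 x -> SU2 (adj2 x).
Proof.
move=> /SU2P[H1 H2 H3]; apply/SU2P; rewrite !mxE /=; split.
- by rewrite H1 conjcK.
- by rewrite conjcN H2.
- by rewrite conjcN mulrNN H1 conjcK [X in X + _]mulrC.
Qed.

Lemma SU2_invmx x : SU2 x -> invmx x = adj2 x.
Proof.
move=> xS; have xU : x \in unitmx by rewrite unitmxE SU2_det // unitr1.
by rewrite -[LHS]mulmx1 -(SU2_mulV xS) mulmxA mulVmx // mul1mx.
Qed.

(** The quaternion q0 + q1 E_1 + q2 E_2 + q3 E_3. SU(2) consists of the unit ones, which turns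
    statements about it into real polynomial arithmetic. *)
Definition quat (q0 q1 q2 q3 : R) : M2 :=
  mx22 (q0 +i* q1) (q2 +i* q3) ((- q2) +i* q3) (q0 -i* q1).

Lemma SU2_quat q0 q1 q2 q3 :
  q0 ^+ 2 + q1 ^+ 2 + q2 ^+ 2 + q3 ^+ 2 = 1 -> SU2 (quat q0 q1 q2 q3).
Proof.
move=> H; apply/SU2P; rewrite !mxE /=; split=> //.
  by apply/eqP; rewrite eq_complex /= opprK !eqxx.
by apply/eqP; rewrite eq_complex /= -H; apply/andP; split; apply/eqP; ring.
Qed.

Lemma SU2_quatP x : SU2 x -> exists q0 q1 q2 q3 : R,
  q0 ^+ 2 + q1 ^+ 2 + q2 ^+ 2 + q3 ^+ 2 = 1 /\ x = quat q0 q1 q2 q3.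
Proof.
move=> /SU2P[H1 H2 H3].
exists (complex.Re (x o0 o0)), (complex.Im (x o0 o0)),
  (complex.Re (x o0 o1)), (complex.Im (x o0 o1)); split.
  move: H3; case: (x o0 o0) => p q; case: (x o0 o1) => r s /eqP.
  by rewrite eq_complex /= => /andP[/eqP <- _]; ring.
apply: mx2P; rewrite !mxE /=.
- by case: (x o0 o0).
- by case: (x o0 o1).
- by rewrite H2; case: (x o0 o1) => ? ?; apply/eqP; rewrite eq_complex /= opprK !eqxx.
- by rewrite H1; case: (x o0 o0).
Qed.

Lemma suEE : [/\ suE R ord0 = mx22 (0 +i* 1) 0 0 (0 -i* 1),
  suE R (inord 1) = mx22 0 1 (- 1) 0 &
  suE R (inord 2) = mx22 0 (0 +i* 1) (0 +i* 1) 0].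
Proof. by rewrite /suE !inordK. Qed.

Lemma ord3P (i : 'I_3) : [\/ i = ord0, i = inord 1 | i = inord 2].
Proof.
by case: i => [[|[|[|i]]] Hi] //; [apply: Or31|apply: Or32|apply: Or33];
  apply: val_inj; rewrite /= ?inordK.
Qed.

Lemma suE_sq i : suE R i *m suE R i = - 1%:M.
Proof.
have [E0 E1 E2] := suEE.
by case: (ord3P i) => ->; rewrite ?E0 ?E1 ?E2; apply: mx2P;
  rewrite !mxE sum2 !mxE /=; apply/eqP; rewrite eq_complex /=;
  apply/andP; split; apply/eqP; ring.
Qed.

(** The one-parameter group exp (t E_i), in closed form because E_i^2 = -1. *)
Definition surot (i : 'I_3) (t : R) : M2 :=
  (cos t)%:C *: 1%:M + (sin t)%:C *: suE R i.

Lemma surotE i t : surot i t =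
  quat (cos t) (if i == 0 then sin t else 0) (if i == 1 then sin t else 0)
               (if i == 2 then sin t else 0).
Proof.
have [E0 E1 E2] := suEE; rewrite /surot.
have I1 : inord 1 = 1 :> 'I_3 by apply: val_inj; rewrite /= inordK.
have I2 : inord 2 = 2 :> 'I_3 by apply: val_inj; rewrite /= inordK.
case: (ord3P i) => ->; rewrite ?E0 ?E1 ?E2 ?I1 ?I2 /=;
  by apply: mx2P; rewrite !mxE /=; apply/eqP; rewrite eq_complex /=;
  apply/andP; split; apply/eqP; ring.
Qed.

Lemma SU2_rot i t : SU2 (surot i t).
Proof.
rewrite surotE; apply: SU2_quat.
have := cos2Dsin2 t; have I1 : inord 1 = 1 :> 'I_3 by apply: val_inj; rewrite /= inordK.
have I2 : inord 2 = 2 :> 'I_3 by apply: val_inj; rewrite /= inordK.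
by case: (ord3P i) => ->; rewrite ?I1 ?I2 /= => <-; ring.
Qed.

Lemma surot0 i : surot i 0 = 1%:M.
Proof. by rewrite /surot cos0 sin0 scale0r addr0 scale1r. Qed.

Lemma rot_curve x i (s : R) : is_curve_derive (fun t => x *m surot i t) s
  (x *m surot i s *m suE R i).
Proof.
move=> p q.
have E t : (x *m surot i t) p q =
    (cos t)%:C * x p q + (sin t)%:C * (x *m suE R i) p q.
  by rewrite /surot mulmxDr -!scalemxAr mulmx1 !mxE.
have -> : (x *m surot i s *m suE R i) p q =
    (- sin s)%:C * x p q + (cos s)%:C * (x *m suE R i) p q.
  rewrite /surot mulmxDr mulmxDl -!scalemxAr -!scalemxAl mulmx1 -[x *m _ *m _]mulmxA.
  by rewrite suE_sq mulmxN mulmx1 scalerN addrC -scaleNr -rmorphN !mxE.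
split.
  rewrite (_ : (fun t => _) = (fun t => cos t * complex.Re (x p q)
      + sin t * complex.Re ((x *m suE R i) p q))); last first.
    by apply/funext => t; rewrite E cReD !cReM /= !mul0r !subr0.
  rewrite cReD !cReM /= !mul0r !subr0.
  apply: is_derive_eq; rewrite /GRing.scale /=; ring.
rewrite (_ : (fun t => _) = (fun t => cos t * complex.Im (x p q)
    + sin t * complex.Im ((x *m suE R i) p q))); last first.
  by apply/funext => t; rewrite E cImD !cImM /= !mul0r !addr0.
rewrite cImD !cImM /= !mul0r !addr0.
apply: is_derive_eq; rewrite /GRing.scale /=; ring.
Qed.

Definition suX (i : 'I_3) (F : M2 -> C) : M2 -> C :=
  fun x => rderiv F (x *m suE R i) x.

Lemma suX_rot F x i (s : R) : smooth F ->
  is_derive s 1 (fun t => complex.Re (F (x *m surot i t)))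
    (complex.Re (suX i F (x *m surot i s))) /\
  is_derive s 1 (fun t => complex.Im (F (x *m surot i t)))
    (complex.Im (suX i F (x *m surot i s))).
Proof. by move=> sF; apply: (is_derive_curve sF (rot_curve x i s)). Qed.

(** The field is tangent to SU(2): its value at [x] is the derivative along x exp (t E_i), a curve
    in the group. Hence identities valid only on the group may be differentiated. *)
Lemma suX_ext F G x i : smooth F -> smooth G ->
  (forall y, SU2 y -> F y = G y) -> SU2 x -> suX i F x = suX i G x.
Proof.
move=> sF sG FG xS; have [F1 F2] := suX_rot x i 0 sF.
have [G1 G2] := suX_rot x i 0 sG; rewrite surot0 mulmx1 in F1 F2 G1 G2.
have E t : F (x *m surot i t) = G (x *m surot i t).
  by apply: FG; apply: SU2_mul => //; apply: SU2_rot.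
have EE : (fun t => complex.Re (F (x *m surot i t))) =
  (fun t => complex.Re (G (x *m surot i t))) by apply/funext => t; rewrite E.
have EI : (fun t => complex.Im (F (x *m surot i t))) =
  (fun t => complex.Im (G (x *m surot i t))) by apply/funext => t; rewrite E.
have : complex.Re (suX i F x) = complex.Re (suX i G x).
  by rewrite -(@derive_val _ _ _ _ _ _ _ F1) EE derive_val.
have : complex.Im (suX i F x) = complex.Im (suX i G x).
  by rewrite -(@derive_val _ _ _ _ _ _ _ F2) EI derive_val.
by case: (suX i F x) (suX i G x) => [p q] [p' q'] /= -> ->.
Qed.

Lemma smooth_suX i F : smooth F -> smooth (suX i F).
Proof.
move=> sF; apply: smooth_lderiv => // p q.
rewrite (_ : (fun x => _) = (fun x : M2 => \sum_k x p k * suE R i k q)).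
  apply: smooth_sum => k; apply: smoothM; first exact: smooth_entry.
  exact: smooth_cst.
by apply/funext => x; rewrite mxE.
Qed.

End SU2Group.

(** * Finite nets and Lipschitz functions on SU(2) *)

Section SU2Mean.
Variable R : realType.
Local Notation C := R[i].
Local Notation M2 := 'M[C]_2.
Implicit Types (F G : M2 -> C).

(** The l^1 norm, in place of the modulus, keeps the estimates linear in the real coordinates. *)
Definition cabs (z : C) : R := `|complex.Re z| + `|complex.Im z|.

Lemma cabs_ge0 (z : C) : 0 <= cabs z.
Proof. by rewrite addr_ge0. Qed.

Lemma cabsD (y z : C) : cabs (y + z) <= cabs y + cabs z.
Proof.
rewrite /cabs cReD cImD addrACA; apply: lerD; exact: ler_normD.
Qed.

Lemma cabsN (z : C) : cabs (- z) = cabs z.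
Proof. by case: z => a b; rewrite /cabs /= !normrN. Qed.

Lemma cabsM (y z : C) : cabs (y * z) <= cabs y * cabs z.
Proof.
rewrite /cabs cReM cImM.
apply: (@le_trans _ _ ((`|complex.Re y| * `|complex.Re z| + `|complex.Im y| * `|complex.Im z|)
  + (`|complex.Re y| * `|complex.Im z| + `|complex.Im y| * `|complex.Re z|))).
  by apply: lerD; [apply: le_trans (ler_normB _ _) _|apply: le_trans (ler_normD _ _) _];
    rewrite !normrM.
by rewrite le_eqVlt; apply/orP; left; apply/eqP; ring.
Qed.

Definition norm1 (x : M2) : R := \sum_i \sum_j cabs (x i j).

Lemma SU2_cabs (x : M2) i j : SU2 x -> cabs (x i j) <= 2.
Proof.
move=> /SU2_quatP [q0 [q1 [q2 [q3 [H ->]]]]].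
have K a b : a ^+ 2 + b ^+ 2 <= 1 -> `|a| + `|b| <= 2 :> R.
  move=> ab; have A : `|a| <= 1 by rewrite ler_norml; apply/andP; split; nra.
  have B : `|b| <= 1 by rewrite ler_norml; apply/andP; split; nra.
  lra.
by case: (ord2P i) => ->; case: (ord2P j) => ->; rewrite mxE /= /cabs /=
  ?normrN; apply: K; nra.
Qed.

Definition sdist (x y : M2) := norm1 (x - y).

Lemma sdistC x y : sdist x y = sdist y x.
Proof.
rewrite /sdist /norm1; apply: eq_bigr => i _; apply: eq_bigr => j _.
by rewrite -cabsN !mxE opprB.
Qed.

Lemma norm1_mulr (x y : M2) : SU2 y -> norm1 (x *m y) <= 4 * norm1 x.
Proof.
move=> yS; rewrite /norm1 mulr_sumr; apply: ler_sum => i _.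
rewrite !sum2.
have H j : cabs ((x *m y) i j) <= 2 * (cabs (x i o0) + cabs (x i o1)).
  rewrite mxE sum2; apply: le_trans (cabsD _ _) _; rewrite mulrDr.
  by apply: lerD; apply: le_trans (cabsM _ _) _; rewrite mulrC;
    apply: ler_wpM2r; rewrite ?cabs_ge0 // SU2_cabs.
have := H o0; have := H o1; lra.
Qed.

Lemma norm1_mull (x y : M2) : SU2 y -> norm1 (y *m x) <= 4 * norm1 x.
Proof.
move=> yS; rewrite /norm1 exchange_big [X in _ <= 4 * X]exchange_big /=.
rewrite mulr_sumr; apply: ler_sum => j _; rewrite !sum2.
have H i : cabs ((y *m x) i j) <= 2 * (cabs (x o0 j) + cabs (x o1 j)).
  rewrite mxE sum2; apply: le_trans (cabsD _ _) _; rewrite mulrDr.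
  by apply: lerD; apply: le_trans (cabsM _ _) _; apply: ler_wpM2r;
    rewrite ?cabs_ge0 // SU2_cabs.
have := H o0; have := H o1; lra.
Qed.

Definition su2 := {x : M2 | SU2 x}.
Definition smul (x y : su2) : su2 :=
  exist _ (sval x *m sval y) (SU2_mul (svalP x) (svalP y)).
Definition sone : su2 := exist _ 1%:M (SU2_1 R).
Definition sinv (x : su2) : su2 := exist _ (adj2 (sval x)) (SU2_adj (svalP x)).
Definition sd (x y : su2) := sdist (sval x) (sval y).

Lemma su2_eq (x y : su2) : sval x = sval y -> x = y.
Proof. by case: x y => [x Hx] [y Hy] /= E; apply: eq_exist. Qed.

Lemma smulA x y z : smul x (smul y z) = smul (smul x y) z.
Proof. by apply: su2_eq; rewrite /= mulmxA. Qed.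
Lemma smul1 x : smul sone x = x.
Proof. by apply: su2_eq; rewrite /= mul1mx. Qed.
Lemma smulr1 x : smul x sone = x.
Proof. by apply: su2_eq; rewrite /= mulmx1. Qed.
Lemma smulV x : smul (sinv x) x = sone.
Proof. by apply: su2_eq; rewrite /= SU2_mulVx //; apply: svalP. Qed.
Lemma smulrV x : smul x (sinv x) = sone.
Proof. by apply: su2_eq; rewrite /= SU2_mulV //; apply: svalP. Qed.
Lemma sdC x y : sd x y = sd y x.
Proof. exact: sdistC. Qed.
Lemma sd_mulr x y g : sd (smul x g) (smul y g) <= 4 * sd x y.
Proof. by rewrite /sd /sdist /= -mulmxBl; apply: norm1_mulr; apply: svalP. Qed.
Lemma sd_mull x y g : sd (smul g x) (smul g y) <= 4 * sd x y.
Proof. by rewrite /sd /sdist /= -mulmxBr; apply: norm1_mull; apply: svalP. Qed.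

Lemma SU2_crd (x : M2) i : SU2 x -> `|crd R i (to_coord x)| <= 1.
Proof.
move=> /SU2_quatP [q0 [q1 [q2 [q3 [H ->]]]]].
have K a : a ^+ 2 <= 1 -> `|a| <= 1 :> R by move=> ?; rewrite ler_norml; apply/andP; split; nra.
case: i => -[] [i j]; rewrite /crd /= /crd_fun /= mxE;
by case: (ord2P i) => ->; case: (ord2P j) => ->; rewrite mxE /= ?normrN;
  apply: K; nra.
Qed.

(* Pigeonhole: round the coordinates to multiples of 1/N. *)
Lemma sd_net (e : R) : 0 < e ->
  exists n (t : 'I_n -> su2), forall x, exists i, sd x (t i) <= e.
Proof.
(* Two matrices in one cell differ by at most 1/N in each real coordinate; four entries with two
   coordinates each give the distance 8/N. *)
move=> e0; pose N := (Num.truncn (8 / e)).+1.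
have N0 : 0 < N%:R :> R by rewrite ltr0n.
have NE : 8 / N%:R <= e.
  rewrite ler_pdivrMr // -ler_pdivrMl // mulrC.
  by apply: ltW; rewrite truncnS_gt.
pose cell (x : su2) : {ffun coord_index 1 -> 'I_(2 * N).+1} :=
  [ffun i => inord (Num.truncn ((crd R i (to_coord (sval x)) + 1) * N%:R))].
have cellP x y : cell x = cell y -> sd x y <= e.
  move=> /ffunP E; apply: le_trans NE.
  have D i : `|crd R i (to_coord (sval x)) - crd R i (to_coord (sval y))| <= N%:R^-1.
    have := E i; rewrite !ffunE => /(congr1 (@nat_of_ord _)).
    set u := crd R i (to_coord (sval x)); set w := crd R i (to_coord (sval y)).
    have P a : `|a| <= 1 -> [/\ ((Num.truncn ((a + 1) * N%:R)) < (2 * N).+1)%N,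
       (Num.truncn ((a + 1) * N%:R))%:R <= (a + 1) * N%:R :> R &
       (a + 1) * N%:R < (Num.truncn ((a + 1) * N%:R)).+1%:R :> R].
      rewrite ler_norml => /andP[a1 a2].
      have aN : 0 <= (a + 1) * N%:R by rewrite mulr_ge0 //; lra.
      have T1 : (Num.truncn ((a + 1) * N%:R))%:R <= (a + 1) * N%:R :> R.
        by rewrite truncn_le.
      split=> //; last exact: truncnS_gt.
      rewrite ltnS -(ler_nat R); apply: le_trans T1 _.
      by rewrite natrM ler_wpM2r //; lra.
    have [u1 u2 u3] := P u (SU2_crd i (svalP x)).
    have [w1 w2 w3] := P w (SU2_crd i (svalP y)).
    rewrite !inordK // => Euw; rewrite Euw in u2 u3.
    rewrite -[leRHS]mul1r ler_pdivlMr // -[N%:R]ger0_norm // -normrM.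
    rewrite -natr1 in u3 w3.
    rewrite ler_norml; apply/andP; split; nra.
  have D2 i j : cabs ((sval x - sval y) i j) <= 2 / N%:R.
    have := D (true, (i, j)); have := D (false, (i, j)).
    rewrite /crd /= /crd_fun /= !mxE /cabs.
    have -> : complex.Re (sval x i j - sval y i j) =
      complex.Re (sval x i j) - complex.Re (sval y i j).
      by case: (sval x i j) (sval y i j) => [? ?] [? ?].
    have -> : complex.Im (sval x i j - sval y i j) =
      complex.Im (sval x i j) - complex.Im (sval y i j).
      by case: (sval x i j) (sval y i j) => [? ?] [? ?].
    lra.
  rewrite /sd /sdist /norm1 !sum2.
  have := D2 o0 o0; have := D2 o0 o1; have := D2 o1 o0; have := D2 o1 o1; lra.
(* Empty cells get an arbitrary representative. *)
have repP k : exists y, (exists x, cell x = k) -> cell y = k.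
  case: (pselect (exists x, cell x = k)) => [[x xk]|nk]; first by exists x.
  by exists sone.
have [rep repE] := choice repP.
exists #|{: {ffun coord_index 1 -> 'I_(2 * N).+1}}|.
exists (fun i => rep (enum_val i)) => x.
exists (enum_rank (cell x)); apply: cellP.
by rewrite enum_rankK repE //; exists x.
Qed.

(* The cube of coordinates of absolute value at most 1 is compact and convex,
   so a C^1 function is Lipschitz on it. *)
Lemma C1_lipschitz (f : 'M[R]_2 * 'M[R]_2 -> R) : Cn 1 f ->
  exists2 L : R, 0 <= L & forall p q,
    (forall i, `|crd R i p| <= 1) -> (forall i, `|crd R i q| <= 1) ->
    `|f p - f q| <= L * \sum_i `|crd R i (p - q)|.
Proof.
move=> Cf.
pose N := #|{: coord_index 1}|.
pose phi (u : 'rV[R]_N) : 'M[R]_2 * 'M[R]_2 :=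
  \sum_i u ord0 (enum_rank i) *: crd_vec R i.
have cphi : continuous phi.
  apply: (@continuous_bigsum _ _ _ _ _ _ (fun i (u : 'rV[R]_N) =>
    u ord0 (enum_rank i) *: crd_vec R i)) => i u.
  apply: (@continuousZr_tmp _ _ _ (fun u : 'rV[R]_N => u ord0 (enum_rank i))).
  exact: coord_continuous.
pose K0 : set 'rV[R]_N := fun u => forall i, `[(-1), 1]%classic (u ord0 i).
have cK0 : compact K0.
  exact: (@rV_compact R N (fun=> `[(-1), 1]%classic) (fun=> @segment_compact R (-1) 1)).
have K0P p : (forall i, `|crd R i p| <= 1) -> exists2 u, K0 u & phi u = p.
  move=> pK; exists (\row_k crd R (enum_val k) p).
    by move=> i; rewrite mxE /= in_itv /= -ler_norml; apply: pK.
  by rewrite /phi [RHS](crd_decomp p); apply: eq_bigr => i _; rewrite mxE enum_rankK.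
have B i : exists2 B : R, 0 <= B & forall p, (forall i, `|crd R i p| <= 1) ->
    `|'D_(crd_vec R i) f p| <= B.
  have cD : continuous ('D_(crd_vec R i) f \o phi).
    move=> u; apply: continuous_comp; first exact: cphi.
    exact: (Cn_continuous (Cn_derive _ Cf)).
  have : compact (('D_(crd_vec R i) f \o phi) @` K0)%classic.
    by apply: continuous_compact => //; apply: continuous_subspaceT.
  move=> /compact_bounded[M [Mr MP]].
  exists (`|M| + 1) => [|p pK]; first by rewrite addr_ge0.
  have [u uK <-] := K0P p pK.
  apply: (MP (`|M| + 1)); last by exists u.
  by rewrite (le_lt_trans (ler_norm _)) // ltrDl.
have B2 i : exists B, 0 <= B /\ forall p, (forall i, `|crd R i p| <= 1) ->
    `|'D_(crd_vec R i) f p| <= B by have [b b0 bP] := B i; exists b.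
have [L LP] := choice B2.
exists (\sum_i L i) => [|p q pK qK].
  by apply: sumr_ge0 => i _; case: (LP i).
have df v x : derivable f x v by exact: Cn_derivable Cf.
have [s s1 Es] : exists2 s : R, 0 <= s <= 1 &
    f p - f q = 'D_(p - q) f (q + s *: (p - q)).
  pose g t := f (q + t *: (p - q)).
  have dg (t : R) : is_derive t 1 g ('D_(p - q) f (q + t *: (p - q))).
    exact: is_derive_line.
  have cg : continuous g.
    by move=> t; apply/differentiable_continuous/derivable1_diffP.
  have [|c c01 Ec] := MVT_segment ler01 (fun s _ => dg s).
    exact: continuous_subspaceT.
  exists c; first by move: c01; rewrite in_itv.
  by move: Ec; rewrite /g scale1r scale0r addr0 subr0 mulr1 [q + _]addrC subrK.
have sK i : `|crd R i (q + s *: (p - q))| <= 1.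
  rewrite linearD linearZ linearB /=.
  move: s1 (pK i) (qK i) => /andP[s0 s1]; rewrite !ler_norml.
  set u := crd R i p; set w := crd R i q => /andP[? ?] /andP[? ?].
  rewrite /GRing.scale /=; apply/andP; split; nra.
rewrite Es deriveE; last first.
  by apply: (@ex_diff _ _ _ _ _ _ _ (C1_differentiable (@crd_continuous R 1)
    (@crd_decomp R 1) _ Cf)).
rewrite (@diff_val _ _ _ _ _ _ _ (C1_differentiable (@crd_continuous R 1)
    (@crd_decomp R 1) _ Cf)).
apply: le_trans (ler_norm_sum _ _ _) _; rewrite mulr_sumr; apply: ler_sum => i _.
rewrite normrM mulrC; apply: ler_wpM2r => //.
apply: le_trans ((LP i).2 _ sK) _.
by rewrite (bigD1 i) //= lerDl; apply: sumr_ge0 => j _; case: (LP j).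
Qed.

Local Notation lip := (lipschitz_fun sd).

Lemma smooth_lip F : smooth F ->
  lip (fun x => complex.Re (F (sval x))) /\ lip (fun x => complex.Im (F (sval x))).
Proof.
move=> sF; have [F1 F2] := sF 1%N.
have H f : Cn 1 f -> lip (fun x => f (to_coord (sval x))).
  move=> /C1_lipschitz[L L0 Lf]; exists (L * 8) => [|x y]; first by rewrite mulr_ge0.
  apply: le_trans (Lf _ _ _ _) _ => [i|i|]; try by apply: SU2_crd; apply: svalP.
  rewrite -mulrA; apply: ler_wpM2l => //.
  have -> : to_coord (sval x) - to_coord (sval y) = to_coord (sval x - sval y).
    by rewrite to_coordD -scaleN1r -to_coordZ rmorphN1 scaleN1r.
  have D i : `|crd R i (to_coord (sval x - sval y))| <= sd x y.
    case: i => b [i j]; apply: (@le_trans _ _ (cabs ((sval x - sval y) i j))).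
      by case: b; rewrite /crd /= /crd_fun /= mxE /cabs ?lerDl ?lerDr.
    rewrite /sd /sdist /norm1 (bigD1 i) //= (bigD1 j) //= -addrA lerDl.
    by rewrite addr_ge0 // !sumr_ge0 // => *; rewrite ?sumr_ge0 // => *; apply: cabs_ge0.
  apply: le_trans (ler_sum _ (fun i _ => D i)) _.
  rewrite sumr_const (_ : #|_| = 8%N) ?mulr_natl //.
  by rewrite -[LHS]/(#|{: bool * ('I_2 * 'I_2)}|) !card_prod !card_ord card_bool.
split; first by have := H _ F1; under [X in lipschitz_fun _ X]eq_fun do rewrite to_coordK.
by have := H _ F2; under [X in lipschitz_fun _ X]eq_fun do rewrite to_coordK.
Qed.

End SU2Mean.

(** * Integration over SU(2) and integration by parts *)

Section InvariantIntegral.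
Variable R : realType.
Local Notation C := R[i].
Local Notation M2 := 'M[C]_2.
Local Notation lip := (lipschitz_fun (@sd R)).
Implicit Types (F G : M2 -> C) (f g : su2 R -> R).

Let four_gt0 : 0 < 4 :> R. Proof. by []. Qed.

Local Notation on_su2 L := (L R _ (@smul R) (sone R) (@sinv R)
  (@smulA R) (@smul1 R) (@smulr1 R) (@smulV R) (@smulrV R)
  (@sd R) 4 four_gt0 (@sdC R) (@sd_mulr R) (@sd_mull R) (@sd_net R)).

Definition smean f : R := mean (@smul R) f.

Lemma smeanD f g : lip f -> lip g -> smean (fun x => f x + g x) = smean f + smean g.
Proof. exact: (on_su2 (@meanD)). Qed.

Lemma smeanZ k f : lip f -> smean (fun x => k * f x) = k * smean f.
Proof. exact: (on_su2 (@meanZ)). Qed.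

Lemma smean_ge0 f : lip f -> (forall x, 0 <= f x) -> 0 <= smean f.
Proof. exact: (on_su2 (@mean_ge0)). Qed.

Lemma smean_le f g : lip f -> lip g -> (forall x, f x <= g x) -> smean f <= smean g.
Proof. exact: (on_su2 (@mean_le)). Qed.

Lemma smean_cst k : smean (fun=> k) = k.
Proof. exact: (on_su2 (@mean_cst)). Qed.

Lemma smean_shift f h : lip f -> smean (fun x => f (smul x h)) = smean f.
Proof. exact: (on_su2 (@mean_shift)). Qed.

Lemma smean_lower_bound (e : R) : 0 < e -> exists2 n, (0 < n)%N &
  forall f x0 (eta : R), lip f -> (forall x, 0 <= f x) ->
    (forall x, sd x x0 <= e -> eta <= f x) -> eta <= n%:R * smean f.
Proof. exact: (on_su2 (@mean_lower_bound)). Qed.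

Lemma slip_cst k : lip (fun=> k).
Proof. exact: lip_cst. Qed.

Lemma slipD f g : lip f -> lip g -> lip (fun x => f x + g x).
Proof. exact: lipD. Qed.

Lemma slip_bounded f : lip f -> exists M : R, forall x, `|f x| <= M.
Proof. exact: (lip_bounded (@sd_net R)). Qed.

Lemma slipM f g : lip f -> lip g -> lip (fun x => f x * g x).
Proof. exact: (lipM (sone R) (@sd_net R)). Qed.

Lemma slipX f n : lip f -> lip (fun x => f x ^+ n).
Proof.
move=> Lf; elim: n => [|n IH]; first exact: slip_cst.
rewrite (_ : (fun _ => _) = (fun x => f x * f x ^+ n)); first exact: slipM.
by apply/funext => x; rewrite exprS.
Qed.

Lemma slip_shift f h : lip f -> lip (fun x => f (smul x h)).
Proof. by apply: (lip_shift four_gt0); apply: sd_mulr. Qed.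

(** [f'] is a uniform limit of difference quotients of [f] along right translations. These have mean
    0 by invariance, so the mean of [f'] is at most [K * t] in absolute value for every t > 0. *)
Lemma smean_diff f f' (K : R) : lip f -> lip f' ->
  (forall t, 0 < t -> exists h, forall x,
     `|f (smul x h) - f x - t * f' x| <= t * (K * t)) -> smean f' = 0.
Proof.
move=> Lf Lf' H.
have B t : 0 < t -> `|smean f'| <= K * t.
  move=> t0; have [h hP] := H t t0.
  have Lh := slip_shift h Lf.
  have Ld : lip (fun x => f (smul x h) + (-1) * f x).
    by apply: slipD => //; apply: slipM => //; apply: slip_cst.
  have Ed : smean (fun x => f (smul x h) + (-1) * f x) = 0.
    rewrite smeanD ?smeanZ ?smean_shift ?mulN1r ?subrr //.
    by apply: slipM => //; apply: slip_cst.
  have Lt : lip (fun x => t * f' x) by apply: slipM => //; apply: slip_cst.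
  have U : t * smean f' <= t * (K * t).
    rewrite -smeanZ // -[leRHS]addr0 -Ed -[t * (K * t)]smean_cst -smeanD //;
      last exact: slip_cst.
    apply: smean_le => // [|x]; first by apply: slipD => //; apply: slip_cst.
    by have := hP x; rewrite ler_norml => /andP[? _]; lra.
  have U2 : 0 <= t * smean f' + t * (K * t).
    rewrite -smeanZ // -Ed -[t * (K * t)]smean_cst -smeanD //;
      last exact: slip_cst.
    apply: smean_le => // [|x]; first by apply: slipD => //; apply: slip_cst.
    by have := hP x; rewrite ler_norml => /andP[_ ?]; lra.
  rewrite -(ler_pM2l t0) -[t in t * `|_|]gtr0_norm // -normrM ler_norml.
  by apply/andP; split; lra.
apply/eqP; rewrite -normr_le0; apply/ler_addgt0Pl => e e0; rewrite addr0.
have K1 : 0 < `|K| + 1 by rewrite ltr_wpDl.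
apply: le_trans (B _ (divr_gt0 e0 K1)) _.
rewrite mulrCA ler_piMr ?(ltW e0) // ler_pdivrMr // mul1r.
by rewrite (le_trans (ler_norm _)) // lerDl.
Qed.

Definition Imean F : C :=
  smean (fun x => complex.Re (F (sval x))) +i* smean (fun x => complex.Im (F (sval x))).

Lemma Imean_ext F G : (forall x, SU2 x -> F x = G x) -> Imean F = Imean G.
Proof.
by move=> E; rewrite /Imean; congr (smean _ +i* smean _); apply/funext => x;
  rewrite E //; apply: svalP.
Qed.

Lemma ImeanD F G : smooth F -> smooth G ->
  Imean (fun x => F x + G x) = Imean F + Imean G.
Proof.
move=> /smooth_lip[F1 F2] /smooth_lip[G1 G2]; rewrite /Imean.
apply/eqP; rewrite eq_complex /=; apply/andP; split; apply/eqP; rewrite -smeanD //.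
  by congr smean; apply/funext => x; rewrite cReD.
by congr smean; apply/funext => x; rewrite cImD.
Qed.

Lemma ImeanZ (c : C) F : smooth F -> Imean (fun x => c * F x) = c * Imean F.
Proof.
move=> /smooth_lip[F1 F2]; rewrite /Imean; case: c => p q.
have L k f : lip f -> lip (fun x => k * f x).
  by move=> Lf; apply: slipM => //; apply: slip_cst.
apply/eqP; rewrite eq_complex /=; apply/andP; split; apply/eqP.
  rewrite -mulNr -!smeanZ // -smeanD; try exact: L.
  by congr smean; apply/funext => x; rewrite cReM /= mulNr.
rewrite -!smeanZ // -smeanD; try exact: L.
by congr smean; apply/funext => x; rewrite cImM.
Qed.

Lemma quat_sub (p0 p1 p2 p3 q0 q1 q2 q3 : R) :
  quat p0 p1 p2 p3 - quat q0 q1 q2 q3 =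
  quat (p0 - q0) (p1 - q1) (p2 - q2) (p3 - q3).
Proof.
by apply: mx2P; rewrite !mxE /=; apply/eqP; rewrite eq_complex /=;
  apply/andP; split; apply/eqP; ring.
Qed.

Lemma quat1 : 1%:M = quat 1 0 0 0 :> M2.
Proof.
by apply: mx2P; rewrite !mxE /=; apply/eqP; rewrite eq_complex /= ?oppr0 ?eqxx.
Qed.

(** 64 = 4 * 4 * 4: a factor 4 for the left translation by [x], and four entries, each moved by at
    most 4 |t|. *)
Lemma sd_rot (x : su2 R) i (t : R) :
  sd (smul x (exist _ (surot i t) (SU2_rot i t))) x <= 64 * `|t|.
Proof.
have xE : x = smul x (sone R) by rewrite smulr1.
rewrite {2}xE; apply: le_trans (sd_mull _ _ _) _.
have ct : `|cos t - 1| <= `|t|.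
  case: (leP 0 t) => t0.
    have [|c] := MVT_segment t0 (fun s _ => is_derive_cos s).
      exact: continuous_subspaceT (@continuous_cos R).
    rewrite cos0 subr0 => _ ->; rewrite normrM normrN ler_piMl //.
    by rewrite ler_norml sin_geN1 sin_le1.
  have [|c] := MVT_segment (ltW t0) (fun s _ => is_derive_cos s).
    exact: continuous_subspaceT (@continuous_cos R).
  rewrite cos0 sub0r distrC => _ ->; rewrite normrM !normrN ler_piMl //.
  by rewrite ler_norml sin_geN1 sin_le1.
have st : `|sin t| <= `|t|.
  case: (leP 0 t) => t0.
    have [|c] := MVT_segment t0 (fun s _ => is_derive_sin s).
      exact: continuous_subspaceT (@continuous_sin R).
    rewrite sin0 !subr0 => _ ->; rewrite normrM ler_piMl //.
    by rewrite ler_norml cos_geN1 cos_le1.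
  have [|c] := MVT_segment (ltW t0) (fun s _ => is_derive_sin s).
    exact: continuous_subspaceT (@continuous_sin R).
  rewrite sin0 !sub0r => _ E; rewrite -[`|sin t|]normrN E normrM normrN ler_piMl //.
  by rewrite ler_norml cos_geN1 cos_le1.
have D p q : cabs ((surot i t - 1%:M) p q) <= 4 * `|t|.
  have Q (b : bool) : `|if b then sin t else 0| <= `|t|.
    by case: b; rewrite ?normr0.
  rewrite surotE; move: (Q (i == 0)) (Q (i == 1)) (Q (i == 2)).
  set q1 := if _ then _ else _; set q2 := if _ then _ else _.
  set q3 := if _ then _ else _ => B1 B2 B3.
  have N0 : 0 <= `|t| by [].
  rewrite quat1 quat_sub !subr0.
  by case: (ord2P p) => ->; case: (ord2P q) => ->; rewrite mxE /cabs /= ?normrN; lra.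
rewrite /sd /sdist /norm1 !sum2 /=.
have := D o0 o0; have := D o0 o1; have := D o1 o0; have := D o1 o1; lra.
Qed.

(** Right translation by exp (t E_i) preserves the mean. The mean value theorem writes the increment
    of F as t times its derivative at an intermediate rotation, and the Lipschitz bound of that
    derivative makes the error of order t^2. *)
Lemma Imean_suX i F : smooth F -> Imean (suX i F) = 0.
Proof.
move=> sF; have [F1 F2] := smooth_lip sF.
have [X1 X2] := smooth_lip (smooth_suX i sF).
have main (f f' : M2 -> R) : lip (fun x => f (sval x)) -> lip (fun x => f' (sval x)) ->
    (forall x (s : R), is_derive s 1 (fun t => f (x *m surot i t)) (f' (x *m surot i s))) ->
    smean (fun x => f' (sval x)) = 0.
  move=> Lf Lf' D; have [L L0 Lf'P] := Lf'.
  apply: (@smean_diff (fun x => f (sval x)) _ (L * 64)) => // t t0.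
  exists (exist _ (surot i t) (SU2_rot i t)) => x /=.
  pose g (s : R) := f (sval x *m surot i s).
  have dg (s : R) : is_derive s 1 g (f' (sval x *m surot i s)) by apply: D.
  have cg : continuous g.
    by move=> s; apply/differentiable_continuous/derivable1_diffP.
  have [|c] := MVT_segment (ltW t0) (fun s _ => dg s).
    exact: continuous_subspaceT.
  rewrite in_itv /= => /andP[c0 ct]; rewrite {2}/g surot0 mulmx1 subr0 => E.
  rewrite -/(g t) E [f' _ * t]mulrC -mulrBr normrM gtr0_norm //.
  apply: ler_wpM2l; first exact: ltW.
  have := Lf'P (smul x (exist _ (surot i c) (SU2_rot i c))) x.
  move=> /= /le_trans; apply; rewrite -mulrA; apply: ler_wpM2l => //.
  apply: le_trans (sd_rot _ _ _) _; rewrite ger0_norm //.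
  by apply: ler_wpM2l.
rewrite /Imean.
have -> : smean (fun x => complex.Re (suX i F (sval x))) = 0.
  apply: (main (fun x => complex.Re (F x)) (fun x => complex.Re (suX i F x))) => // x s.
  by case: (suX_rot x i s sF).
have -> // : smean (fun x => complex.Im (suX i F (sval x))) = 0.
apply: (main (fun x => complex.Im (F x)) (fun x => complex.Im (suX i F x))) => // x s.
by case: (suX_rot x i s sF).
Qed.

End InvariantIntegral.

(** * Concentration of powers at a point *)

Section Concentration.
Variable R : realType.
Local Notation C := R[i].
Local Notation M2 := 'M[C]_2.
Local Notation lip := (lipschitz_fun (@sd R)).

(** Suppose f x0 > 0. Then f >= f x0 / 2 where k >= r, and the vanishing of the mean of f k^n bounds
    the mean of k^n by a constant times r^n. But k >= r' > r on a whole ball, so this mean is at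
    least a constant times r'^n. This fails for large n. *)
Lemma peak_le0 (f k : su2 R -> R) (x0 : su2 R) : lip f -> lip k ->
  (forall x, 0 <= k x <= 1) -> k x0 = 1 ->
  (forall d : R, 0 < d -> exists2 r : R, 0 < r < 1 &
     forall x, r <= k x -> sd x x0 <= d) ->
  (forall n, smean (fun x => f x * k x ^+ n) = 0) -> f x0 <= 0.
Proof.
move=> Lf Lk k01 k1 peak M0; rewrite leNgt; apply/negP => eta0.
set eta := f x0 in eta0.
have [B fB] := slip_bounded Lf; have [L L0 Lf'] := Lf; have [K K0 Lk'] := Lk.
have B0 : 0 <= B by apply: le_trans (fB x0).
have L1 : 0 < L + 1 by rewrite ltr_wpDl.
have K1 : 0 < K + 1 by rewrite ltr_wpDl.
have [r /andP[r0 r1] rP] := peak _ (divr_gt0 (divr_gt0 eta0 (ltr0n R 2)) L1).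
pose r' := (1 + r) / 2.
have rr' : r < r' by rewrite /r'; lra.
have r'1 : r' < 1 by rewrite /r'; lra.
have r'0 : 0 < r' by lra.
have fr x : r <= k x -> eta / 2 <= f x.
  move=> /rP d; have := Lf' x x0; rewrite ler_norml => /andP[H _].
  have : L * sd x x0 <= eta / 2.
    apply: le_trans (ler_wpM2l L0 d) _.
    have -> : L * (eta / 2 / (L + 1)) = eta / 2 * (L / (L + 1)).
      by field; rewrite gt_eqF.
    by apply: ler_piMr; [lra|rewrite ler_pdivrMr // mul1r lerDl].
  rewrite -/eta in H; lra.
have Lkn n : lip (fun x => k x ^+ n) by apply: slipX.
have k0 x n : 0 <= k x ^+ n by apply: exprn_ge0; case/andP: (k01 x).
have M1 n : eta / 2 * smean (fun x => k x ^+ n) <= (B + eta / 2) * r ^+ n.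
  rewrite -smeanZ // -[leRHS]addr0 -(M0 n) -[(B + _) * _]smean_cst -smeanD;
    [|exact: slip_cst|exact: slipM].
  apply: smean_le => [||x].
  - by apply: slipM => //; apply: slip_cst.
  - by apply: slipD; [apply: slip_cst|apply: slipM].
  have kn0 := k0 x n; have rn0 : 0 <= r ^+ n by apply: exprn_ge0; exact: ltW.
  have := fB x; rewrite ler_norml => /andP[fB1 _].
  case: (leP r (k x)) => rk.
    have fx := fr x rk.
    have : eta / 2 * k x ^+ n <= f x * k x ^+ n by apply: ler_wpM2r.
    have : 0 <= (B + eta / 2) * r ^+ n by rewrite mulr_ge0 //; lra.
    lra.
  have kr : k x ^+ n <= r ^+ n.
    by apply: lerXn2r; rewrite ?nnegrE ?(ltW r0) ?(ltW rk) //; case/andP: (k01 x).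
  have h1 : - B * k x ^+ n <= f x * k x ^+ n by apply: ler_wpM2r.
  have h2 : (B + eta / 2) * k x ^+ n <= (B + eta / 2) * r ^+ n.
    by apply: ler_wpM2l => //; lra.
  lra.
have d0 : 0 < (1 - r') / (K + 1) by rewrite divr_gt0 // subr_gt0.
have [N N0 NP] := smean_lower_bound d0.
have M2 n : r' ^+ n <= N%:R * smean (fun x => k x ^+ n).
  apply: (NP _ x0) => // x dx.
  have : r' <= k x.
    have := Lk' x x0; rewrite ler_norml k1 => /andP[H _].
    have : K * sd x x0 <= 1 - r'.
      apply: le_trans (ler_wpM2l K0 dx) _.
      have -> : K * ((1 - r') / (K + 1)) = (1 - r') * (K / (K + 1)).
        by field; rewrite gt_eqF.
      by apply: ler_piMr; [lra|rewrite ler_pdivrMr // mul1r lerDl].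
    lra.
  by move=> rk; apply: lerXn2r; rewrite ?nnegrE ?(ltW r'0) // (le_trans _ rk) // ltW.
have NR : 0 < N%:R :> R by rewrite ltr0n.
have q01 : 0 <= r / r' < 1.
  by rewrite divr_ge0 ?ltW //= ltr_pdivrMr // mul1r.
pose c := eta / 2 / (N%:R * (B + eta / 2)).
have Be : 0 < B + eta / 2 by lra.
have c0 : 0 < c by rewrite /c divr_gt0 // ?mulr_gt0 //; lra.
have cn n : c <= (r / r') ^+ n.
  rewrite expr_div_n ler_pdivlMr ?exprn_gt0 // /c.
  rewrite mulrAC ler_pdivrMr; last by rewrite mulr_gt0.
  have h1 := M1 n; have h2 := M2 n.
  have h3 : eta / 2 * r' ^+ n <= eta / 2 * (N%:R * smean (fun x => k x ^+ n)).
    by apply: ler_wpM2l => //; lra.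
  have h4 : N%:R * (eta / 2 * smean (fun x => k x ^+ n)) <=
            N%:R * ((B + eta / 2) * r ^+ n) by apply: ler_wpM2l => //; exact: ltW.
  lra.
have : (GRing.exp (r / r') @ \oo --> (0 : R))%classic.
  by apply: cvg_expr; case/andP: q01 => ? ?; rewrite ger0_norm.
move=> /cvgrPdist_lt /(_ _ c0) [n _ /(_ n (leqnn n))] /=.
rewrite sub0r normrN ger0_norm ?exprn_ge0 //; last by case/andP: q01.
by rewrite ltNge cn.
Qed.

(** For unit quaternions p and q this is (1 + <p, q>) / 2 = 1 - |p - q|^2 / 4: it takes values in
    [0, 1] and equals 1 only at [x0]. Being affine in the entries of [y], it has powers in the span
    of the matrix coefficients. *)
Definition su_kernel (x0 y : M2) : C := 2^-1 + 4^-1 * \tr (adj2 x0 *m y).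

Lemma smooth_su_kernel x0 : smooth (su_kernel x0).
Proof.
apply: smoothD; first exact: smooth_cst.
apply: smoothZ; rewrite (_ : (fun _ => _) =
  (fun y : M2 => \sum_i \sum_j adj2 x0 i j * y j i)); last first.
  by apply/funext => y; apply: eq_bigr => i _; rewrite mxE.
apply: smooth_sum => i; apply: smooth_sum => j.
by apply: smoothZ; apply: smooth_entry.
Qed.

Lemma su_kernel_quat (p0 p1 p2 p3 q0 q1 q2 q3 : R) :
  su_kernel (quat p0 p1 p2 p3) (quat q0 q1 q2 q3) =
  ((1 + (p0 * q0 + p1 * q1 + p2 * q2 + p3 * q3)) / 2)%:C.
Proof.
rewrite /su_kernel /mxtrace sum2 !mxE !sum2 !mxE /=.
have -> : (4^-1 : C) = (4^-1 : R)%:C by rewrite fmorphV rmorph_nat.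
have -> : (2^-1 : C) = (2^-1 : R)%:C by rewrite fmorphV rmorph_nat.
by apply/eqP; rewrite eq_complex /=; apply/andP; split; apply/eqP; field.
Qed.

Lemma Imean_kernel_eq0 (F : M2 -> C) (x0 : M2) : smooth F -> SU2 x0 ->
  (forall n, Imean (fun y => F y * su_kernel x0 y ^+ n) = 0) -> F x0 = 0.
Proof.
move=> sF xS I0.
(* The real part of [G] at [x0] is |F x0|^2, so that a one-sided bound there suffices. *)
pose G y := conjc (F x0) * F y.
have sG : smooth G by apply: smoothZ.
have sk := smooth_su_kernel x0.
have kreal y : SU2 y -> su_kernel x0 y = (complex.Re (su_kernel x0 y))%:C.
  have [p0 [p1 [p2 [p3 [_ ->]]]]] := SU2_quatP xS.
  by move=> /SU2_quatP [q0 [q1 [q2 [q3 [_ ->]]]]]; rewrite su_kernel_quat.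
have M0 n : smean (fun x : su2 R => complex.Re (G (sval x)) *
    complex.Re (su_kernel x0 (sval x)) ^+ n) = 0.
  have := ImeanZ (conjc (F x0)) (smoothM sF (smoothX n sk)).
  rewrite I0 mulr0 /Imean => /eqP; rewrite eq_complex => /andP[/eqP /= E _].
  rewrite -[RHS]E; congr smean; apply/funext => x.
  rewrite mulrA -/(G (sval x)) (kreal _ (svalP x)) -rmorphXn cReM /=.
  by rewrite mulr0 subr0.
have [g1 _] := smooth_lip sG; have [k1 _] := smooth_lip sk.
have : complex.Re (G (sval (exist (@SU2 R) x0 xS))) <= 0.
  apply: (peak_le0 g1 k1 _ _ _ M0).
  - move=> [y yS] /=.
    have [p0 [p1 [p2 [p3 [pP ->]]]]] := SU2_quatP xS.
    have [q0 [q1 [q2 [q3 [qP ->]]]]] := SU2_quatP yS.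
    rewrite su_kernel_quat /=.
    have := sqr_ge0 (p0 + q0); have := sqr_ge0 (p1 + q1).
    have := sqr_ge0 (p2 + q2); have := sqr_ge0 (p3 + q3).
    have := sqr_ge0 (p0 - q0); have := sqr_ge0 (p1 - q1).
    have := sqr_ge0 (p2 - q2); have := sqr_ge0 (p3 - q3).
    by move=> *; apply/andP; split; lra.
  - have [p0 [p1 [p2 [p3 [pP E]]]]] := SU2_quatP xS; rewrite /= E.
    by rewrite su_kernel_quat /= -!expr2 pP; field.
  (* A kernel value at least 1 - s means |p - q|^2 <= 4 s <= (d / 8)^2, and the distance adds up
     eight coordinate differences. The bound 1/2 keeps 1 - s positive. *)
  - move=> d d0; pose s := Num.min (2^-1) (d ^+ 2 / 256).
    have d2 : 0 < d ^+ 2 / 256 by rewrite divr_gt0 ?exprn_gt0 ?ltr0n.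
    have s0 : 0 < s by rewrite /s lt_min d2 andbT invr_gt0.
    have s1 : s <= 2^-1 by rewrite /s ge_min lexx.
    have s2 : s <= d ^+ 2 / 256 by rewrite /s ge_min lexx orbT.
    exists (1 - s); first by apply/andP; split; lra.
    move=> [y yS] /=; rewrite /sd /=.
    have [p0 [p1 [p2 [p3 [pP ->]]]]] := SU2_quatP xS.
    have [q0 [q1 [q2 [q3 [qP ->]]]]] := SU2_quatP yS.
    rewrite su_kernel_quat /= => H.
    have Q : (q0 - p0) ^+ 2 + (q1 - p1) ^+ 2 + (q2 - p2) ^+ 2 + (q3 - p3) ^+ 2
        <= (d / 8) ^+ 2 by lra.
    have A u : u ^+ 2 <= (d / 8) ^+ 2 -> `|u| <= d / 8.
      have : 0 < d / 8 by rewrite divr_gt0.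
      move: (d / 8) => e e0 uP; rewrite ler_norml; apply/andP; split; nra.
    have h0 := sqr_ge0 (q0 - p0); have h1 := sqr_ge0 (q1 - p1).
    have h2 := sqr_ge0 (q2 - p2); have h3 := sqr_ge0 (q3 - p3).
    have A0 : `|q0 - p0| <= d / 8 by apply: A; lra.
    have A1 : `|q1 - p1| <= d / 8 by apply: A; lra.
    have A2 : `|q2 - p2| <= d / 8 by apply: A; lra.
    have A3 : `|q3 - p3| <= d / 8 by apply: A; lra.
    rewrite /sdist /norm1 quat_sub !sum2 !mxE /cabs /= !normrN; lra.
rewrite /= /G cReM; case: (F x0) => a b /= H.
have : a ^+ 2 + b ^+ 2 <= 0 by lra.
have := sqr_ge0 a; have := sqr_ge0 b => b2 a2 ab.
have /eqP : a ^+ 2 = 0 by lra.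
have /eqP : b ^+ 2 = 0 by lra.
by rewrite !sqrf_eq0 => /eqP -> /eqP ->.
Qed.

End Concentration.

(** * Matrix coefficients *)

Section MatrixCoefficients.
Variable R : realType.
Local Notation C := R[i].
Local Notation M2 := 'M[C]_2.
Implicit Types (F G : M2 -> C) (P Q : M2 -> {poly C}).

(** For z = (1, X), the row z adj(x) is ([Alin x], [Blin x]). So [mpol (k - s) s x] is the monomial
    z_0^(k-s) z_1^s moved by x^-1, and [mcoef k s j x] is the (j, s) entry of the matrix of x^-1 in
    the representation [hpoly k]. *)
Definition Alin (x : M2) : {poly C} := (x o1 o1)%:P - x o1 o0 *: 'X.
Definition Blin (x : M2) : {poly C} := - (x o0 o1)%:P + x o0 o0 *: 'X.
Definition mpol (n m : nat) (x : M2) : {poly C} := Alin x ^+ n * Blin x ^+ m.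
Definition mcoef (k s j : nat) (x : M2) : C := (mpol (k - s) s x)`_j.

Definition iC : C := 0 +i* 1.

Lemma iC_sq : iC * iC = -1.
Proof. by apply/eqP; rewrite eq_complex /=; apply/andP; split; apply/eqP; ring. Qed.

Definition smoothP P := forall j, smooth (fun x => (P x)`_j).

Lemma smoothP_mul P Q : smoothP P -> smoothP Q -> smoothP (fun x => P x * Q x).
Proof.
move=> sP sQ j; rewrite (_ : (fun _ => _) =
  (fun x => \sum_(i < j.+1) (P x)`_i * (Q x)`_(j - i))).
  by apply: smooth_sum => i; apply: smoothM.
by apply/funext => x; rewrite coefM.
Qed.

Lemma smoothP_exp P n : smoothP P -> smoothP (fun x => P x ^+ n).
Proof.
move=> sP; elim: n => [|n IH].
  by move=> j; rewrite (_ : (fun _ => _) = fun=> (1 : {poly C})`_j) //; apply: smooth_cst.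
rewrite (_ : (fun x => P x ^+ n.+1) = (fun x => P x * P x ^+ n)).
  exact: smoothP_mul.
by apply/funext => x; rewrite exprS.
Qed.

Lemma smoothP_Alin : smoothP Alin.
Proof.
move=> j; rewrite (_ : (fun x => (Alin x)`_j) = (fun x : M2 => x o1 o1 * (j == 0)%N%:R
    + x o1 o0 * - (j == 1)%N%:R)).
  by apply: smoothD; apply: smoothM; try exact: smooth_entry; apply: smooth_cst.
apply/funext => x; rewrite /Alin coefB coefC coefZ coefX mulrN.
by case: eqP; rewrite ?mulr1 ?mulr0.
Qed.

Lemma smoothP_Blin : smoothP Blin.
Proof.
move=> j; rewrite (_ : (fun x => (Blin x)`_j) = (fun x : M2 => x o0 o1 * - (j == 0)%N%:R
    + x o0 o0 * (j == 1)%N%:R)).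
  by apply: smoothD; apply: smoothM; try exact: smooth_entry; apply: smooth_cst.
apply/funext => x; rewrite /Blin coefD coefN coefC coefZ coefX mulrN.
by case: eqP; rewrite ?mulr1 ?mulr0.
Qed.

Lemma smooth_mcoef k s j : smooth (mcoef k s j).
Proof.
exact: (smoothP_mul (smoothP_exp _ smoothP_Alin) (smoothP_exp _ smoothP_Blin)).
Qed.

Definition is_rdP P v x (p : {poly C}) :=
  forall j, is_rd (fun y => (P y)`_j) v x p`_j.

Lemma is_rdP_mul P Q v x p q : is_rdP P v x p -> is_rdP Q v x q ->
  is_rdP (fun y => P y * Q y) v x (p * Q x + P x * q).
Proof.
move=> dP dQ j; rewrite (_ : (fun _ => _) =
  (fun y => \sum_(i < j.+1) (P y)`_i * (Q y)`_(j - i))); last first.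
  by apply/funext => y; rewrite coefM.
by rewrite coefD !coefM -big_split; apply: is_rd_sum => i; apply: is_rdM.
Qed.

Lemma is_rdP_cst p v x : is_rdP (fun=> p) v x 0.
Proof. by move=> j; rewrite coef0; apply: is_rd_cst. Qed.

Lemma is_rdP_Alin v x : is_rdP Alin v x (Alin v).
Proof.
move=> j; have E y : (Alin y)`_j = y o1 o1 * (j == 0)%N%:R + y o1 o0 * - (j == 1)%N%:R.
  rewrite /Alin coefB coefC coefZ coefX mulrN.
  by case: eqP; rewrite ?mulr1 ?mulr0.
have D := is_rdD (is_rdM (is_rd_entry o1 o1 v x) (is_rd_cst ((j == 0)%N%:R) v x))
  (is_rdM (is_rd_entry o1 o0 v x) (is_rd_cst (- (j == 1)%N%:R) v x)).
by rewrite !mulr0 !addr0 -E in D; rewrite (funext E).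
Qed.

Lemma is_rdP_Blin v x : is_rdP Blin v x (Blin v).
Proof.
move=> j; have E y : (Blin y)`_j = y o0 o1 * - (j == 0)%N%:R + y o0 o0 * (j == 1)%N%:R.
  rewrite /Blin coefD coefN coefC coefZ coefX mulrN.
  by case: eqP; rewrite ?mulr1 ?mulr0.
have D := is_rdD (is_rdM (is_rd_entry o0 o1 v x) (is_rd_cst (- (j == 0)%N%:R) v x))
  (is_rdM (is_rd_entry o0 o0 v x) (is_rd_cst ((j == 1)%N%:R) v x)).
by rewrite !mulr0 !addr0 -E in D; rewrite (funext E).
Qed.

(* The derivative at x in the direction x e of the polynomial
   U(z) = u(z adj(x)) of degree k, in the affine coordinate z = (1, X). *)
Definition inf_action (e : M2) (k : nat) (p : {poly C}) : {poly C} :=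
  - (((e o0 o0)%:P + (e o1 o0)%:P * 'X) * (k%:R%:P * p - 'X * p^`()))
  - ((e o0 o1)%:P - (e o0 o0)%:P * 'X) * p^`().

(** The infinitesimal action is a derivation when degrees add up, so its formula need only be
    checked on the two linear factors. *)
Lemma inf_actionM e m n p q : inf_action e (m + n) (p * q) =
  inf_action e m p * q + p * inf_action e n q.
Proof. by rewrite /inf_action derivM natrD polyCD; ring. Qed.

Lemma deriv_Alin x : (Alin x)^`() = - (x o1 o0)%:P.
Proof. by rewrite /Alin derivB derivC derivZ derivX sub0r alg_polyC. Qed.

Lemma deriv_Blin x : (Blin x)^`() = (x o0 o0)%:P.
Proof. by rewrite /Blin derivD derivN derivC derivZ derivX oppr0 add0r alg_polyC. Qed.

Lemma inf_action_Alin (e x : M2) : e o1 o1 = - e o0 o0 ->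
  Alin (x *m e) = inf_action e 1 (Alin x).
Proof.
move=> eT; rewrite /inf_action deriv_Alin /Alin !mxE !sum2 eT -!mul_polyC.
rewrite !(polyCD, polyCM, polyCN) polyC1; ring.
Qed.

Lemma inf_action_Blin (e x : M2) : e o1 o1 = - e o0 o0 ->
  Blin (x *m e) = inf_action e 1 (Blin x).
Proof.
move=> eT; rewrite /inf_action deriv_Blin /Blin !mxE !sum2 eT -!mul_polyC.
rewrite !(polyCD, polyCM, polyCN) polyC1; ring.
Qed.

Lemma inf_action1 e : inf_action e 0 1 = 0.
Proof. by rewrite /inf_action derivC; ring. Qed.

Lemma is_rdP_mpol (e x : M2) n m : e o1 o1 = - e o0 o0 ->
  is_rdP (mpol n m) (x *m e) x (inf_action e (n + m) (mpol n m x)).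
Proof.
move=> eT.
have X P p n' : is_rdP P (x *m e) x p -> p = inf_action e 1 (P x) ->
    is_rdP (fun y => P y ^+ n') (x *m e) x (inf_action e n' (P x ^+ n')).
  move=> dP pE; elim: n' => [|n' IH].
    by rewrite inf_action1; exact: is_rdP_cst.
  rewrite exprS -[X in inf_action e X]add1n inf_actionM -pE.
  rewrite (_ : (fun y => P y ^+ n'.+1) = (fun y => P y * P y ^+ n')).
    exact: is_rdP_mul.
  by apply/funext => y; rewrite exprS.
rewrite /mpol inf_actionM; apply: is_rdP_mul.
  by apply: X; [apply: is_rdP_Alin|apply: inf_action_Alin].
by apply: X; [apply: is_rdP_Blin|apply: inf_action_Blin].
Qed.

Definition pcoef (p : {poly C}) (j : nat) : C := if j is i.+1 then p`_i else 0.

Lemma coef_mul_lin (a b : C) (p : {poly C}) j :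
  ((a%:P + b%:P * 'X) * p)`_j = a * p`_j + b * pcoef p j.
Proof.
rewrite mulrDl -mulrA coefD !coefCM coefXM; case: j => [|j] //=.
Qed.

Lemma coef_mul_linB (a b : C) (p : {poly C}) j :
  ((a%:P - b%:P * 'X) * p)`_j = a * p`_j - b * pcoef p j.
Proof. by rewrite -[- (b%:P * 'X)]mulNr -polyCN coef_mul_lin mulNr. Qed.

Lemma pcoef_deriv (p : {poly C}) j : pcoef p^`() j = j%:R * p`_j.
Proof. by case: j => [|j] /=; rewrite ?mul0r // coef_deriv mulr_natl. Qed.

Lemma coef_euler (p : {poly C}) (k i : nat) :
  (k%:R%:P * p - 'X * p^`())`_i = (k%:R - i%:R) * p`_i.
Proof.
rewrite coefB coefCM coefXM mulrBl; case: i => [|i] /=; first by rewrite mul0r.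
by rewrite coef_deriv !mulr_natl.
Qed.

(** Only the coefficients j - 1, j and j + 1 occur: the diagonal of [e] acts by the weight k - 2 j,
    its other two entries act as raising and lowering operators. *)
Lemma coef_inf_action (e : M2) k (p : {poly C}) j : (inf_action e k p)`_j =
  - (e o0 o0 * (k%:R - 2 * j%:R) * p`_j)
  - e o1 o0 * (k%:R - j%:R + 1) * pcoef p j - e o0 o1 * j.+1%:R * p`_j.+1.
Proof.
rewrite /inf_action coefB coefN coef_mul_linB coef_mul_lin coef_euler pcoef_deriv coef_deriv -[p`_j.+1 *+ _]mulr_natl.
have -> : pcoef (k%:R%:P * p - 'X * p^`()) j = (k%:R - j%:R + 1) * pcoef p j.
  case: j => [|j] /=; first by rewrite mulr0.
  by rewrite coef_euler -natr1; ring.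
rewrite -natr1; ring.
Qed.

Lemma suX_mcoef i k s j x : (s <= k)%N ->
  suX i (mcoef k s j) x = (inf_action (suE R i) k (mpol (k - s) s x))`_j.
Proof.
move=> sk; rewrite /suX.
have eT : suE R i o1 o1 = - suE R i o0 o0.
  have [E0 E1 E2] := suEE R.
  by case: (ord3P i) => ->; rewrite ?E0 ?E1 ?E2 !mxE /=;
    apply/eqP; rewrite eq_complex /= ?oppr0 !eqxx.
have := is_rdP_mpol x (k - s) s eT; rewrite subnK // => D.
exact: is_rd_rderiv (D j).
Qed.

(** The field of E_1 is diagonal in [j]; this is the grading by the right action of the circle. *)
Lemma suX0_mcoef k s j x : (s <= k)%N ->
  suX ord0 (mcoef k s j) x = - iC * (k%:R - 2 * j%:R) * mcoef k s j x.
Proof.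
move=> sk; have [E0 _ _] := suEE R.
rewrite suX_mcoef // coef_inf_action E0 !mxE /= -/(mcoef k s j x).
rewrite -/iC; ring.
Qed.

Definition mcoefp (k s j : nat) (x : M2) : C := if j is i.+1 then mcoef k s i x else 0.

Lemma suX1_mcoef k s j x : (s <= k)%N -> suX (inord 1) (mcoef k s j) x =
  (k%:R - j%:R + 1) * mcoefp k s j x - j.+1%:R * mcoef k s j.+1 x.
Proof.
move=> sk; have [_ E1 _] := suEE R.
rewrite suX_mcoef // coef_inf_action E1 !mxE /= -/(mcoef k s j.+1 x).
have -> : pcoef (mpol (k - s) s x) j = mcoefp k s j x by case: j.
ring.
Qed.

Lemma suX2_mcoef k s j x : (s <= k)%N -> suX (inord 2) (mcoef k s j) x =
  - iC * ((k%:R - j%:R + 1) * mcoefp k s j x + j.+1%:R * mcoef k s j.+1 x).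
Proof.
move=> sk; have [_ _ E2] := suEE R.
rewrite suX_mcoef // coef_inf_action E2 !mxE /= -/(mcoef k s j.+1 x).
have -> : pcoef (mpol (k - s) s x) j = mcoefp k s j x by case: j.
rewrite -/iC; ring.
Qed.

Lemma size_mpol n m x : (size (mpol n m x) <= (n + m).+1)%N.
Proof.
have X (p : {poly C}) q : (size p <= 2)%N -> (size (p ^+ q) <= q.+1)%N.
  move=> p2; apply: leq_trans (size_poly_exp_leq _ _) _; rewrite ltnS.
  by rewrite -[leqRHS]mul1n leq_mul2r -subn1 leq_subLR p2 orbT.
have A : (size (Alin x) <= 2)%N.
  apply: leq_trans (size_polyD _ _) _; rewrite geq_max size_polyN.
  rewrite (leq_trans (size_polyC_leq1 _)) //=.
  by apply: leq_trans (size_scale_leq _ _) _; rewrite size_polyX.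
have B : (size (Blin x) <= 2)%N.
  apply: leq_trans (size_polyD _ _) _; rewrite geq_max size_polyN.
  rewrite (leq_trans (size_polyC_leq1 _)) //=.
  by apply: leq_trans (size_scale_leq _ _) _; rewrite size_polyX.
apply: leq_trans (size_polyMleq _ _) _.
rewrite -subn1 leq_subLR; apply: leq_trans (leq_add (X _ n A) (X _ m B)) _.
by rewrite addSn addnS add1n.
Qed.

Lemma mcoef_high k s j x : (s <= k)%N -> (k < j)%N -> mcoef k s j x = 0.
Proof.
move=> sk kj; apply: nth_default; apply: leq_trans (size_mpol _ _ _) _.
by rewrite subnK.
Qed.

End MatrixCoefficients.

(** * Density of the matrix coefficients *)

Section Completeness.
Variable R : realType.
Local Notation C := R[i].
Local Notation M2 := 'M[C]_2.
Implicit Types (F G : M2 -> C).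

Lemma Alin_Blin (x : M2) : SU2 x ->
  (x o0 o0)%:P * Alin x + (x o1 o0)%:P * Blin x = 1.
Proof.
move=> /SU2_det; rewrite det2 /Alin /Blin -!mul_polyC => D.
rewrite -polyC1 -D !(polyCD, polyCM, polyCN); ring.
Qed.

Lemma deriv_expE (p : {poly C}) n :
  (p ^+ n)^`() = n%:R * (p^`() * p ^+ n.-1).
Proof. by rewrite deriv_exp mulr_natl. Qed.

(** A Clebsch-Gordan formula: an entry times a coefficient of weight k is a combination of weights k
    + 1 and k - 1. It follows on inserting the unit determinant, in the form of [Alin_Blin], into
    the term n A^(n-1) B^m, beside the derivative of A^n B^(m+1). *)
Lemma mpol_rec00 n m (x : M2) : SU2 x ->
  (n + m).+1%:R * ((x o0 o0)%:P * mpol n m x) =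
  (mpol n m.+1 x)^`() + n%:R * mpol n.-1 m x.
Proof.
move=> xS; have H := Alin_Blin xS.
rewrite /mpol derivM !deriv_expE deriv_Alin deriv_Blin /=.
move: (Alin x) (Blin x) H => A B H.
move: (x o0 o0)%:P (x o1 o0)%:P H => a c H.
rewrite -[(n + m).+1%:R]natr1 natrD -[m.+1%:R]natr1 exprS.
case: n => [|n] /=.
  by rewrite !expr0 !mulr0n; move: (B ^+ m) m%:R => Q q; ring.
rewrite [A ^+ n.+1]exprS; move: (A ^+ n) (B ^+ m) n.+1%:R m%:R => P Q p q.
have -> : p * (P * Q) = p * (P * Q) * (a * A + c * B) by rewrite H mulr1.
ring.
Qed.

Lemma mpol_rec10 n m (x : M2) : SU2 x ->
  - ((n + m).+1%:R * ((x o1 o0)%:P * mpol n m x)) =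
  (mpol n.+1 m x)^`() - m%:R * mpol n m.-1 x.
Proof.
move=> xS; have H := Alin_Blin xS.
rewrite /mpol derivM !deriv_expE deriv_Alin deriv_Blin /=.
move: (Alin x) (Blin x) H => A B H.
move: (x o0 o0)%:P (x o1 o0)%:P H => a c H.
rewrite -[(n + m).+1%:R]natr1 natrD -[n.+1%:R]natr1 exprS.
case: m => [|m] /=.
  by rewrite !expr0 !mulr0n; move: (A ^+ n) n%:R => Q q; ring.
rewrite [B ^+ m.+1]exprS; move: (A ^+ n) (B ^+ m) m.+1%:R n%:R => P Q p q.
have -> : p * (P * Q) = p * (P * Q) * (a * A + c * B) by rewrite H mulr1.
ring.
Qed.

Lemma mul00_mcoef k s j (x : M2) : SU2 x -> (s <= k)%N ->
  x o0 o0 * mcoef k s j x = k.+1%:R^-1 *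
  (j.+1%:R * mcoef k.+1 s.+1 j.+1 x + (k - s)%:R * mcoef k.-1 s j x).
Proof.
move=> xS sk; have := congr1 (fun p : {poly C} => p`_j) (mpol_rec00 (k - s) s xS).
rewrite !mulr_natl coefD !coefMn coefCM coef_deriv subnK // /mcoef subSS.
have -> : (k.-1 - s)%N = (k - s).-1 by rewrite -subn1 subnAC subn1.
by move=> <-; rewrite -[(_ * _) *+ k.+1]mulr_natl mulKf //.
Qed.

Lemma mul10_mcoef k s j (x : M2) : SU2 x -> (s <= k)%N ->
  x o1 o0 * mcoef k s j x = - k.+1%:R^-1 *
  (j.+1%:R * mcoef k.+1 s j.+1 x - s%:R * mcoef k.-1 s.-1 j x).
Proof.
move=> xS sk; have := congr1 (fun p : {poly C} => p`_j) (mpol_rec10 (k - s) s xS).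
have -> : s%:R * mcoef k.-1 s.-1 j x = (s%:R * mpol (k - s) s.-1 x)`_j.
  case: s sk => [|s] sk; first by rewrite !mul0r coef0.
  rewrite [in RHS]mulr_natl coefMn -[RHS]mulr_natl /mcoef.
  by congr (_ * (mpol _ _ _)`_j); case: k sk.
rewrite coefB coefN !mulr_natl !coefMn coefCM coef_deriv subnK //.
rewrite /mcoef subSn // => <-.
by rewrite mulrNN -[(_ * _) *+ k.+1]mulr_natl mulKf.
Qed.

Lemma mul01_mcoef k s j (x : M2) : (s <= k)%N ->
  x o0 o1 * mcoef k s j x = - mcoef k.+1 s.+1 j x + x o0 o0 * mcoefp k s j x.
Proof.
move=> sk.
have E : mpol (k - s) s.+1 x = (- (x o0 o1)%:P + x o0 o0 *: 'X) * mpol (k - s) s x.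
  by rewrite /mpol exprS -/(Blin x); ring.
rewrite /mcoef subSS E mulrDl coefD mulNr coefN coefCM -scalerAl coefZ coefXM.
by rewrite opprD opprK /mcoefp; case: j => [|j] /=; rewrite subrK.
Qed.

Lemma mul11_mcoef k s j (x : M2) : (s <= k)%N ->
  x o1 o1 * mcoef k s j x = mcoef k.+1 s j x + x o1 o0 * mcoefp k s j x.
Proof.
move=> sk.
have E : mpol (k - s).+1 s x = ((x o1 o1)%:P - x o1 o0 *: 'X) * mpol (k - s) s x.
  by rewrite /mpol exprS -/(Alin x); ring.
rewrite /mcoef subSn // E mulrBl coefB coefCM -scalerAl coefZ coefXM.
by rewrite /mcoefp; case: j => [|j] /=; rewrite subrK.
Qed.

(** The last constructor replaces a function by another with the same restriction to SU(2), since
    the product formulas use the determinant and hold only there. *)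
Inductive mspan : (M2 -> C) -> Prop :=
| mspan_coef k s j : (s <= k)%N -> mspan (mcoef k s j)
| mspanD F G : mspan F -> mspan G -> mspan (fun x => F x + G x)
| mspanZ c F : mspan F -> mspan (fun x => c * F x)
| mspan_eq F G : smooth G -> (forall x, SU2 x -> F x = G x) -> mspan F -> mspan G.

Lemma mspan_smooth F : mspan F -> smooth F.
Proof.
by elim=> // *; [apply: smooth_mcoef|apply: smoothD|apply: smoothZ].
Qed.

Lemma mspan0 : mspan (fun=> 0).
Proof.
rewrite (_ : (fun _ => _) = (fun x => 0 * mcoef 0 0 0 x)).
  by apply: mspanZ; apply: mspan_coef.
by apply/funext => x; rewrite mul0r.
Qed.

Lemma mspan1 : mspan (fun=> 1).
Proof.
rewrite (_ : (fun _ => _) = mcoef 0 0 0); first exact: mspan_coef.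
by apply/funext => x; rewrite /mcoef /mpol !expr0 mulr1 coef1.
Qed.

(** The first column is handled by the two Clebsch-Gordan formulas, and the second reduces to it by
    the definition of [Alin] and [Blin]. *)
Lemma mspan_entry p q F : mspan F -> mspan (fun x => x p q * F x).
Proof.
have sE G : smooth G -> smooth (fun x : M2 => x p q * G x).
  by move=> sG; apply: smoothM => //; apply: smooth_entry.
elim=> {F}[k s j sk|F G hF IF hG IG|c F hF IF|F G sG FG _ IF]; last first.
- by apply: mspan_eq IF => [|x xS]; [exact: sE|rewrite FG].
- apply: mspan_eq (mspanZ c IF) => [|x xS]; last by rewrite mulrCA.
  by apply: sE; apply: smoothZ; apply: mspan_smooth.
- apply: mspan_eq (mspanD IF IG) => [|x xS]; last by rewrite mulrDr.
  by apply: sE; apply: smoothD; apply: mspan_smooth.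
have S00 j' : mspan (fun x => x o0 o0 * mcoef k s j' x).
  apply: (@mspan_eq (fun x => k.+1%:R^-1 *
    (j'.+1%:R * mcoef k.+1 s.+1 j'.+1 x + (k - s)%:R * mcoef k.-1 s j' x))).
  - by apply: smoothM; [apply: smooth_entry|apply: smooth_mcoef].
  - by move=> x xS; rewrite mul00_mcoef.
  apply: mspanZ; apply: mspanD; first by apply: mspanZ; apply: mspan_coef.
  (* For s = k the coefficient of weight k - 1 has [s] out of range, but its factor k - s is 0. *)
  have [ks|sk'] := leqP k s.
    rewrite (_ : (fun x => _) = (fun=> 0)); first exact: mspan0.
    by apply/funext => x; move: ks; rewrite -subn_eq0 => /eqP ->; rewrite mul0r.
  by apply: mspanZ; apply: mspan_coef; case: k sk sk'.
have S10 j' : mspan (fun x => x o1 o0 * mcoef k s j' x).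
  apply: (@mspan_eq (fun x => - k.+1%:R^-1 *
    (j'.+1%:R * mcoef k.+1 s j'.+1 x + (- s%:R) * mcoef k.-1 s.-1 j' x))).
  - by apply: smoothM; [apply: smooth_entry|apply: smooth_mcoef].
  - by move=> x xS; rewrite mul10_mcoef // mulNr.
  apply: mspanZ; apply: mspanD; first by apply: mspanZ; apply: mspan_coef; apply: leqW.
  case: s sk {S00} => [|s] sk.
    rewrite (_ : (fun x => _) = (fun=> 0)); first exact: mspan0.
    by apply/funext => x; rewrite oppr0 mul0r.
  by apply: mspanZ; apply: mspan_coef; case: k sk.
have SP (c : 'I_2) : (forall j', mspan (fun x => x c o0 * mcoef k s j' x)) ->
    mspan (fun x => x c o0 * mcoefp k s j x).
  move=> H; case: j => [|j'] /=; last exact: H.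
  rewrite (_ : (fun x => _) = (fun=> 0)); first exact: mspan0.
  by apply/funext => x; rewrite mulr0.
case: (ord2P p) => ->; case: (ord2P q) => -> //.
  rewrite (_ : (fun x => _) =
    (fun x => -1 * mcoef k.+1 s.+1 j x + x o0 o0 * mcoefp k s j x)).
    by apply: mspanD; [apply: mspanZ; apply: mspan_coef|apply: SP].
  by apply/funext => x; rewrite mul01_mcoef // mulN1r.
rewrite (_ : (fun x => _) =
  (fun x => mcoef k.+1 s j x + x o1 o0 * mcoefp k s j x)).
  by apply: mspanD; [apply: mspan_coef; apply: leqW|apply: SP].
by apply/funext => x; rewrite mul11_mcoef.
Qed.

Lemma mspan_kernel x0 F : mspan F -> mspan (fun x => su_kernel x0 x * F x).
Proof.
move=> sF; rewrite (_ : (fun x => _) = (fun x => 2^-1 * F x + 4^-1 *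
   ((adj2 x0 o0 o0 * (x o0 o0 * F x) + adj2 x0 o0 o1 * (x o1 o0 * F x)) +
    (adj2 x0 o1 o0 * (x o0 o1 * F x) + adj2 x0 o1 o1 * (x o1 o1 * F x))))).
  apply: mspanD; [exact: mspanZ|apply: mspanZ].
  by do 2 apply: mspanD; apply: mspanZ; apply: mspan_entry.
apply/funext => x; rewrite /su_kernel /mxtrace sum2 !mxE !sum2 !mxE; ring.
Qed.

Lemma mspan_kernelX x0 n : mspan (fun x => su_kernel x0 x ^+ n).
Proof.
elim: n => [|n IH]; first exact: mspan1.
rewrite (_ : (fun x => _) = (fun x => su_kernel x0 x * su_kernel x0 x ^+ n)).
  exact: mspan_kernel.
by apply/funext => x; rewrite exprS.
Qed.

(** The span contains all powers of the kernels, so F is orthogonal to a family concentrating at any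
    given point. *)
Lemma mcoef_complete F : smooth F ->
  (forall k s j, (s <= k)%N -> (j <= k)%N ->
     Imean (fun x => F x * mcoef k s j x) = 0) ->
  forall x, SU2 x -> F x = 0.
Proof.
move=> sF F0; have H G : mspan G -> Imean (fun x => F x * G x) = 0.
  elim=> {G}[k s j sk|G G' hG IG hG' IG'|c G hG IG|G G' sG' GG' hG IG].
  - have [jk|kj] := leqP j k; first exact: F0.
    rewrite (Imean_ext (G := fun x => 0 * F x)); last first.
      by move=> x _; rewrite mcoef_high // mulr0 mul0r.
    by rewrite ImeanZ // mul0r.
  - rewrite (Imean_ext (G := fun x => F x * G x + F x * G' x)); last first.
      by move=> x _; rewrite mulrDr.
    have sG := mspan_smooth hG; have sG' := mspan_smooth hG'.
    by rewrite ImeanD ?IG ?IG' ?addr0 //; apply: smoothM.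
  - rewrite (Imean_ext (G := fun x => c * (F x * G x))); last first.
      by move=> x _; rewrite mulrCA.
    by rewrite ImeanZ ?IG ?mulr0 //; apply: smoothM => //; apply: mspan_smooth.
  - by rewrite -IG; apply: Imean_ext => x xS; rewrite GG'.
move=> x xS; apply: Imean_kernel_eq0 => // n; apply: H; exact: mspan_kernelX.
Qed.

End Completeness.

(** * Linear independence of the matrix coefficients *)

Section Independence.
Variable R : realType.
Local Notation C := R[i].
Local Notation M2 := 'M[C]_2.
Implicit Types (F G : M2 -> C).

Lemma suX_sum (N : nat) i (c : nat -> C) (F : nat -> M2 -> C) x :
  (forall n, smooth (F n)) ->
  suX i (fun y => \sum_(n < N) c n * F n y) x = \sum_(n < N) c n * suX i (F n) x.
Proof.
move=> sF; apply: is_rd_rderiv; apply: is_rd_sum => n.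
have := is_rdM (is_rd_cst (c n) (x *m suE R i) x) (smooth_rd (x *m suE R i) x (sF n)).
by rewrite mul0r add0r.
Qed.

Lemma suXD i F G x : smooth F -> smooth G ->
  suX i (fun y => F y + G y) x = suX i F x + suX i G x.
Proof. by move=> sF sG; apply: is_rd_rderiv; apply: is_rdD; apply: smooth_rd. Qed.

Lemma suXZ i c F x : smooth F -> suX i (fun y => c * F y) x = c * suX i F x.
Proof.
move=> sF; apply: is_rd_rderiv.
have := is_rdM (is_rd_cst c (x *m suE R i) x) (smooth_rd (x *m suE R i) x sF).
by rewrite mul0r add0r.
Qed.

Lemma suX_conj i F x : smooth F -> suX i (fun y => conjc (F y)) x = conjc (suX i F x).
Proof. by move=> sF; apply: is_rd_rderiv; apply: is_rd_conj; apply: smooth_rd. Qed.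

Lemma suXM i F G x : smooth F -> smooth G ->
  suX i (fun y => F y * G y) x = suX i F x * G x + F x * suX i G x.
Proof. by move=> sF sG; apply: is_rd_rderiv; apply: is_rdM; apply: smooth_rd. Qed.

Lemma suX0 i (x : M2) : suX i (fun _ : M2 => 0 : C) x = 0.
Proof. by apply: is_rd_rderiv; apply: is_rd_cst. Qed.

(** Applying [T] to the relation and subtracting the last eigenvalue times the relation removes the
    last term. The functions [f n] may vanish, so the conclusion concerns the products. [T] is a
    parameter because both the Casimir operator and the field of E_1 are used. *)
Lemma eigen_sum0 (T : (M2 -> C) -> M2 -> C) (N : nat) (theta c : nat -> C)
    (f : nat -> M2 -> C) :
  (forall N (c : nat -> C) (F : nat -> M2 -> C) x, (forall n, smooth (F n)) ->
    SU2 x ->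
    T (fun y => \sum_(n < N) c n * F n y) x = \sum_(n < N) c n * T (F n) x) ->
  (forall F G x, smooth F -> smooth G -> (forall y, SU2 y -> F y = G y) ->
    SU2 x -> T F x = T G x) ->
  (forall n, smooth (f n)) ->
  (forall n x, SU2 x -> T (f n) x = theta n * f n x) ->
  (forall m n, (m < N)%N -> (n < N)%N -> theta m = theta n -> m = n) ->
  (forall x, SU2 x -> \sum_(n < N) c n * f n x = 0) ->
  forall n x, (n < N)%N -> SU2 x -> c n * f n x = 0.
Proof.
move=> Tsum Text sf Tf; elim: N c => [//|N IH] c thI f0 n x nN xS.
have f1 y : SU2 y -> \sum_(n < N.+1) (c n * theta n) * f n y = 0.
  move=> yS; transitivity (T (fun y => \sum_(n < N.+1) c n * f n y) y).
    by rewrite Tsum //; apply: eq_bigr => m _; rewrite Tf // mulrA.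
  rewrite (Text _ (fun y => \sum_(n < 0) c n * f n y)) //.
  - by rewrite Tsum // big_ord0.
  - by apply: smooth_sum => m; apply: smoothZ.
  - by apply: smooth_sum => m; apply: smoothZ.
  - by move=> z zS; rewrite f0 // big_ord0.
have lowf m y : (m < N)%N -> SU2 y -> c m * f m y = 0.
  move=> mN yS.
  have : (c m * (theta m - theta N)) * f m y = 0.
    apply: (IH (fun m => c m * (theta m - theta N))) => // [p q pN qN|z zS].
      by apply: thI; apply: ltnW.
    have := f1 z zS; rewrite big_ord_recr /= => E1.
    have := f0 z zS; rewrite big_ord_recr /= => E0.
    under eq_bigr do rewrite mulrBr mulrBl.
    rewrite sumrB -[X in X - _](addrK (c N * theta N * f N z)) E1 sub0r.
    have -> : \sum_(m < N) c m * theta N * f m z = theta N * \sum_(m < N) c m * f m z.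
      by rewrite mulr_sumr; apply: eq_bigr => p _; ring.
    rewrite -[X in theta N * X](addrK (c N * f N z)) E0 sub0r; ring.
  have /negPf tn : theta m - theta N != 0.
    rewrite subr_eq0; apply/eqP => /thI E.
    have : m = N by apply: E; rewrite // ltnS ltnW.
    by move=> mE; rewrite mE ltnn in mN.
  by rewrite mulrAC => /eqP; rewrite mulf_eq0 tn orbF => /eqP.
have [->|nN'] := eqVneq n N; last first.
  by apply: lowf => //; rewrite ltn_neqAle nN' -ltnS.
have := f0 x xS; rewrite big_ord_recr /= big1 ?add0r // => m _.
exact: lowf.
Qed.

(** It acts on all coefficients of weight k by -k (k + 2), and these scalars are distinct. *)
Definition casimir F x : C := suX ord0 (suX ord0 F) x
  + suX (inord 1) (suX (inord 1) F) x + suX (inord 2) (suX (inord 2) F) x.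

Lemma smooth_mcoefp k s j : smooth (@mcoefp R k s j).
Proof. by case: j => [|j]; [apply: smooth_cst|apply: smooth_mcoef]. Qed.

Lemma suX1_mcoefp k s j x : (s <= k)%N -> suX (inord 1) (@mcoefp R k s j) x =
  (k%:R - j%:R + 2) * (if j is i.+1 then mcoefp k s i x else 0)
   - j%:R * mcoef k s j x.
Proof.
move=> sk; case: j => [|j]; first by rewrite suX0; ring.
by rewrite /= suX1_mcoef // -natr1; ring.
Qed.

Lemma suX2_mcoefp k s j x : (s <= k)%N -> suX (inord 2) (@mcoefp R k s j) x =
  - iC R * ((k%:R - j%:R + 2) * (if j is i.+1 then mcoefp k s i x else 0)
   + j%:R * mcoef k s j x).
Proof.
move=> sk; case: j => [|j]; first by rewrite suX0; ring.
by rewrite /= suX2_mcoef // -natr1; ring.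
Qed.

Lemma casimir_mcoef k s j x : (s <= k)%N ->
  casimir (mcoef k s j) x = - (k%:R ^+ 2 + 2 * k%:R) * mcoef k s j x.
Proof.
move=> sk; rewrite /casimir.
have c1 := smooth_mcoef R k s j.+1; have c0 := smooth_mcoefp k s j.
have -> : suX ord0 (mcoef k s j) =
    (fun x : M2 => - iC R * (k%:R - 2 * j%:R) * mcoef k s j x).
  by apply/funext => y; rewrite suX0_mcoef.
have -> : suX (inord 1) (mcoef k s j) = (fun x : M2 =>
    (k%:R - j%:R + 1) * mcoefp k s j x + (- j.+1%:R) * mcoef k s j.+1 x).
  by apply/funext => y; rewrite suX1_mcoef // mulNr.
have -> : suX (inord 2) (mcoef k s j) = (fun x : M2 =>
    - iC R * (k%:R - j%:R + 1) * mcoefp k s j x + (- iC R * j.+1%:R) * mcoef k s j.+1 x).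
  by apply/funext => y; rewrite suX2_mcoef //; ring.
rewrite suXZ; last exact: smooth_mcoef.
rewrite !suXD ?suXZ //; try by apply: smoothZ.
rewrite suX0_mcoef // suX1_mcoefp // suX2_mcoefp // suX1_mcoef // suX2_mcoef //=.
rewrite -!natr1.
have I := iC_sq R; set ii := iC R in I *; set p := if j is _.+1 then _ else _.
transitivity ((ii * ii) * (k%:R - 2 * j%:R) * (k%:R - 2 * j%:R) * mcoef k s j x
  + ((k%:R - j%:R + 1) * ((k%:R - j%:R + 2) * p - j%:R * mcoef k s j x)
     - (j%:R + 1) * ((k%:R - (j%:R + 1) + 1) * mcoef k s j x - (j%:R + 1 + 1) * mcoef k s j.+2 x))
  + (ii * ii) * ((k%:R - j%:R + 1) * ((k%:R - j%:R + 2) * p + j%:R * mcoef k s j x)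
     + (j%:R + 1) * ((k%:R - (j%:R + 1) + 1) * mcoef k s j x + (j%:R + 1 + 1) * mcoef k s j.+2 x))).
  ring.
rewrite I; ring.
Qed.

Lemma poly0_nat (p : {poly C}) : (forall n : nat, p.[n%:R] = 0) -> p = 0.
Proof.
move=> H; apply/eqP; apply: contraT => p0.
have := @max_poly_roots _ p [seq n%:R | n <- iota 0 (size p)] p0.
rewrite size_map size_iota ltnn; apply.
  by apply/allP => _ /mapP[n _ ->]; rewrite /root H.
by rewrite map_inj_uniq ?iota_uniq // => m n /eqP; rewrite eqr_nat => /eqP.
Qed.

Lemma mcoef0E k s (x : M2) :
  mcoef k s 0 x = x o1 o1 ^+ (k - s) * (- x o0 o1) ^+ s.
Proof.
rewrite /mcoef -horner_coef0 /mpol hornerM !horner_exp /Alin /Blin.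
by rewrite !hornerE ?mulr0 ?subr0 ?addr0.
Qed.

(** At the real rotation whose second column is proportional to (-n, 1), the sum is a nonzero factor
    times the value at n of the polynomial with coefficients [alpha]; n runs over all natural
    numbers. *)
Lemma mcoef0_free k (alpha : nat -> C) :
  (forall x, SU2 x -> \sum_(s < k.+1) alpha s * mcoef k s 0 x = 0) ->
  forall s, (s <= k)%N -> alpha s = 0.
Proof.
move=> H; pose p := \poly_(s < k.+1) alpha s.
suff p0 : p = 0.
  move=> s sk; have := congr1 (fun q : {poly C} => q`_s) p0.
  by rewrite coef_poly ltnS sk coef0.
apply: poly0_nat => n.
pose rho : R := (Num.sqrt (1 + n%:R ^+ 2))^-1.
have n1 : 0 < 1 + n%:R ^+ 2 :> R by rewrite ltr_pwDl // sqr_ge0.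
have rho0 : rho != 0 by rewrite invr_eq0 gt_eqF // sqrtr_gt0.
have rho2 : rho ^+ 2 * (1 + n%:R ^+ 2) = 1.
  by rewrite /rho exprVn sqr_sqrtr ?ltW // mulVf // gt_eqF.
have xS : SU2 (quat rho 0 (- (n%:R * rho)) 0).
  by apply: SU2_quat; rewrite -[RHS]rho2; ring.
have := H _ xS.
under eq_bigr do rewrite mcoef0E !mxE /=.
have -> : (rho -i* 0) = rho%:C by rewrite oppr0.
have -> : - (- (n%:R * rho) +i* 0) = n%:R * rho%:C.
  by rewrite -[n%:R in RHS](rmorph_nat (real_complex R)) -rmorphM /=;
    apply/eqP; rewrite eq_complex /= opprK oppr0 !eqxx.
have E (s : 'I_k.+1) : alpha s * (rho%:C ^+ (k - s) * (n%:R * rho%:C) ^+ s) =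
    rho%:C ^+ k * (alpha s * n%:R ^+ s).
  have -> : rho%:C ^+ k = rho%:C ^+ (k - s) * rho%:C ^+ s.
    by rewrite -exprD subnK // leq_ord.
  by rewrite exprMn; ring.
under eq_bigr do rewrite E.
rewrite -mulr_sumr horner_poly => /eqP; rewrite mulf_eq0 expf_eq0.
have /negPf -> : rho%:C != 0 :> C by rewrite (fmorph_eq0 (real_complex R)).
by rewrite andbF => /eqP.
Qed.

(** The operator X_1 + i X_2 takes index j + 1 to index j with factor 2 (k - j), nonzero in the
    range, so the relation descends to j = 0. *)
Lemma mcoefj_free k j (alpha : nat -> C) : (j <= k)%N ->
  (forall x, SU2 x -> \sum_(s < k.+1) alpha s * mcoef k s j x = 0) ->
  forall s, (s <= k)%N -> alpha s = 0.
Proof.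
elim: j => [|j IH] jk H; first exact: mcoef0_free.
apply: IH => [|x xS]; first exact: ltnW.
pose F x := \sum_(s < k.+1) alpha s * mcoef k s j.+1 x.
have sF : smooth F by apply: smooth_sum => s; apply: smoothZ; apply: smooth_mcoef.
have X0 i : suX i F x = 0.
  have s0 : smooth (fun _ : M2 => 0 : C) by apply: smooth_cst.
  by rewrite (suX_ext i sF s0) // suX0.
have sm n : smooth (@mcoef R k n j.+1) by apply: smooth_mcoef.
have S i : \sum_(s < k.+1) alpha s * suX i (mcoef k s j.+1) x = 0.
  by rewrite -[RHS](X0 i) /F (@suX_sum k.+1 i alpha (fun n => mcoef k n j.+1)).
have kj : k%:R - j%:R != 0 :> C.
  by rewrite subr_eq0 eqr_nat gtn_eqF.
have := f_equal2 (fun z w => z + iC R * w) (S (inord 1)) (S (inord 2)).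
rewrite mulr0 addr0.
rewrite mulr_sumr -big_split /=.
have E (s : 'I_k.+1) : alpha s * suX (inord 1) (mcoef k s j.+1) x
   + iC R * (alpha s * suX (inord 2) (mcoef k s j.+1) x) =
   2 * (k%:R - j%:R) * (alpha s * mcoef k s j x).
  have sk : (s <= k)%N := leq_ord s.
  rewrite suX1_mcoef // suX2_mcoef //= -[j.+1%:R]natr1.
  set P := (_ - _ + 1) * _; set Q := j.+2%:R * _.
  transitivity (alpha s * (P - Q) - (iC R * iC R) * (alpha s * (P + Q))); first ring.
  rewrite iC_sq /P /Q; ring.
under eq_bigr do rewrite E.
rewrite -mulr_sumr => /eqP; rewrite mulf_eq0 mulf_eq0 (negPf kj) orbF.
by rewrite pnatr_eq0 /= => /eqP.
Qed.

(** The Casimir operator separates the weights k, the field of E_1 separates the indices j within a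
    weight, and [mcoefj_free] separates s. *)
Lemma mcoef_free N (alpha : nat -> nat -> nat -> C) :
  (forall x, SU2 x -> \sum_(k < N) \sum_(j < k.+1) \sum_(s < k.+1)
     alpha k s j * mcoef k s j x = 0) ->
  forall k s j, (k < N)%N -> (s <= k)%N -> (j <= k)%N -> alpha k s j = 0.
Proof.
move=> H k s j kN sk jk.
pose fj k j x := \sum_(s < k.+1) alpha k s j * mcoef k s j x.
pose f k x := \sum_(j < k.+1) 1 * fj k j x.
have sfj k' j' : smooth (fj k' j').
  by apply: smooth_sum => n; apply: smoothZ; apply: smooth_mcoef.
have sf k' : smooth (f k') by apply: smooth_sum => n; apply: smoothZ.
have casfj k' j' x : casimir (fj k' j') x = - (k'%:R ^+ 2 + 2 * k'%:R) * fj k' j' x.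
  have S i : suX i (fj k' j') = (fun x => \sum_(s < k'.+1) alpha k' s j' * suX i (mcoef k' s j') x).
    apply/funext => y; rewrite /fj (@suX_sum k'.+1 i (fun s => alpha k' s j') (fun n => mcoef k' n j')) // => n.
    exact: smooth_mcoef.
  have S2 i y : suX i (suX i (fj k' j')) y =
     \sum_(s < k'.+1) alpha k' s j' * suX i (suX i (mcoef k' s j')) y.
    rewrite S (@suX_sum k'.+1 i (fun s => alpha k' s j') (fun n => suX i (mcoef k' n j'))) // => n.
    by apply: smooth_suX; apply: smooth_mcoef.
  rewrite /casimir !S2 -!big_split mulr_sumr; apply: eq_bigr => n _.
  by rewrite /= -!mulrDr -/(casimir (mcoef k' n j') x) casimir_mcoef ?leq_ord // mulrCA.
have cassum N' (c : nat -> C) (F : nat -> M2 -> C) x : (forall n, smooth (F n)) ->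
    casimir (fun y => \sum_(n < N') c n * F n y) x = \sum_(n < N') c n * casimir (F n) x.
  move=> sF; rewrite /casimir.
  have S i : suX i (fun y => \sum_(n < N') c n * F n y) =
     (fun y => \sum_(n < N') c n * suX i (F n) y).
    by apply/funext => y; rewrite suX_sum.
  have S2 i : suX i (fun y => \sum_(n < N') c n * suX i (F n) y) x =
     \sum_(n < N') c n * suX i (suX i (F n)) x.
    by rewrite (@suX_sum N' i c (fun n => suX i (F n))) // => n; apply: smooth_suX.
  rewrite !S !S2.
  by rewrite -!big_split; apply: eq_bigr => n _; rewrite /= -!mulrDr.
have casext F G x : smooth F -> smooth G -> (forall y, SU2 y -> F y = G y) ->
    SU2 x -> casimir F x = casimir G x.
  move=> sF sG FG xS.
  have E i : suX i (suX i F) x = suX i (suX i G) x.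
    apply: suX_ext xS; [exact: smooth_suX|exact: smooth_suX|].
    by move=> y yS; apply: suX_ext yS.
  by rewrite /casimir !E.
have Hk x : SU2 x -> 1 * f k x = 0.
  move=> xS.
  apply: (@eigen_sum0 casimir N (fun k => - (k%:R ^+ 2 + 2 * k%:R)) (fun=> 1) f) => //.
  - by move=> N' c F y sF yS; apply: cassum.
  - move=> n y yS; rewrite /f (cassum n.+1 (fun=> 1) (fj n)) // mulr_sumr; apply: eq_bigr => m _.
    by rewrite casfj mulrCA.
  - move=> m n _ _ /oppr_inj E; apply/eqP; rewrite -(eqr_nat C).
    have : (m%:R - n%:R) * (m + n + 2)%:R = 0 :> C.
      rewrite !natrD.
      transitivity (m%:R ^+ 2 + 2 * m%:R - (n%:R ^+ 2 + 2 * n%:R) : C); first ring.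
      by rewrite E subrr.
    move/eqP; rewrite mulf_eq0 subr_eq0 => /orP[//|].
    by rewrite pnatr_eq0 addn2.
  - move=> y yS; rewrite -[RHS](H y yS); apply: eq_bigr => m _.
    by rewrite mul1r; apply: eq_bigr => n _; rewrite mul1r.
have Hj x : SU2 x -> 1 * fj k j x = 0.
  move=> xS.
  apply: (@eigen_sum0 (suX ord0) k.+1 (fun j => - iC R * (k%:R - 2 * j%:R)) (fun=> 1) (fj k)) => //.
  - by move=> N' c F y sF yS; apply: suX_sum.
  - by move=> F G y sF sG FG yS; apply: suX_ext.
  - move=> n y yS; rewrite /fj (@suX_sum k.+1 ord0 (fun s => alpha k s n) (fun s => mcoef k s n)); last first.
      by move=> m; apply: smooth_mcoef.
    rewrite mulr_sumr; apply: eq_bigr => m _.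
    by rewrite suX0_mcoef ?leq_ord // mulrCA.
  - move=> m n _ _ E; apply/eqP; rewrite -(eqr_nat C).
    have i0 : - iC R != 0.
      by rewrite oppr_eq0 eq_complex /= oner_eq0 andbF.
    have := mulfI i0 E => /(congr1 (fun z => k%:R - z)); rewrite !opprD !addrA !subrr !add0r !opprK.
    by move=> /(mulfI _) -> //; rewrite pnatr_eq0.
  - by move=> y yS; rewrite -[RHS](Hk y yS) mul1r.
apply: (@mcoefj_free k j (fun s => alpha k s j) jk _ s sk) => x xS.
by have := Hj x xS; rewrite mul1r.
Qed.

End Independence.

(** * The Laplacian on 1-forms of SU(2) *)

Opaque rderiv.

Section Forms.
Variables (R : realType) (a b : R).
Hypotheses (a0 : 0 < a) (b0 : 0 < b).
Local Notation C := R[i].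
Local Notation M2 := 'M[C]_2.
Local Notation G := (gSU2 a0 b0 b0).
Local Notation i0 := (ord0 : 'I_3).
Local Notation i1 := (inord 1 : 'I_3).
Local Notation i2 := (inord 2 : 'I_3).
Implicit Types (f g : M2 -> C) (w p : 'I_3 -> M2 -> C).

Lemma sum3 (V : nmodType) (F : 'I_3 -> V) : \sum_i F i = F i0 + F i1 + F i2.
Proof.
rewrite !big_ord_recl big_ord0 addr0 addrA; congr (_ + F _ + F _);
  by apply: val_inj; rewrite /= inordK.
Qed.

Definition Yop (i : 'I_3) f : M2 -> C := fun x => (scal a b b i)%:C * suX i f x.

Lemma lfieldE i f : smooth f -> lfield (G := G) i f = Yop i f.
Proof.
move=> sf; apply/funext => x; rewrite /lfield /Yop /suX /=.
by rewrite -scalemxAr rderivZv.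
Qed.

Lemma smooth_Yop i f : smooth f -> smooth (Yop i f).
Proof. by move=> sf; apply: smoothZ; apply: smooth_suX. Qed.

Definition cdiv w : M2 -> C := fun x =>
  Yop i0 (w i0) x + Yop i1 (w i1) x + Yop i2 (w i2) x.

Lemma scalE : [/\ scal a b b i0 = a, scal a b b i1 = b & scal a b b i2 = b].
Proof. by rewrite /scal /= !inordK. Qed.

(** The operator star d in the frame a E_1, b E_2, b E_3. Its zero-order terms are structure
    constants: [b E_2, b E_3] = 2 (b^2 / a) a E_1, while the other two brackets carry the factor 2
    a. *)
Definition ccurl w : 'I_3 -> M2 -> C := fun i x =>
  nth 0 [:: Yop i1 (w i2) x - Yop i2 (w i1) x - (2 * (b ^+ 2 / a))%:C * w i0 x;
            Yop i2 (w i0) x - Yop i0 (w i2) x - (2 * a)%:C * w i1 x;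
            Yop i0 (w i1) x - Yop i1 (w i0) x - (2 * a)%:C * w i2 x] i.

Lemma ccurlE w x :
  [/\ ccurl w i0 x = Yop i1 (w i2) x - Yop i2 (w i1) x - (2 * (b ^+ 2 / a))%:C * w i0 x,
      ccurl w i1 x = Yop i2 (w i0) x - Yop i0 (w i2) x - (2 * a)%:C * w i1 x &
      ccurl w i2 x = Yop i0 (w i1) x - Yop i1 (w i0) x - (2 * a)%:C * w i2 x].
Proof. by rewrite /ccurl /= !inordK. Qed.

Lemma smooth_cdiv w : (forall i, smooth (w i)) -> smooth (cdiv w).
Proof. by move=> sw; do 2?apply: smoothD; apply: smooth_Yop. Qed.

Lemma smooth_ccurl w : (forall i, smooth (w i)) -> forall i, smooth (ccurl w i).
Proof.
move=> sw i; have H j l m c : smooth (fun x => Yop j (w l) x - Yop l (w j) x - c * w m x).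
  apply: smoothB; last exact: smoothZ.
  by apply: smoothB; apply: smooth_Yop.
rewrite /ccurl; case: (ord3P i) => -> /=; rewrite ?inordK //=; exact: H.
Qed.

Lemma eps_inord (p q r : nat) : (p < 3)%N -> (q < 3)%N -> (r < 3)%N ->
  eps R (inord p) (inord q) (inord r) = (epsZ p q r)%:~R.
Proof. by move=> p3 q3 r3; rewrite /eps !inordK. Qed.

Lemma inord0 : i0 = inord 0.
Proof. by apply: val_inj; rewrite /= inordK. Qed.

Lemma eps_ii : (forall i j, eps R i i j = 0) * (forall i j, eps R i j i = 0)
  * (forall i j, eps R j i i = 0).
Proof.
by do !split; move=> i j; rewrite /eps;
  case: i j => [[|[|[|i]]] Hi] [[|[|[|j]]] Hj].
Qed.

Lemma eps1 : [/\ eps R i0 i1 i2 = 1, eps R i1 i2 i0 = 1 & eps R i2 i0 i1 = 1].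
Proof. by rewrite inord0 !eps_inord. Qed.

Lemma epsN1 : [/\ eps R i0 i2 i1 = -1, eps R i1 i0 i2 = -1 & eps R i2 i1 i0 = -1].
Proof. by rewrite inord0 !eps_inord. Qed.

Lemma eps_values : (eps R i0 i1 i2 = 1) * (eps R i1 i2 i0 = 1) * (eps R i2 i0 i1 = 1)
  * (eps R i0 i2 i1 = -1) * (eps R i1 i0 i2 = -1) * (eps R i2 i1 i0 = -1).
Proof. by have [e1 e2 e3] := eps1; have [n1 n2 n3] := epsN1. Qed.

Let epsC := (eps_values, eps_ii).

Let castC := (rmorph0 (real_complex R), rmorph1 (real_complex R),
  rmorphN1 (real_complex R)).

Lemma star2E (h : form2 G) x : (forall i j, h j i x = - h i j x) ->
  [/\ star2 h i0 x = h i1 i2 x, star2 h i1 x = h i2 i0 x & star2 h i2 x = h i0 i1 x].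
Proof.
move=> H; rewrite /star2 !sum3 !epsC !castC (H i0 i1) (H i1 i2) (H i2 i0).
rewrite (H i0 i0) (H i1 i1) (H i2 i2).
by split; field; rewrite ?pnatr_eq0.
Qed.

Lemma struct_sum i j w x : \sum_l (struct G i j l)%:C * w l x =
  (2 * eps R i j i0 * scal a b b i * scal a b b j / a)%:C * w i0 x +
  (2 * eps R i j i1 * scal a b b i * scal a b b j / b)%:C * w i1 x +
  (2 * eps R i j i2 * scal a b b i * scal a b b j / b)%:C * w i2 x.
Proof. by rewrite sum3 /= /scal_struct; have [-> -> ->] := scalE. Qed.

Lemma struct_sumC : forall w x,
  [/\ \sum_l (struct G i1 i2 l)%:C * w l x = (2 * (b ^+ 2 / a))%:C * w i0 x,
      \sum_l (struct G i2 i0 l)%:C * w l x = (2 * a)%:C * w i1 x &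
      \sum_l (struct G i0 i1 l)%:C * w l x = (2 * a)%:C * w i2 x].
Proof.
move=> w x; have an : a != 0 by rewrite gt_eqF.
have bn : b != 0 by rewrite gt_eqF.
rewrite !struct_sum; have [-> -> ->] := scalE; rewrite !epsC.
split.
- rewrite (_ : 2 * 1 * b * b / a = 2 * (b ^+ 2 / a)); last by field.
  rewrite !mulr0 !mul0r ?castC ?mul0r; ring.
- rewrite (_ : 2 * 1 * b * a / b = 2 * a); last by field.
  rewrite !mulr0 !mul0r ?castC ?mul0r; ring.
- rewrite (_ : 2 * 1 * a * b / b = 2 * a); last by field.
  rewrite !mulr0 !mul0r ?castC ?mul0r; ring.
Qed.

Lemma eps_anti i j k : eps R j i k = - eps R i j k.
Proof.
by rewrite /eps -rmorphN; congr (_%:~R); case: i j k => [[|[|[|i]]] Hi] [[|[|[|j]]] Hj] [[|[|[|k]]] Hk].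
Qed.

Lemma d1_anti w i j x : d1 (G := G) w j i x = - d1 (G := G) w i j x.
Proof.
have S : \sum_l (struct G j i l)%:C * w l x = - \sum_l (struct G i j l)%:C * w l x.
  rewrite -sumrN; apply: eq_bigr => l _; rewrite -mulNr -rmorphN /=.
  by rewrite /scal_struct eps_anti; congr (_%:C * _); ring.
rewrite /d1 S; move: (lfield _ _ _) (lfield _ _ _) (\sum_l _) => p q r.
by rewrite opprK !opprB addrC.
Qed.

Lemma star2_d1E w : (forall i, smooth (w i)) -> star2 (d1 (G := G) w) = ccurl w.
Proof.
move=> sw; apply/funext => k; apply/funext => x.
have [C0 C1 C2] := ccurlE w x.
have [D0 D1 D2] := star2E (fun i j => d1_anti w i j x).
have [S0 S1 S2] := struct_sumC w x.
have L i j : lfield (G := G) i (w j) x = Yop i (w j) x by rewrite lfieldE.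
case: (ord3P k) => ->.
- by rewrite D0 C0 /d1 S0 (L i1 i2) (L i2 i1); move: (Yop _ _ x) (Yop _ _ x).
- by rewrite D1 C1 /d1 S1 (L i2 i0) (L i0 i2); move: (Yop _ _ x) (Yop _ _ x).
- by rewrite D2 C2 /d1 S2 (L i0 i1) (L i1 i0); move: (Yop _ _ x) (Yop _ _ x).
Qed.

(** Each bracket of two frame fields is a multiple of the third, so the structure terms of [d2] only
    meet diagonal entries of the antisymmetric array [star1 w], which vanish. *)
Lemma delta1E w : (forall i, smooth (w i)) ->
  delta1 (G := G) w = (fun x => - cdiv w x).
Proof.
move=> sw; apply/funext => x; rewrite /delta1; congr (- _).
have S12 : star1 (G := G) w i1 i2 = w i0.
  by apply/funext => y; rewrite /star1 sum3 !epsC !castC !mul0r mul1r !addr0.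
have S02 : star1 (G := G) w i0 i2 = (fun y => -1 * w i1 y).
  by apply/funext => y; rewrite /star1 sum3 !epsC !castC !mul0r addr0 add0r.
have S01 : star1 (G := G) w i0 i1 = w i2.
  by apply/funext => y; rewrite /star1 sum3 !epsC !castC !mul0r mul1r !add0r.
have S11 i y : star1 (G := G) w i i y = 0.
  by rewrite /star1 sum3 !epsC !castC !mul0r !addr0.
rewrite /star3 /d2 -inord0 S12 S02 S01 !lfieldE //; last exact: smoothZ.
have [T12 T20 T01] := struct_sumC (fun l => star1 (G := G) w l i0) x.
have [_ _ U01] := struct_sumC (fun l => star1 (G := G) w l i2) x.
have V02 : \sum_l (struct G i0 i2 l)%:C * star1 (G := G) w l i1 x = 0.
  by rewrite (struct_sum i0 i2 (fun l => star1 (G := G) w l i1) x) !epsC !mulr0 !mul0r ?castC ?mul0r S11 mulr0 !addr0.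
rewrite T12 U01 V02 !S11 !mulr0 !subr0 addr0 /cdiv {2}/Yop suXZ //.
rewrite mulN1r mulrN opprK; congr (_ + _).
Qed.

Lemma Delta1E w i x : (forall i, smooth (w i)) ->
  Delta1 (G := G) w i x = - Yop i (cdiv w) x + ccurl (ccurl w) i x.
Proof.
move=> sw; rewrite /Delta1 /d0 delta1E // /delta2 (star2_d1E sw).
rewrite (star2_d1E (smooth_ccurl sw)).
have sc := smooth_cdiv sw.
rewrite lfieldE; last exact: smoothN.
congr (_ + _); rewrite /Yop.
have -> : (fun y => - cdiv w y) = (fun y => -1 * cdiv w y).
  by apply/funext => y; rewrite mulN1r.
by rewrite suXZ // mulN1r mulrN.
Qed.

End Forms.

(** * The invariant blocks of the Laplacian *)

Section Eigenforms.
Variables (R : realType) (a b : R).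
Hypotheses (a0 : 0 < a) (b0 : 0 < b).
Local Notation C := R[i].
Local Notation M2 := 'M[C]_2.
Local Notation G := (gSU2 a0 b0 b0).
Local Notation i0 := (ord0 : 'I_3).
Local Notation i1 := (inord 1 : 'I_3).
Local Notation i2 := (inord 2 : 'I_3).
Local Notation Yop := (Yop a b).
Local Notation ccurl := (ccurl a b).
Local Notation cdiv := (cdiv a b).

(** The index is shifted by 2 with zeros in front, as coefficients of index above k also vanish. The
    blocks J = 0, ..., k + 2, each using J, J + 1 and J + 2, then cover all coefficients, including
    the truncated blocks, without negative indices. *)
Definition ecoef (k s J : nat) (x : M2) : C := if J is j.+2 then mcoef k s j x else 0.

Arguments ecoef : simpl never.

Lemma smooth_ecoef k s J : smooth (ecoef k s J).
Proof. by case: J => [|[|J]]; [apply: smooth_cst|apply: smooth_cst|apply: smooth_mcoef]. Qed.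

Definition ecoefp k s J x : C := if J is j.+1 then ecoef k s j x else 0.

Arguments ecoefp : simpl never.

Lemma ecoefpSS k s j x : ecoefp k s j.+2 x = mcoefp k s j x.
Proof. by case: j. Qed.

Lemma suX0_ecoef k s J x : (s <= k)%N ->
  suX i0 (ecoef k s J) x = - iC R * (k%:R - 2 * J%:R + 4) * ecoef k s J x.
Proof.
move=> sk; case: J => [|[|j]].
- by rewrite /ecoef suX0 mulr0.
- by rewrite /ecoef suX0 mulr0.
rewrite /ecoef suX0_mcoef // -[j.+2%:R]natr1 -[j.+1%:R]natr1.
by move: (mcoef k s j x) => c; ring.
Qed.

Lemma suX1_ecoef k s J x : (s <= k)%N -> suX i1 (ecoef k s J) x =
  (k%:R - J%:R + 3) * ecoefp k s J x - (J%:R - 1) * ecoef k s J.+1 x.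
Proof.
move=> sk; case: J => [|[|j]].
- by rewrite /ecoefp /ecoef suX0 !mulr0 subr0.
- by rewrite /ecoefp /ecoef suX0 subrr mul0r mulr0 subr0.
rewrite ecoefpSS /ecoef suX1_mcoef // -[j.+2%:R]natr1 -[j.+1%:R]natr1.
by move: (mcoef k s j.+1 x) (mcoefp k s j x) => c d; ring.
Qed.

Lemma suX2_ecoef k s J x : (s <= k)%N -> suX i2 (ecoef k s J) x =
  - iC R * ((k%:R - J%:R + 3) * ecoefp k s J x + (J%:R - 1) * ecoef k s J.+1 x).
Proof.
move=> sk; case: J => [|[|j]].
- by rewrite /ecoefp /ecoef suX0 !mulr0 addr0 mulr0.
- by rewrite /ecoefp /ecoef suX0 subrr mul0r mulr0 addr0 mulr0.
rewrite ecoefpSS /ecoef suX2_mcoef // -[j.+2%:R]natr1 -[j.+1%:R]natr1.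
by move: (mcoef k s j.+1 x) (mcoefp k s j x) => c d; ring.
Qed.

(* In terms of w_+ = w_1 + i w_2 and w_- = w_1 - i w_2 this is
   w_0 = al e_(J+1), w_+ = - i be e_J, w_- = - i ga e_(J+2). *)
Definition bform (k s J : nat) (al be ga : R) : 'I_3 -> M2 -> C := fun i x =>
  nth 0 [:: al%:C * ecoef k s J.+1 x;
    (- (iC R / 2) * be%:C) * ecoef k s J x + (- (iC R / 2) * ga%:C) * ecoef k s J.+2 x;
    (- 2^-1 * be%:C) * ecoef k s J x + (2^-1 * ga%:C) * ecoef k s J.+2 x] i.

Lemma bformE k s J al be ga :
  [/\ bform k s J al be ga i0 = (fun x => al%:C * ecoef k s J.+1 x),
    bform k s J al be ga i1 = (fun x =>
      (- (iC R / 2) * be%:C) * ecoef k s J x + (- (iC R / 2) * ga%:C) * ecoef k s J.+2 x) &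
    bform k s J al be ga i2 = (fun x =>
      (- 2^-1 * be%:C) * ecoef k s J x + (2^-1 * ga%:C) * ecoef k s J.+2 x)].
Proof. by split; apply/funext => x; rewrite /bform /= ?inordK. Qed.

Lemma smooth_bform k s J al be ga i : smooth (bform k s J al be ga i).
Proof.
have [E0 E1 E2] := bformE k s J al be ga.
case: (ord3P i) => ->; rewrite ?E0 ?E1 ?E2.
- by apply: smoothZ; apply: smooth_ecoef.
- by apply: smoothD; apply: smoothZ; apply: smooth_ecoef.
- by apply: smoothD; apply: smoothZ; apply: smooth_ecoef.
Qed.

Let S0 : scal a b b i0 = a. Proof. by []. Qed.
Let S1 : scal a b b i1 = b. Proof. by have [_ -> _] := scalE a b. Qed.
Let S2 : scal a b b i2 = b. Proof. by have [_ _ ->] := scalE a b. Qed.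

Lemma suX_lin i (p q : C) k s J J' x :
  suX i (fun y => p * ecoef k s J y + q * ecoef k s J' y) x =
  p * suX i (ecoef k s J) x + q * suX i (ecoef k s J') x.
Proof.
have s1 := smooth_ecoef k s J; have s2 := smooth_ecoef k s J'.
by rewrite suXD ?suXZ //; apply: smoothZ.
Qed.

Let castD := (rmorphD (real_complex R)).
Let castB := (rmorphB (real_complex R)).
Let castM := (rmorphM (real_complex R)).
Let castN := (rmorphN (real_complex R)).
Let castnat := (rmorph_nat (real_complex R)).
Let cast1 := (rmorph1 (real_complex R)).

Section Block.
Variables (k J : nat).
Let kk : R := k%:R.
Let j : R := J%:R - 1.
Let m : R := kk - 2 * j.

(** The rows of the 3 by 3 matrix of the curl on a block, followed by the divergence. The factors -i
    in [bform] make all of them real. *)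
Definition blockN0 (al be ga : R) : R := b * (j * be + (kk - j) * ga) - 2 * (b ^+ 2 / a) * al.
Definition blockN1 (al be : R) : R := 2 * b * (kk - j + 1) * al + a * m * be.
Definition blockN2 (al ga : R) : R := 2 * b * (j + 1) * al - a * m * ga.
Definition block_div (al be ga : R) : R := - (a * m * al) + b * (j * be - (kk - j) * ga).

Lemma ccurl_bform s al be ga i x : (s <= k)%N ->
  ccurl (bform k s J al be ga) i x =
  bform k s J (blockN0 al be ga) (blockN1 al be) (blockN2 al ga) i x.
Proof.
move=> sk; set w := bform k s J al be ga.
have [C0 C1 C2] := ccurlE a b w x.
have [E0 E1 E2] := bformE k s J al be ga.
have [F0 F1 F2] := bformE k s J (blockN0 al be ga) (blockN1 al be) (blockN2 al ga).
have se n : smooth (ecoef k s n) by apply: smooth_ecoef.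
have K := castnat k; have JJ := castnat J.
have n2 : (2 : C) != 0 by rewrite pnatr_eq0.
have I := iC_sq R.
have cD := (castnat, cast1, castD, castB, castM, castN, fmorphV (real_complex R)).
have PS : ecoefp k s J.+2 x = ecoef k s J.+1 x by [].
have PS1 : ecoefp k s J.+1 x = ecoef k s J x by [].
case: (ord3P i) => ->.
- rewrite C0 F0 /w E0 E1 E2 /Yop ?S1 ?S2 !suX_lin !suX1_ecoef // !suX2_ecoef //.
  rewrite PS /blockN0 /j /kk !cD /= -[J.+2%:R]natr1 -[J.+1%:R]natr1.
  move: (ecoefp k s J x) (ecoef k s J.+1 x) (ecoef k s J.+3 x) => e1 e2 e3.
  move: (k%:R : C) (J%:R : C) al%:C be%:C ga%:C (b ^+ 2)%:C a%:C^-1 b%:C => K' J' al' be' ga' b2 a' b'.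
  by move: (iC R) I => ii I; field: I.
- rewrite C1 F1 /w E0 E1 E2 /Yop ?S0 ?S1 ?S2 !suXZ ?suX_lin // !suX0_ecoef // !suX2_ecoef //.
  rewrite PS1 /blockN1 /blockN2 /m /j /kk !cD /= -[J.+2%:R]natr1 -[J.+1%:R]natr1.
  move: (ecoef k s J x) (ecoef k s J.+2 x) => e1 e2.
  move: (k%:R : C) (J%:R : C) al%:C be%:C ga%:C a%:C b%:C => K' J' al' be' ga' a' b'.
  by move: (iC R) I => ii I; field: I.
- rewrite C2 F2 /w E0 E1 E2 /Yop ?S0 ?S1 ?S2 !suXZ ?suX_lin // !suX0_ecoef // !suX1_ecoef //.
  rewrite PS1 /blockN1 /blockN2 /m /j /kk !cD /= -[J.+2%:R]natr1 -[J.+1%:R]natr1.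
  move: (ecoef k s J x) (ecoef k s J.+2 x) => e1 e2.
  move: (k%:R : C) (J%:R : C) al%:C be%:C ga%:C a%:C b%:C => K' J' al' be' ga' a' b'.
  by move: (iC R) I => ii I; field: I.
Qed.

Lemma cdiv_bform s al be ga x : (s <= k)%N ->
  cdiv (bform k s J al be ga) x =
  iC R * (block_div al be ga)%:C * ecoef k s J.+1 x.
Proof.
move=> sk; have [E0 E1 E2] := bformE k s J al be ga.
have se n : smooth (ecoef k s n) by apply: smooth_ecoef.
have cD := (castnat, cast1, castD, castB, castM, castN, fmorphV (real_complex R)).
have PS : ecoefp k s J.+2 x = ecoef k s J.+1 x by [].
rewrite /cdiv E0 E1 E2 /Yop ?S0 ?S1 ?S2 !suXZ ?suX_lin // !suX0_ecoef // !suX1_ecoef //.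
rewrite !suX2_ecoef // PS /block_div /m /j /kk !cD /= -[J.+2%:R]natr1 -[J.+1%:R]natr1.
move: (ecoefp k s J x) (ecoef k s J.+1 x) (ecoef k s J.+3 x) => e1 e2 e3.
move: (k%:R : C) (J%:R : C) al%:C be%:C ga%:C a%:C b%:C => K' J' al' be' ga' a' b'.
by field.
Qed.

(** The gradient of the middle function of a block lies in the block; up to -i its vector is the
    exact direction. *)
Lemma grad_ecoef s i x : (s <= k)%N -> Yop i (ecoef k s J.+1) x =
  - iC R * bform k s J (a * m) (- (2 * b * (kk - j + 1))) (2 * b * (j + 1)) i x.
Proof.
move=> sk.
have [E0 E1 E2] := bformE k s J (a * m) (- (2 * b * (kk - j + 1))) (2 * b * (j + 1)).
have cD := (castnat, cast1, castD, castB, castM, castN, fmorphV (real_complex R)).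
have PS1 : ecoefp k s J.+1 x = ecoef k s J x by [].
have I := iC_sq R.
case: (ord3P i) => ->; rewrite ?E0 ?E1 ?E2 /Yop ?S0 ?S1 ?S2.
- rewrite suX0_ecoef // /m /j /kk !cD /= -[J.+1%:R]natr1.
  move: (ecoef k s J.+1 x) => e1.
  move: (k%:R : C) (J%:R : C) a%:C b%:C => K' J' a' b'; by ring.
- rewrite suX1_ecoef // PS1 /m /j /kk !cD /= -[J.+1%:R]natr1.
  move: (ecoef k s J x) (ecoef k s J.+2 x) => e1 e2.
  move: (k%:R : C) (J%:R : C) a%:C b%:C => K' J' a' b'.
  transitivity (- (iC R * iC R) * b' * ((K' - J' + 1 + 1) * e1 - J' * e2)).
    by rewrite I; ring.
  by field.
- rewrite suX2_ecoef // PS1 /m /j /kk !cD /= -[J.+1%:R]natr1.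
  move: (ecoef k s J x) (ecoef k s J.+2 x) => e1 e2.
  move: (k%:R : C) (J%:R : C) a%:C b%:C => K' J' a' b'; by field.
Qed.

(** The Laplacian is curl curl minus grad div, computed on coordinates. The alternatives serve the
    truncated blocks: a coordinate whose function vanishes imposes no equation. *)
Lemma Delta1_bform s al be ga i x (mu : R) : (s <= k)%N ->
  let al1 := blockN0 al be ga in let be1 := blockN1 al be in
  let ga1 := blockN2 al ga in let de := block_div al be ga in
  (ecoef k s J.+1 x = 0 \/ blockN0 al1 be1 ga1 - de * (a * m) = mu * al) ->
  (ecoef k s J x = 0 \/ blockN1 al1 be1 + de * (2 * b * (kk - j + 1)) = mu * be) ->
  (ecoef k s J.+2 x = 0 \/ blockN2 al1 ga1 - de * (2 * b * (j + 1)) = mu * ga) ->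
  Delta1 (G := G) (bform k s J al be ga) i x = mu%:C * bform k s J al be ga i x.
Proof.
move=> sk al1 be1 ga1 de H0 H1 H2.
rewrite Delta1E; last by move=> l; apply: smooth_bform.
have -> : ccurl (bform k s J al be ga) = bform k s J al1 be1 ga1.
  by apply/funext => l; apply/funext => y; apply: ccurl_bform.
rewrite ccurl_bform //.
have -> : cdiv (bform k s J al be ga) = (fun y => iC R * de%:C * ecoef k s J.+1 y).
  by apply/funext => y; apply: cdiv_bform.
have -> : Yop i (fun y => iC R * de%:C * ecoef k s J.+1 y) x =
   iC R * de%:C * Yop i (ecoef k s J.+1) x.
  by rewrite /Yop suXZ; [rewrite mulrCA|apply: smooth_ecoef].
rewrite grad_ecoef //.
have [E0 E1 E2] := bformE k s J al be ga.
have [F0 F1 F2] := bformE k s J (blockN0 al1 be1 ga1) (blockN1 al1 be1) (blockN2 al1 ga1).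
have [G0 G1 G2] := bformE k s J (a * m) (- (2 * b * (kk - j + 1))) (2 * b * (j + 1)).
have -> (z : C) : - (iC R * de%:C * (- iC R * z)) = - de%:C * z.
  by transitivity ((iC R * iC R) * de%:C * z); [ring|rewrite iC_sq; ring].
have cX (p q r : R) : (p + q * r)%:C = p%:C + q%:C * r%:C by rewrite castD castM.
have cXM (p q : R) : (p * q)%:C = p%:C * q%:C by rewrite castM.
have cXN (p : R) : (- p)%:C = - p%:C by rewrite castN.
have K0 : (blockN0 al1 be1 ga1)%:C * ecoef k s J.+1 x =
   (mu%:C * al%:C + de%:C * (a * m)%:C) * ecoef k s J.+1 x.
  case: H0 => [->|H0]; first by rewrite !mulr0.
  by rewrite -cXM -cX -H0; congr (_%:C * _); ring.
have K1 : (blockN1 al1 be1)%:C * ecoef k s J x =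
   (mu%:C * be%:C + de%:C * (- (2 * b * (kk - j + 1)))%:C) * ecoef k s J x.
  case: H1 => [->|H1]; first by rewrite !mulr0.
  by rewrite -cXM -cX -H1; congr (_%:C * _); ring.
have K2 : (blockN2 al1 ga1)%:C * ecoef k s J.+2 x =
   (mu%:C * ga%:C + de%:C * (2 * b * (j + 1))%:C) * ecoef k s J.+2 x.
  case: H2 => [->|H2]; first by rewrite !mulr0.
  by rewrite -cXM -cX -H2; congr (_%:C * _); ring.
case: (ord3P i) => ->.
- rewrite F0 E0 G0 K0.
  move: (ecoef k s J.+1 x) (a * m)%:C => e1 am; ring.
- rewrite F1 E1 G1 -[_ * (blockN1 _ _)%:C * _]mulrA K1 -[_ * (blockN2 _ _)%:C * _]mulrA K2.
  move: (- (2 * b * (kk - j + 1)))%:C (2 * b * (j + 1))%:C => p q.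
  move: (ecoef k s J x) (ecoef k s J.+2 x) => e1 e2; ring.
- rewrite F2 E2 G2 -[_ * (blockN1 _ _)%:C * _]mulrA K1 -[_ * (blockN2 _ _)%:C * _]mulrA K2.
  move: (- (2 * b * (kk - j + 1)))%:C (2 * b * (j + 1))%:C => p q.
  move: (ecoef k s J x) (ecoef k s J.+2 x) => e1 e2; ring.
Qed.

End Block.
End Eigenforms.

(** * Eigenvalues and eigenforms *)

Section Values.
Variables (R : realType) (a b : R).
Hypotheses (a0 : 0 < a) (b0 : 0 < b).
Local Notation C := R[i].

Definition sq_disc (k j : nat) : R := Num.sqrt (a ^+ 2 * nu a b k j + b ^+ 4).

(* The eigenvalues of the curl operator * d on coexact forms are
   tau = tau_plus, tau_minus; their squares are mu_plus and mu_minus. *)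
Definition tau_plus (k j : nat) : R := - ((sq_disc k j + b ^+ 2) / a).
Definition tau_minus (k j : nat) : R := (sq_disc k j - b ^+ 2) / a.

(** The difference is a^2 (k - 2 j)^2 + 4 b^2 j (k - j). The bound gives positivity and the growth
    of the spectrum. *)
Lemma nu_lower k j : (j <= k)%N -> 2 * k%:R * b ^+ 2 <= nu a b k j.
Proof.
move=> jk; rewrite /nu.
have j0 : 0 <= j%:R :> R by [].
have kj : 0 <= k%:R - j%:R :> R by rewrite subr_ge0 ler_nat.
have h1 : 0 <= b ^+ 2 * (4 * (j%:R * (k%:R - j%:R))).
  by apply: mulr_ge0; [exact: sqr_ge0|apply: mulr_ge0 => //; apply: mulr_ge0].
have h2 : 0 <= a ^+ 2 * (k%:R - 2 * j%:R) ^+ 2 by apply: mulr_ge0; exact: sqr_ge0.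
lra.
Qed.

Lemma nu_ge0 k j : (j <= k)%N -> 0 <= nu a b k j.
Proof.
move=> jk; apply: le_trans (nu_lower jk).
by apply: mulr_ge0; [apply: mulr_ge0|exact: sqr_ge0].
Qed.

Lemma sq_disc2 k j : (j <= k)%N -> sq_disc k j ^+ 2 = a ^+ 2 * nu a b k j + b ^+ 4.
Proof.
move=> jk; have h1 := mulr_ge0 (sqr_ge0 a) (nu_ge0 jk).
have h2 : 0 <= b ^+ 4 by apply: exprn_ge0; apply: ltW.
by rewrite sqr_sqrtr // addr_ge0.
Qed.

Lemma tau_plus_eq k j : (j <= k)%N ->
  tau_plus k j ^+ 2 + 2 * (b ^+ 2 / a) * tau_plus k j = nu a b k j.
Proof.
move=> jk; have S := sq_disc2 jk; have an : a != 0 by rewrite gt_eqF.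
apply: (mulfI (expf_neq0 2 an)); rewrite -[RHS](addrK (b ^+ 4)) -S /tau_plus.
by field.
Qed.

Lemma tau_minus_eq k j : (j <= k)%N ->
  tau_minus k j ^+ 2 + 2 * (b ^+ 2 / a) * tau_minus k j = nu a b k j.
Proof.
move=> jk; have S := sq_disc2 jk; have an : a != 0 by rewrite gt_eqF.
apply: (mulfI (expf_neq0 2 an)); rewrite -[RHS](addrK (b ^+ 4)) -S /tau_minus.
by field.
Qed.

(** By the quadratic equation tau^2 = nu - 2 (b^2 / a) tau; the negative root therefore gives the
    larger eigenvalue [mu_plus]. *)
Lemma mu_plusE k j : (j <= k)%N -> mu_plus a b k j = tau_plus k j ^+ 2.
Proof.
move=> jk; have an : a != 0 by rewrite gt_eqF.
rewrite /mu_plus -/(sq_disc k j) -(tau_plus_eq jk) /tau_plus; by field.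
Qed.

Lemma mu_minusE k j : (j <= k)%N -> mu_minus a b k j = tau_minus k j ^+ 2.
Proof.
move=> jk; have an : a != 0 by rewrite gt_eqF.
rewrite /mu_minus -/(sq_disc k j) -(tau_minus_eq jk) /tau_minus; by field.
Qed.

Lemma tau_plus_lt0 k j : tau_plus k j < 0.
Proof. by rewrite oppr_lt0 divr_gt0 // ltr_wpDl ?sqrtr_ge0 // exprn_gt0. Qed.

(** Strictness comes from nu > 0, that is from k > 0. It makes the curl invertible on the coexact
    forms of the second kind. *)
Lemma tau_minus_gt0 k j : (0 < k)%N -> (j <= k)%N -> 0 < tau_minus k j.
Proof.
move=> k0 jk; rewrite divr_gt0 // subr_gt0.
rewrite -(ltr_pXn2r (n := 2)) ?nnegrE ?sqrtr_ge0 ?sqr_ge0 // sq_disc2 // -exprM.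
rewrite ltrDr mulr_gt0 ?exprn_gt0 //; apply: lt_le_trans (nu_lower jk).
by rewrite !mulr_gt0 ?ltr0n ?exprn_gt0.
Qed.

(** At both ends the radicand is the square of a^2 k + b^2. The other root is then tau = a k, for
    which [coexact_vec] is supported on the coordinate whose function is 0; this is why kind 2 omits
    the ends. *)
Lemma mu_plus_end k : (mu_plus a b k 0 = mu_end a b k) * (mu_plus a b k k = mu_end a b k).
Proof.
have an : a != 0 by rewrite gt_eqF.
have H j : nu a b k j = a ^+ 2 * k%:R ^+ 2 + 2 * b ^+ 2 * k%:R ->
    mu_plus a b k j = mu_end a b k.
  move=> E; rewrite /mu_plus (_ : a ^+ 2 * nu a b k j + b ^+ 4 = (a ^+ 2 * k%:R + b ^+ 2) ^+ 2).
    rewrite sqrtr_sqr ger0_norm ?E /mu_end; first by field.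
    apply: addr_ge0; last exact: sqr_ge0.
    by apply: mulr_ge0 => //; exact: sqr_ge0.
  by rewrite E; ring.
by split; apply: H; rewrite /nu; ring.
Qed.

(* The eigenforms are indexed by a weight k, a kind (0 : exact; 1, 2 : coexact
   with eigenvalues mu_plus, mu_minus; 3 : coexact with eigenvalue mu_out), an
   index J, which is j + 1 in the notation of the theorem, and s <= k. *)
Definition eig_valid (k kd J : nat) : bool :=
  match kd with
  | 0 => [&& 0 < k, 0 < J & J <= k.+1]%N
  | 1 => (0 < J <= k.+1)%N
  | 2 => (1 < J <= k)%N
  | 3 => (J == 0) || (J == k.+2)
  | _ => false
  end.

Definition eig_mu (k kd J : nat) : R :=
  match kd with
  | 0 => nu a b k J.-1
  | 1 => mu_plus a b k J.-1
  | 2 => mu_minus a b k J.-1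
  | _ => mu_out a k
  end.

(** The last two rows of the eigenvector equation give be and ga as multiples of al, with
    denominators tau - a m and tau + a m; here they are cleared by taking al = tau^2 - (a m)^2. *)
Definition coexact_vec (k J : nat) (tau : R) : R * R * R :=
  let j := J%:R - 1 in let m := k%:R - 2 * j in
  (tau ^+ 2 - (a * m) ^+ 2, 2 * b * (k%:R - j + 1) * (tau + a * m),
   2 * b * (j + 1) * (tau - a * m)).

Definition eig_vec (k kd J : nat) : R * R * R :=
  let j := J%:R - 1 in let m := k%:R - 2 * j in
  match kd with
  | 0 => (a * m, - (2 * b * (k%:R - j + 1)), 2 * b * (j + 1))
  | 1 => coexact_vec k J (tau_plus k J.-1)
  | 2 => coexact_vec k J (tau_minus k J.-1)
  | _ => if J == 0 then (0, 0, 1) else (0, 1, 0)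
  end.

(** The last two rows hold identically. The first row and the vanishing of the divergence both
    reduce to the quadratic equation for [tau]. *)
Lemma coexact_vec_eigen k J tau :
  tau ^+ 2 + 2 * (b ^+ 2 / a) * tau = nu a b k J -> let v := coexact_vec k J.+1 tau in
  [/\ blockN0 a b k J.+1 v.1.1 v.1.2 v.2 = tau * v.1.1,
      blockN1 a b k J.+1 v.1.1 v.1.2 = tau * v.1.2,
      blockN2 a b k J.+1 v.1.1 v.2 = tau * v.2 &
      block_div a b k J.+1 v.1.1 v.1.2 v.2 = 0].
Proof.
move=> H; have an : a != 0 by rewrite gt_eqF.
have N : a ^+ 2 * (k%:R - 2 * J%:R) ^+ 2 + b ^+ 2 * ((4 * J%:R + 2) * k%:R - 4 * J%:R ^+ 2)
   = tau ^+ 2 + 2 * (b ^+ 2 / a) * tau by rewrite H.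
rewrite /coexact_vec /blockN0 /blockN1 /blockN2 /block_div /= -[J.+1%:R]natr1.
move: (k%:R : R) (J%:R : R) N => K j N; rewrite (_ : j + 1 - 1 = j); last by ring.
split; [| by ring | by ring | ].
- transitivity (tau * ((a ^+ 2 * (K - 2 * j) ^+ 2 + b ^+ 2 * ((4 * j + 2) * K - 4 * j ^+ 2))
    - (a * (K - 2 * j)) ^+ 2 - 2 * (b ^+ 2 / a) * tau)); first by field.
  by rewrite N; field.
- transitivity (a * (K - 2 * j) * ((a ^+ 2 * (K - 2 * j) ^+ 2 + b ^+ 2 * ((4 * j + 2) * K - 4 * j ^+ 2))
    - tau ^+ 2 - 2 * (b ^+ 2 / a) * tau)); first by field.
  by rewrite N; field.
Qed.

Definition eig_form (k kd J s : nat) : 'I_3 -> 'M[C]_2 -> C :=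
  let v := eig_vec k kd J in bform k s J v.1.1 v.1.2 v.2.

Lemma eig_formP k kd J s i x : eig_valid k kd J -> (s <= k)%N ->
  Delta1 (G := gSU2 a0 b0 b0) (eig_form k kd J s) i x =
  (eig_mu k kd J)%:C * eig_form k kd J s i x.
Proof.
have an : a != 0 by rewrite gt_eqF.
have coexact j tau mu : tau ^+ 2 + 2 * (b ^+ 2 / a) * tau = nu a b k j -> mu = tau ^+ 2 ->
    let v := coexact_vec k j.+1 tau in (s <= k)%N ->
    Delta1 (G := gSU2 a0 b0 b0) (bform k s j.+1 v.1.1 v.1.2 v.2) i x =
    mu%:C * bform k s j.+1 v.1.1 v.1.2 v.2 i x.
  move=> T -> v sk; have [N0 N1 N2 D] := coexact_vec_eigen T.
  have {}N0 : blockN0 a b k j.+1 v.1.1 v.1.2 v.2 = tau * v.1.1 by [].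
  have {}N1 : blockN1 a b k j.+1 v.1.1 v.1.2 = tau * v.1.2 by [].
  have {}N2 : blockN2 a b k j.+1 v.1.1 v.2 = tau * v.2 by [].
  have {}D : block_div a b k j.+1 v.1.1 v.1.2 v.2 = 0 by [].
  have L0 : blockN0 a b k j.+1 (tau * v.1.1) (tau * v.1.2) (tau * v.2) = tau ^+ 2 * v.1.1.
    by rewrite expr2 -mulrA -[in RHS]N0 /blockN0; ring.
  have L1 : blockN1 a b k j.+1 (tau * v.1.1) (tau * v.1.2) = tau ^+ 2 * v.1.2.
    by rewrite expr2 -mulrA -[in RHS]N1 /blockN1; ring.
  have L2 : blockN2 a b k j.+1 (tau * v.1.1) (tau * v.2) = tau ^+ 2 * v.2.
    by rewrite expr2 -mulrA -[in RHS]N2 /blockN2; ring.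
  apply: Delta1_bform => //; right; rewrite N0 ?N1 ?N2 D mul0r ?subr0 ?addr0 //.
case: kd => [|[|[|[|kd]]]] //= V sk.
- case/and3P: V => k0 J0 Jk; case: J J0 Jk => // J _ Jk.
  rewrite /eig_form /=; apply: Delta1_bform => //; right;
    rewrite /blockN0 /blockN1 /blockN2 /block_div /nu -[J.+1%:R]natr1 /=; by field.
- case: J V => // J /= Jk; apply: coexact => //; last exact: mu_plusE.
  exact: tau_plus_eq.
- case: J V => // J /andP[_ Jk]; have Jk' : (J <= k)%N by apply: ltnW.
  by apply: coexact => //; [exact: tau_minus_eq|exact: mu_minusE].
(* In the outermost blocks two of the three functions vanish: [ecoef k s 2] remains for J = 0 and
   [ecoef k s k.+2] for J = k + 2. *)
- case/orP: V => /eqP ->; rewrite /eig_form /=; apply: Delta1_bform => //;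
    rewrite /mu_out.
  + by left.
  + by left.
  + by right; rewrite /blockN2 /block_div /blockN0 /blockN1; field.
  + by left; rewrite /ecoef mcoef_high.
  + by right; rewrite /blockN2 /block_div /blockN0 /blockN1 -[k.+2%:R]natr1 -[k.+1%:R]natr1; field.
  + by left; rewrite /ecoef mcoef_high.
Qed.

Lemma smooth_eig_form k kd J s i : smooth (eig_form k kd J s i).
Proof. exact: smooth_bform. Qed.

End Values.

(** * Linear algebra of one block *)

Section Algebra.
Variable F : fieldType.
Hypothesis two : (2 : F) != 0.
Implicit Types (A T S p q c x y z : F).

(** Independence of the exact vector and the two coexact ones. After division by p and q, the sum of
    the last two equations is c1 T + c2 S = 0, their difference gives c0, and the first becomes c1
    T^2 + c2 S^2 = 0: a Vandermonde system for distinct nonzero roots. *)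
Lemma coexact_free3 A T S p q c0 c1 c2 : T != 0 -> S != 0 -> S != T -> p != 0 -> q != 0 ->
  c0 * A + c1 * (T ^+ 2 - A ^+ 2) + c2 * (S ^+ 2 - A ^+ 2) = 0 ->
  c0 * - p + c1 * (p * (T + A)) + c2 * (p * (S + A)) = 0 ->
  c0 * q + c1 * (q * (T - A)) + c2 * (q * (S - A)) = 0 ->
  [/\ c0 = 0, c1 = 0 & c2 = 0].
Proof.
move=> Tn Sn ST pn qn E0 E1 E2.
have {}E1 : - c0 + c1 * (T + A) + c2 * (S + A) = 0.
  by apply: (mulfI pn); rewrite mulr0 -E1; ring.
have {}E2 : c0 + c1 * (T - A) + c2 * (S - A) = 0.
  by apply: (mulfI qn); rewrite mulr0 -E2; ring.
have Es : c1 * T + c2 * S = 0.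
  transitivity ((- c0 + c1 * (T + A) + c2 * (S + A) + (c0 + c1 * (T - A) + c2 * (S - A))) / 2).
    by field.
  by rewrite E1 E2; ring.
have Ed : c0 = A * (c1 + c2).
  transitivity (A * (c1 + c2) + ((c0 + c1 * (T - A) + c2 * (S - A)) -
    (- c0 + c1 * (T + A) + c2 * (S + A))) / 2); first by field.
  by rewrite E1 E2; ring.
have Eq : c1 * T ^+ 2 + c2 * S ^+ 2 = 0 by rewrite -E0 Ed; ring.
have c2E : c2 = 0.
  apply: (mulIf (mulf_neq0 Sn (_ : S - T != 0))); first by rewrite subr_eq0.
  transitivity (c1 * T ^+ 2 + c2 * S ^+ 2 - T * (c1 * T + c2 * S)); first by ring.
  by rewrite Eq Es; ring.
have c1E : c1 = 0 by apply: (mulIf Tn); rewrite mul0r -[RHS]Es c2E; ring.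
by split=> //; rewrite Ed c1E c2E addr0 mulr0.
Qed.

(** The end blocks: one coordinate and one root are missing. *)
Lemma coexact_free2 A T q c0 c1 : T != 0 -> T - A != 0 -> q != 0 ->
  c0 * A + c1 * (T ^+ 2 - A ^+ 2) = 0 -> c0 * q + c1 * (q * (T - A)) = 0 ->
  c0 = 0 /\ c1 = 0.
Proof.
move=> Tn TA qn E0 E1.
have Ed : c0 = - c1 * (T - A).
  apply: (mulfI qn); transitivity (c0 * q + c1 * (q * (T - A)) - c1 * (q * (T - A))).
    by ring.
  by rewrite E1; ring.
have c1E : c1 = 0.
  by apply: (mulIf (mulf_neq0 Tn TA)); rewrite mul0r -E0 Ed; ring.
by rewrite Ed c1E oppr0 mul0r.
Qed.

(** The dual statement: a vector annihilated by all three eigenvectors is 0. Adding A times the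
    exact equation to a coexact one makes the latter divisible by its root. *)
Lemma coexact_sep3 A T S p q x y z : S != T -> p != 0 -> q != 0 ->
  A * x + - p * y + q * z = 0 ->
  (T ^+ 2 - A ^+ 2) * x + p * (T + A) * y + q * (T - A) * z = 0 ->
  (S ^+ 2 - A ^+ 2) * x + p * (S + A) * y + q * (S - A) * z = 0 ->
  T != 0 -> S != 0 -> [/\ x = 0, y = 0 & z = 0].
Proof.
move=> ST pn qn E0 E1 E2 Tn Sn.
have E1' : T * x + (p * y + q * z) = 0.
  apply: (mulfI Tn); transitivity ((T ^+ 2 - A ^+ 2) * x + p * (T + A) * y + q * (T - A) * z
    + A * (A * x + - p * y + q * z)); first by ring.
  by rewrite E0 E1; ring.
have E2' : S * x + (p * y + q * z) = 0.
  apply: (mulfI Sn); transitivity ((S ^+ 2 - A ^+ 2) * x + p * (S + A) * y + q * (S - A) * z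
    + A * (A * x + - p * y + q * z)); first by ring.
  by rewrite E0 E2; ring.
have x0 : x = 0.
  have D : S - T != 0 by rewrite subr_eq0.
  apply: (mulfI D); transitivity (S * x + (p * y + q * z) - (T * x + (p * y + q * z))).
    by ring.
  by rewrite E1' E2'; ring.
move: E1' E0; rewrite x0 !mulr0 !add0r => E1' E0.
split=> //.
  apply: (mulfI (mulf_neq0 two pn)).
  by transitivity (p * y + q * z - (- p * y + q * z)); [ring|rewrite E1' E0; ring].
apply: (mulfI (mulf_neq0 two qn)).
by transitivity (p * y + q * z + (- p * y + q * z)); [ring|rewrite E1' E0; ring].
Qed.

Lemma coexact_sep2 A T q x z : q != 0 -> A * x + q * z = 0 ->
  (T ^+ 2 - A ^+ 2) * x + q * (T - A) * z = 0 -> T != 0 -> T - A != 0 ->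
  x = 0 /\ z = 0.
Proof.
move=> qn E0 E1 Tn TA.
have x0 : x = 0.
  apply: (mulfI (mulf_neq0 Tn TA)).
  transitivity ((T ^+ 2 - A ^+ 2) * x + q * (T - A) * z - (T - A) * (A * x + q * z)).
    by ring.
  by rewrite E0 E1; ring.
by split=> //; apply: (mulfI qn); rewrite mulr0 -E0 x0 mulr0 add0r.
Qed.

End Algebra.

(** * Growth and counting of the eigenvalues *)

Section Spectrum.
Variables (R : realType) (a b : R).
Hypotheses (a0 : 0 < a) (b0 : 0 < b).
Local Notation C := R[i].

Lemma eig_bound (lambda : C) : exists N : nat, forall k kd J, (N <= k)%N ->
  eig_valid k kd J -> (eig_mu a b k kd J)%:C != lambda.
Proof.
pose L := `|complex.Re lambda|.
(* For an eigenvalue L of kind 0, 1 or 2 one has nu <= L + 2 (b^2 / a) (L + 1), because tau <= tau^2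
   + 1, and [nu_lower] bounds k. For kind 3, k <= (k + 2)^2 bounds k by L / a^2. *)
pose M1 := (L + 2 * (b ^+ 2 / a) * (L + 1)) / (2 * b ^+ 2).
have L0 : 0 <= L by exact: normr_ge0.
have b2 : 0 < 2 * b ^+ 2 by rewrite mulr_gt0 // exprn_gt0.
have ba : 0 < b ^+ 2 / a by rewrite divr_gt0 // exprn_gt0.
have a2 : 0 < a ^+ 2 by rewrite exprn_gt0.
have M10 : 0 <= M1.
  by apply: divr_ge0; [apply: addr_ge0 => //; apply: mulr_ge0; [apply: mulr_ge0 => //|]; lra|exact: ltW].
have M20 : 0 <= L / a ^+ 2 by apply: divr_ge0 => //; exact: ltW.
have K k kd J : eig_valid k kd J -> (eig_mu a b k kd J)%:C = lambda ->
    k%:R <= M1 + L / a ^+ 2.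
  move=> V E; have {}E : eig_mu a b k kd J = complex.Re lambda by rewrite -E.
  have low j : (j <= k)%N -> nu a b k j <= L + 2 * (b ^+ 2 / a) * (L + 1) ->
      k%:R <= M1 + L / a ^+ 2.
    move=> jk H; suff : k%:R <= M1 by lra.
    rewrite ler_pdivlMr //; apply: le_trans H; apply: le_trans (nu_lower a b jk).
    by rewrite mulrCA mulrA.
  have EL : eig_mu a b k kd J = L.
    apply/esym; rewrite /L -E ger0_norm //.
    move: V; case: (kd) => [|[|[|[|n]]]] //= V.
    - by case/and3P: V => _ J0 Jk; apply: nu_ge0; rewrite -ltnS prednK.
    - case/andP: V => J0 Jk; rewrite mu_plusE //; first exact: sqr_ge0.
      by rewrite -ltnS prednK.
    - case/andP: V => J0 Jk; rewrite mu_minusE //; first exact: sqr_ge0.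
      by apply: leq_trans Jk; apply: leq_pred.
    - by apply: mulr_ge0; exact: sqr_ge0.
  have LL : 0 <= 2 * (b ^+ 2 / a) * (L + 1) by apply: mulr_ge0; [apply: mulr_ge0 => //|]; lra.
  case: kd V EL {E} => [|[|[|[|n]]]] //= V EL.
  - case/and3P: V => _ J0 Jk; have jk : (J.-1 <= k)%N by rewrite -ltnS prednK.
    by apply: (low _ jk); rewrite EL; lra.
  - case/andP: V => J0 Jk; have jk : (J.-1 <= k)%N by rewrite -ltnS prednK.
    apply: (low _ jk); rewrite -(tau_plus_eq a0 b0 jk) -(mu_plusE a0 b0 jk) EL.
    have : 2 * (b ^+ 2 / a) * tau_plus a b k J.-1 <= 0; last by lra.
    by apply: mulr_ge0_le0; [apply: mulr_ge0 => //; exact: ltW|apply: ltW; exact: tau_plus_lt0].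
  - case/andP: V => J0 Jk; have jk : (J.-1 <= k)%N by apply: leq_trans Jk; apply: leq_pred.
    apply: (low _ jk); rewrite -(tau_minus_eq a0 b0 jk) -(mu_minusE a0 b0 jk) EL lerD2l.
    rewrite ler_pM2l; last by rewrite mulr_gt0.
    rewrite -EL (mu_minusE a0 b0 jk); move: (tau_minus _ _ _ _) => t.
    have := sqr_ge0 (t - 1); have := sqr_ge0 t; rewrite !expr2; nra.
  - suff : k%:R <= L / a ^+ 2 by lra.
    rewrite ler_pdivlMr // -EL /mu_out; apply: ler_wpM2r; first exact: ltW.
    have : 0 <= k%:R :> R by []. by move: (k%:R : R) => t t0; rewrite expr2; nra.
exists (Num.bound (M1 + L / a ^+ 2)) => k kd J Nk V; apply/eqP => E.
have := archi_boundP (addr_ge0 M10 M20); rewrite ltNge => /negP; apply.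
by apply: le_trans (K _ _ _ V E); rewrite ler_nat.
Qed.

(** The eigenvalue does not depend on [s], whose k + 1 values account for the repetitions in
    [spec1]; the rest is a matching of the four kinds with the parts of that list. *)
Lemma eig_count (lambda : C) k :
  count_mem lambda [seq r%:C | r <- spec1 a b k] =
  (\sum_(0 <= J < k.+3) \sum_(0 <= s < k.+1) \sum_(0 <= kd < 4)
     (eig_valid k kd J && ((eig_mu a b k kd J)%:C == lambda)))%N.
Proof.
pose P r := (r%:C == lambda : nat).
pose Q kd J := (eig_valid k kd J && ((eig_mu a b k kd J)%:C == lambda) : nat).
transitivity (k.+1 * (\sum_(0 <= kd < 4) \sum_(0 <= J < k.+3) Q kd J))%N; last first.
  rewrite exchange_big big_distrr /=; apply: eq_bigr => J _.
  by rewrite big_const_nat subn0 iter_addn_0 mulnC.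
have cm (I : Type) (f : I -> R) (s : seq I) : count (fun r => r%:C == lambda) (map f s) =
    (\sum_(i <- s) P (f i))%N.
  by elim: s => [|i s IH] /=; rewrite ?big_nil // big_cons IH.
rewrite count_map (eq_count (a2 := fun r => r%:C == lambda)) //.
have -> : (\sum_(0 <= kd < 4) \sum_(0 <= J < k.+3) Q kd J = 
  \sum_(0 <= J < k.+3) Q 0 J + (\sum_(0 <= J < k.+3) Q 1 J +
  (\sum_(0 <= J < k.+3) Q 2 J + \sum_(0 <= J < k.+3) Q 3 J)))%N.
  by rewrite unlock /= addn0.
have shift (f : nat -> nat) : (\sum_(0 <= J < k.+3) ((0 < J <= k.+1) * f J.-1) =
    \sum_(0 <= j < k.+1) f j)%N.
  rewrite big_nat_recl // big_nat_recr //= ltnn mul0n add0n addn0.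
  by apply: eq_big_nat => j /andP[_ jk]; rewrite jk mul1n.
have out : (\sum_(0 <= J < k.+3) Q 3 J)%N = (P (mu_out a k) + P (mu_out a k))%N.
  have q0 : Q 3 0 = P (mu_out a k) by [].
  have q2 : Q 3 k.+2 = P (mu_out a k) by rewrite /Q /= eqxx.
  have q1 : (\sum_(0 <= J < k.+1) Q 3 J.+1 = 0)%N.
    rewrite big_nat big1 // => J /andP[_ Jk].
    by rewrite /Q /= eqSS ltn_eqF.
  by rewrite big_nat_recl // big_nat_recr // q0 q1 q2.
have plus : (\sum_(0 <= J < k.+3) Q 1 J = \sum_(0 <= j < k.+1) P (mu_plus a b k j))%N.
  by rewrite -shift; apply: eq_bigr => J _; rewrite /Q /= /P mulnb.
rewrite out plus.
(* In weight 0 the functions are constant and there is no exact form: J = 1 of kind 1 gives 4 b^4 /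
   a^2 and the two ends give 4 a^2 twice. *)
case: k @Q shift out plus => [|k] Q shift out plus.
  have Q0 J : Q 0 J = 0 by [].
  have Q2 J : Q 2 J = 0 by rewrite /Q /=; case: J => [|[|J]].
  have S0 : (\sum_(0 <= J < 3) Q 0 J = 0)%N by rewrite big1.
  have S2 : (\sum_(0 <= J < 3) Q 2 J = 0)%N by rewrite big1.
  rewrite mul1n S0 S2 big_nat1 /=.
  have [-> _] := mu_plus_end b a0 0.
  rewrite (_ : mu_end a b 0 = 4 * (b ^+ 4 / a ^+ 2)); last by rewrite /mu_end; ring.
  rewrite (_ : mu_out a 0 = 4 * a ^+ 2); last by rewrite /mu_out; ring.
  rewrite /P.
  by move: ((4 * a ^+ 2)%:C == lambda) ((4 * (b ^+ 4 / a ^+ 2))%:C == lambda) => [] [].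
have -> : (\sum_(0 <= J < k.+1.+3) Q 0 J = \sum_(0 <= j < k.+2) P (nu a b k.+1 j))%N.
  by rewrite -shift; apply: eq_bigr => J _; rewrite /Q /= /P mulnb.
have -> : (\sum_(0 <= J < k.+1.+3) Q 2 J = \sum_(1 <= j < k.+1) P (mu_minus a b k.+1 j))%N.
  have q2 : Q 2 k.+2 = 0%N by rewrite /Q /= ltnn.
  have q3 : Q 2 k.+3 = 0%N by rewrite /Q /= ltnNge leqnSn.
  rewrite big_nat_recl // big_nat_recl // big_nat_recr // big_nat_recr // q2 q3.
  transitivity (\sum_(0 <= J < k) Q 2 J.+2)%N; first by rewrite /= !addn0.
  rewrite big_add1 /=; apply: eq_big_nat => j /andP[_ jk] /=.
  by rewrite /Q /= !ltnS jk.
(* The extreme indices j = 0 and j = k + 1 supply the two copies of [mu_end]. *)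
have -> : (\sum_(0 <= j < k.+2) P (mu_plus a b k.+1 j))%N =
    (P (mu_end a b k.+1) + \sum_(1 <= j < k.+1) P (mu_plus a b k.+1 j) + P (mu_end a b k.+1))%N.
  have [E0 Ek] := mu_plus_end b a0 k.+1.
  by rewrite big_nat_recr //= Ek big_nat_recl //= E0 big_add1.
have -> : spec1 a b k.+1 = flatten [seq nseq k.+2 r | r <-
    [seq nu a b k.+1 j | j <- iota 0 k.+2]
    ++ [:: mu_out a k.+1; mu_end a b k.+1; mu_end a b k.+1; mu_out a k.+1]
    ++ [seq mu_plus a b k.+1 j | j <- iota 1 k]
    ++ [seq mu_minus a b k.+1 j | j <- iota 1 k]] by [].
have cf (s : seq R) : count (fun r => r%:C == lambda) (flatten [seq nseq k.+2 r | r <- s]) =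
    (k.+2 * count (fun r => r%:C == lambda) s)%N.
  elim: s => [|r s IH]; first by rewrite muln0.
  have fl (T : Type) (x : seq T) l : flatten (x :: l) = x ++ flatten l by [].
  by rewrite map_cons fl count_cat IH count_nseq -cat1s count_cat mulnDr mulnC /= addn0.
rewrite cf !count_cat !cm /= -/(index_iota 1 k.+1).
rewrite /index_iota subn0 subSS subn0 /P; congr (_ * _)%N.
rewrite -[(0 :: 1 :: iota 2 k)%N]/(iota 0 k.+2).
move: (\sum_(i <- iota 0 k.+2) _)%N (\sum_(i <- iota 1 k) _)%N (\sum_(i <- iota 1 k) _)%N => x y z.
by move: (nat_of_bool _) (nat_of_bool _) => p q; lia.
Qed.

End Spectrum.

(** * Independence and separation of the eigenvectors in each block *)

Section EigVec.
Variables (R : realType) (a b : R).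
Hypotheses (a0 : 0 < a) (b0 : 0 < b).
Local Notation C := R[i].

Lemma sum4 (V : nmodType) (F : nat -> V) :
  \sum_(0 <= l < 4) F l = F 0%N + F 1%N + F 2%N + F 3%N.
Proof. by rewrite !big_nat_recr //= big_geq // add0r. Qed.

Section Fixed.
Variables (k J : nat).
Let A : C := (a * (k%:R - 2 * (J%:R - 1)))%:C.
Let p : C := (2 * b * (k%:R - (J%:R - 1) + 1))%:C.
Let q : C := (2 * b * (J%:R - 1 + 1))%:C.
Let T : C := (tau_plus a b k J.-1)%:C.
Let S : C := (tau_minus a b k J.-1)%:C.

Lemma eig_vecC0 : let v := eig_vec a b k 0 J in
  [/\ v.1.1%:C = A, v.1.2%:C = - p & v.2%:C = q].
Proof. by split => //=; rewrite /p -rmorphN. Qed.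

Lemma coexact_vecC t : let v := coexact_vec a b k J t in
  [/\ v.1.1%:C = t%:C ^+ 2 - A ^+ 2, v.1.2%:C = p * (t%:C + A) & v.2%:C = q * (t%:C - A)].
Proof.
split.
- by rewrite [LHS]rmorphB /= ![in LHS](rmorphXn (real_complex R)).
- by rewrite [LHS]rmorphM /= -rmorphD.
- by rewrite [LHS]rmorphM /= -rmorphB.
Qed.

Lemma two_neq0 : (2 : C) != 0. Proof. by rewrite pnatr_eq0. Qed.

Lemma p_neq0 : (J <= k.+1)%N -> p != 0.
Proof.
move=> Jk; rewrite fmorph_eq0 gt_eqF // mulr_gt0 ?mulr_gt0 //.
have : J%:R <= k.+1%:R :> R by rewrite ler_nat.
rewrite -[k.+1%:R]natr1; lra.
Qed.

Lemma q_neq0 : (0 < J)%N -> q != 0.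
Proof. by move=> J0; rewrite fmorph_eq0 gt_eqF // subrK !mulr_gt0 // ltr0n. Qed.

Lemma T_neq0 : T != 0.
Proof. by rewrite fmorph_eq0 lt_eqF // tau_plus_lt0. Qed.

Lemma S_neq0 : (1 < J <= k)%N -> S != 0.
Proof.
case/andP=> J1 Jk; rewrite fmorph_eq0 gt_eqF // tau_minus_gt0 //.
  by apply: leq_trans Jk; apply: leq_trans J1.
by apply: leq_trans Jk; apply: leq_pred.
Qed.

Lemma S_neqT : (1 < J <= k)%N -> S != T.
Proof.
case/andP=> J1 Jk; rewrite (inj_eq (fmorph_inj _)) gt_eqF //.
apply: lt_trans (tau_plus_lt0 _ _ _ _) _ => //; apply: tau_minus_gt0 => //.
  by apply: leq_trans Jk; apply: leq_trans J1.
by apply: leq_trans Jk; apply: leq_pred.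
Qed.

(** Here A = a k >= 0 while T < 0. In the last block the sign of A is reversed. *)
Lemma TA_first : J = 1%N -> T - A != 0.
Proof.
move=> J1; rewrite -rmorphB fmorph_eq0 lt_eqF // J1 subrr mulr0 subr0 subr_lt0.
apply: lt_le_trans (tau_plus_lt0 a0 b0 _ _) _; apply: mulr_ge0 => //; exact: ltW.
Qed.

Lemma TA_last : J = k.+1 -> T - - A != 0.
Proof.
move=> Jk; rewrite opprK -rmorphD fmorph_eq0 lt_eqF // Jk -[k.+1%:R]natr1 addrK.
have := tau_plus_lt0 a0 b0 k k; have : 0 <= a * k%:R by apply: mulr_ge0 => //; exact: ltW.
by rewrite /= => h1 h2; lra.
Qed.

(** The blocks by shape. The number of functions that survive, and also of valid kinds, is 1 in the
    first three cases, 2 in the next two and 3 in the last. *)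
Variant J_spec : Prop :=
| J_zero of J = 0%N
| J_top of J = k.+2
| J_unique of k = 0%N & J = 1%N
| J_first of (0 < k)%N & J = 1%N
| J_last of (0 < k)%N & J = k.+1
| J_mid of (1 < J <= k)%N.

Lemma J_cases : (J < k.+3)%N -> J_spec.
Proof.
move=> Jk; case: (posnP J) => [|J0]; first exact: J_zero.
case: (ltngtP J k.+2) => [Jk2||]; [|by rewrite ltnNge -ltnS Jk|exact: J_top].
case: (posnP k) => [k0|k0].
  by apply: J_unique => //; apply/eqP; rewrite eqn_leq J0 -ltnS (leq_trans Jk2) // k0.
case: (ltngtP J 1) => [||]; [by rewrite ltnNge J0| |exact: J_first] => J1.
case: (ltngtP J k.+1) => [||]; [|by rewrite ltnNge -ltnS Jk2|exact: J_last] => Jk1.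
by apply: J_mid; rewrite J1 -ltnS.
Qed.

(** A coordinate equation is available only if the function carrying it, of index J - 1, J - 2 or J
    in terms of [mcoef], lies in the range from 0 to k. In each block the remaining equations still
    determine the coefficients of the valid kinds. *)
Lemma eig_vec_free (c : nat -> C) : (J < k.+3)%N ->
  let vsum (f : R * R * R -> R) :=
    \sum_(0 <= l < 4 | eig_valid k l J) c l * (f (eig_vec a b k l J))%:C in
  ((0 < J <= k.+1)%N -> vsum (fun v => v.1.1) = 0) ->
  ((1 < J <= k.+2)%N -> vsum (fun v => v.1.2) = 0) ->
  ((J <= k)%N -> vsum (fun v => v.2) = 0) ->
  forall l, eig_valid k l J -> c l = 0.
Proof.
move=> Jk vsum; rewrite /vsum !(big_mkcond (fun l => eig_valid k l J)) !sum4.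
have [v00 v01 v02] := eig_vecC0.
have [v10 v11 v12] := coexact_vecC (tau_plus a b k J.-1).
have [v20 v21 v22] := coexact_vecC (tau_minus a b k J.-1).
have -> : eig_vec a b k 1 J = coexact_vec a b k J (tau_plus a b k J.-1) by [].
have -> : eig_vec a b k 2 J = coexact_vec a b k J (tau_minus a b k J.-1) by [].
rewrite {}v00 {}v01 {}v02 {}v10 {}v11 {}v12 {}v20 {}v21 {}v22 -/T -/S.
have fin : (eig_valid k 0 J -> c 0%N = 0) -> (eig_valid k 1 J -> c 1%N = 0) ->
    (eig_valid k 2 J -> c 2%N = 0) -> (eig_valid k 3 J -> c 3%N = 0) ->
    forall l, eig_valid k l J -> c l = 0.
  by move=> ? ? ? ? [|[|[|[|l]]]].
case: (J_cases Jk).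
- move=> J0.
  have V0 : eig_valid k 0 J = false by rewrite /= J0 andbF.
  have V3 : eig_valid k 3 J by rewrite /= J0.
  have V1 : eig_valid k 1 J = false by rewrite /= J0.
  have V2 : eig_valid k 2 J = false by rewrite /= J0.
  rewrite V0 V1 V2 V3 !add0r => _ _ E2; apply: fin; rewrite ?V0 ?V1 ?V2 // => _.
  by move: E2; rewrite /= J0 /= mulr1; apply.
- move=> J0.
  have V0 : eig_valid k 0 J = false by rewrite /= J0 ltnn !andbF.
  have V3 : eig_valid k 3 J by rewrite /= J0 eqxx.
  have V1 : eig_valid k 1 J = false by rewrite /= J0 ltnn.
  have V2 : eig_valid k 2 J = false by rewrite /= J0; lia.
  rewrite V0 V1 V2 V3 !add0r => _ E1 _; apply: fin; rewrite ?V0 ?V1 ?V2 // => _.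
  by move: E1; rewrite /= J0 /= mulr1 !ltnS leqnn; apply.
- move=> k0 J1.
  have V0 : eig_valid k 0 J = false by rewrite /= k0.
  have V3 : eig_valid k 3 J = false by rewrite /= J1 k0.
  have V1 : eig_valid k 1 J by rewrite /= J1.
  have V2 : eig_valid k 2 J = false by rewrite /= J1.
  rewrite V0 V1 V2 V3 !add0r !addr0 => E0 _ _; apply: fin; rewrite ?V0 ?V2 ?V3 // => _.
  have A0 : A = 0 by rewrite /A k0 J1 subrr mulr0 subrr mulr0 rmorph0.
  move: E0; rewrite A0 expr0n subr0 => /(_ V1) /eqP.
  by rewrite mulf_eq0 expf_eq0 /= (negPf T_neq0) orbF => /eqP.
- move=> k0 J1.
  have V0 : eig_valid k 0 J by rewrite /= J1 k0.
  have V3 : eig_valid k 3 J = false by rewrite /= J1.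
  have V1 : eig_valid k 1 J by rewrite /= J1.
  have V2 : eig_valid k 2 J = false by rewrite /= J1.
  rewrite V0 V1 V2 V3 !addr0 => E0 _ E2.
  have qn : q != 0 by apply: q_neq0; rewrite J1.
  have Jk1 : (J <= k)%N by rewrite J1.
  have [c0 c1] := coexact_free2 T_neq0 (TA_first J1) qn (E0 V1) (E2 Jk1).
  by apply: fin; rewrite ?V2 ?V3.
- move=> k0 J1.
  have V0 : eig_valid k 0 J by rewrite /= J1 k0 leqnn.
  have V3 : eig_valid k 3 J = false by rewrite /= J1; lia.
  have V1 : eig_valid k 1 J by rewrite /= J1 leqnn.
  have V2 : eig_valid k 2 J = false by rewrite /= J1 ltnn andbF.
  rewrite V0 V1 V2 V3 !addr0 => E0 E1 _.
  (* Changing the signs of A and of the exact coefficient turns the last block into the first one,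
     with p in place of q. *)
  have {}E0 : - c 0%N * - A + c 1%N * (T ^+ 2 - (- A) ^+ 2) = 0.
    by rewrite mulrNN sqrrN E0 // J1 leqnn.
  have {}E1 : - c 0%N * p + c 1%N * (p * (T - - A)) = 0.
    by rewrite opprK mulNr -mulrN E1 // J1 !ltnS k0 leqnSn.
  have pn : p != 0 by apply: p_neq0; rewrite J1.
  have [/eqP c0 c1] := coexact_free2 T_neq0 (TA_last J1) pn E0 E1.
  by apply: fin; rewrite ?V2 ?V3 // => _; apply/eqP; rewrite -oppr_eq0.
- move=> JJ; have /andP[J1 Jk1] := JJ; have J0 := ltnW J1.
  have V0 : eig_valid k 0 J by rewrite /= J0 (leqW Jk1) (leq_trans J0 Jk1).
  have V3 : eig_valid k 3 J = false by rewrite /=; lia.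
  have V1 : eig_valid k 1 J by rewrite /= J0 leqW.
  have V2 : eig_valid k 2 J by [].
  rewrite V0 V1 V2 V3 !addr0 => E0 E1 E2.
  have [c0 c1 c2] := coexact_free3 two_neq0 T_neq0 (S_neq0 JJ) (S_neqT JJ)
    (p_neq0 (leqW Jk1)) (q_neq0 J0) (E0 V1) (E1 (introT andP (conj J1 (leqW (leqW Jk1))))) (E2 Jk1).
  by apply: fin; rewrite ?V3.
Qed.

Lemma eig_vec_sep (x y z : C) : (J < k.+3)%N ->
  (~~ (0 < J <= k.+1)%N -> x = 0) -> (~~ (1 < J)%N -> y = 0) -> (~~ (J <= k)%N -> z = 0) ->
  (forall l, eig_valid k l J -> let v := eig_vec a b k l J in
     v.1.1%:C * x + v.1.2%:C * y + v.2%:C * z = 0) ->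
  [/\ x = 0, y = 0 & z = 0].
Proof.
move=> Jk x0 y0 z0 H.
have [v00 v01 v02] := eig_vecC0.
have [v10 v11 v12] := coexact_vecC (tau_plus a b k J.-1).
have [v20 v21 v22] := coexact_vecC (tau_minus a b k J.-1).
have H0 : eig_valid k 0 J -> A * x + - p * y + q * z = 0.
  by move=> /H /=; rewrite v00 v01 v02.
have H1 : eig_valid k 1 J -> (T ^+ 2 - A ^+ 2) * x + p * (T + A) * y + q * (T - A) * z = 0.
  by move=> /H /=; rewrite v10 v11 v12.
have H2 : eig_valid k 2 J -> (S ^+ 2 - A ^+ 2) * x + p * (S + A) * y + q * (S - A) * z = 0.
  by move=> /H /=; rewrite v20 v21 v22.
have H3 := H 3%N.
case: (J_cases Jk).
- move=> J0; have X0 : x = 0 by apply: x0; rewrite J0.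
  have Y0 : y = 0 by apply: y0; rewrite J0.
  move: H3; rewrite /= J0 /= => /(_ isT); rewrite X0 Y0 !mulr0 !add0r mul1r.
  by [].
- move=> J0; have X0 : x = 0 by apply: x0; rewrite J0 ltnn.
  have Z0 : z = 0 by apply: z0; rewrite J0 -ltnNge leqnSn.
  move: H3; rewrite /= J0 /= eqxx => /(_ isT); rewrite X0 Z0 !mulr0 !add0r addr0 mul1r.
  by [].
- move=> k0 J1; have Y0 : y = 0 by apply: y0; rewrite J1.
  have Z0 : z = 0 by apply: z0; rewrite J1 k0.
  move: H1; rewrite /= J1 => /(_ isT); rewrite Y0 Z0 !mulr0 !addr0.
  rewrite /A k0 J1 subrr mulr0 subrr mulr0 rmorph0 expr0n subr0 => /eqP.
  by rewrite mulf_eq0 expf_eq0 /= (negPf T_neq0) => /eqP.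
- move=> k0 J1; have Y0 : y = 0 by apply: y0; rewrite J1.
  have V0 : eig_valid k 0 J by rewrite /= J1 k0.
  have V1 : eig_valid k 1 J by rewrite /= J1.
  have {}H0 : A * x + q * z = 0 by rewrite -[RHS](H0 V0) Y0 mulr0 addr0.
  have {}H1 : (T ^+ 2 - A ^+ 2) * x + q * (T - A) * z = 0.
    by rewrite -[RHS](H1 V1) Y0 mulr0 addr0.
  have qn : q != 0 by apply: q_neq0; rewrite J1.
  by have [-> ->] := coexact_sep2 qn H0 H1 T_neq0 (TA_first J1).
- move=> k0 J1; have Z0 : z = 0 by apply: z0; rewrite J1 ltnn.
  have V0 : eig_valid k 0 J by rewrite /= J1 k0 leqnn.
  have V1 : eig_valid k 1 J by rewrite /= J1 leqnn.
  have {}H0 : - A * x + p * y = 0.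
    by apply: oppr_inj; rewrite oppr0 -[RHS](H0 V0) Z0; ring.
  have {}H1 : (T ^+ 2 - (- A) ^+ 2) * x + p * (T - - A) * y = 0.
    by rewrite -[RHS](H1 V1) Z0 mulr0 addr0 sqrrN opprK.
  have pn : p != 0 by apply: p_neq0; rewrite J1.
  by have [-> ->] := coexact_sep2 pn H0 H1 T_neq0 (TA_last J1).
- move=> JJ; have /andP[J1 Jk1] := JJ.
  have V0 : eig_valid k 0 J.
    by rewrite /= (ltnW J1) (leqW Jk1) (leq_trans (ltnW J1) Jk1).
  have V1 : eig_valid k 1 J by rewrite /= (ltnW J1) (leqW Jk1).
  exact: (coexact_sep3 two_neq0 (S_neqT JJ) (p_neq0 (leqW Jk1)) (q_neq0 (ltnW J1))
    (H0 V0) (H1 V1) (H2 JJ) T_neq0 (S_neq0 JJ)).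
Qed.

End Fixed.
End EigVec.

(** * Independence of the eigenforms modulo one weight *)

Section Independence.
Variables (R : realType) (a b : R).
Hypotheses (a0 : 0 < a) (b0 : 0 < b).
Local Notation C := R[i].
Local Notation M2 := 'M[C]_2.
Local Notation i0 := (ord0 : 'I_3).
Local Notation i1 := (inord 1 : 'I_3).
Local Notation i2 := (inord 2 : 'I_3).

Definition weight_fun (k : nat) (f : M2 -> C) : Prop := exists beta : nat -> nat -> C,
  forall x, SU2 x -> f x = \sum_(0 <= j < k.+1) \sum_(0 <= s < k.+1) beta j s * mcoef k s j x.

Lemma weight_fun0 k : weight_fun k (fun=> 0).
Proof.
exists (fun _ _ => 0) => x _; rewrite big1 // => j _; rewrite big1 // => s _.
by rewrite mul0r.
Qed.

Lemma weight_fun_lin k f g (c : C) : weight_fun k f -> weight_fun k g ->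
  weight_fun k (fun x => f x + c * g x).
Proof.
move=> [be Hf] [ga Hg]; exists (fun j s => be j s + c * ga j s) => x xS.
rewrite Hf // Hg // mulr_sumr -big_split /=; apply: eq_bigr => j _.
rewrite mulr_sumr -big_split /=; apply: eq_bigr => s _.
by rewrite mulrDl mulrA.
Qed.

Lemma sum_ecoef (k t : nat) (H : nat -> C) (e : nat -> C) : (t <= 2)%N ->
  e 0%N = 0 -> e 1%N = 0 -> (forall J, (k.+2 < J)%N -> e J = 0) ->
  \sum_(0 <= J < k.+3) H J * e (J + t)%N = \sum_(0 <= j < k.+1) H (j + 2 - t)%N * e j.+2.
Proof.
move=> t2 e0 e1 eh; case: t t2 => [|[|[|t]]] // _.
- rewrite big_nat_recl // big_nat_recl // e0 e1 !mulr0 !add0r.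
  by apply: eq_bigr => j _; rewrite addn0 subn0 !addnS addn0.
- rewrite big_nat_recl // big_nat_recr //= e1 [e _]eh ?addn1 // !mulr0 add0r addr0.
  by apply: eq_bigr => j _; rewrite addn1 subn1 addn2.
- rewrite big_nat_recr // big_nat_recr //= !eh ?addn2 // ?ltnS // !mulr0 !addr0.
  by apply: eq_bigr => j _; rewrite addnK addn2.
Qed.

(** The right-hand side is any function of weight [k0], so the result also says that a form of
    weight [k0] has no terms of other weights in its expansion. The shift [t] is the position of the
    function in its block. *)
Lemma ecoef_free N k0 t (H : nat -> nat -> nat -> C) f : (t <= 2)%N -> weight_fun k0 f ->
  (forall x, SU2 x -> \sum_(0 <= k < N) \sum_(0 <= J < k.+3) \sum_(0 <= s < k.+1)
     H k J s * ecoef k s (J + t) x = f x) ->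
  forall k J s, (k < N)%N -> k != k0 -> (s <= k)%N -> (2 <= J + t <= k.+2)%N -> H k J s = 0.
Proof.
move=> t2 [be fE] E k J s kN kk0 sk /andP[J2 Jk].
(* The range is enlarged to include [k0], so that the right-hand side can be moved into the same
   sum. *)
pose N' := maxn N k0.+1.
pose al k s j : C := (if (k < N)%N then H k (j + 2 - t)%N s else 0)
  - (if k == k0 then be j s else 0).
suff : al k s (J + t - 2)%N = 0.
  by rewrite /al kN (negPf kk0) subr0 subnK // addnK.
apply: (@mcoef_free _ N' al) => //; last by rewrite leq_subLR add2n.
  move=> x xS; pose g k := \sum_(0 <= j < k.+1) \sum_(0 <= s < k.+1) H k (j + 2 - t)%N s * mcoef k s j x.
  pose h k := \sum_(0 <= j < k.+1) \sum_(0 <= s < k.+1) be j s * mcoef k s j x.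
  have -> : \sum_(k1 < N') \sum_(j < k1.+1) \sum_(s1 < k1.+1) al k1 s1 j * mcoef k1 s1 j x =
     \sum_(0 <= k1 < N') ((if (k1 < N)%N then g k1 else 0) - (if k1 == k0 then h k1 else 0)).
    rewrite big_mkord; apply: eq_bigr => k1 _; rewrite /g /h !big_mkord /al.
    transitivity ((if (k1 < N)%N then \sum_(i < k1.+1) \sum_(0 <= s1 < k1.+1) 
        H k1 (i + 2 - t)%N s1 * mcoef k1 s1 i x else 0) +
      \sum_(i < k1.+1) \sum_(0 <= s1 < k1.+1) - (if nat_of_ord k1 == k0 then be i s1 else 0) * mcoef k1 s1 i x).
      case: ifP => _; rewrite ?add0r.
        rewrite -big_split /=; apply: eq_bigr => j _; rewrite -big_split /= big_mkord.
        by apply: eq_bigr => s1 _; rewrite mulrDl.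
      by apply: eq_bigr => j _; rewrite big_mkord; apply: eq_bigr => s1 _; rewrite add0r.
    congr (_ + _); case: ifP => _.
      rewrite -sumrN; apply: eq_bigr => j _; rewrite -sumrN; apply: eq_bigr => s1 _.
      by rewrite mulNr.
    by rewrite oppr0 big1 // => j _; rewrite big1 // => s1 _; rewrite mul0r.
  rewrite sumrB -!big_mkcond /=; apply/eqP; rewrite subr_eq0; apply/eqP.
  have -> : \sum_(0 <= k1 < N' | (k1 < N)%N) g k1 = \sum_(0 <= k1 < N) g k1.
    rewrite (big_nat_widen 0 N N') ?leq_maxl //.
  have -> : \sum_(0 <= k1 < N' | k1 == k0) h k1 = f x.
    by rewrite big_nat1_eq /= leq_maxr fE.
  rewrite -(E x xS); apply: eq_bigr => k1 _; rewrite /g.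
  rewrite exchange_big [RHS]exchange_big /=; apply: eq_big_nat => s1 /andP[_ s1k].
  rewrite (@sum_ecoef k1 t (fun J => H k1 J s1) (fun J => ecoef k1 s1 J x)) // => J' J'k.
  case: J' J'k => [|[|J']] //; rewrite !ltnS => J'k.
  by rewrite /ecoef mcoef_high // -ltnS.
by rewrite leq_max kN.
Qed.

Definition eig_sum (N : nat) (c : nat -> nat -> nat -> nat -> C) : 'I_3 -> M2 -> C :=
  fun i x => \sum_(0 <= k < N) \sum_(0 <= J < k.+3) \sum_(0 <= s < k.+1)
    \sum_(0 <= l < 4 | eig_valid k l J) c k J s l * eig_form a b k l J s i x.

(** The combinations w_0, w_1 + i w_2 and w_1 - i w_2 isolate the three functions of each block.
    Comparing their coefficients gives the equations of [eig_vec_free] block by block. *)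
Lemma eig_free N k0 c : (forall i, weight_fun k0 (eig_sum N c i)) ->
  forall k J s l, (k < N)%N -> k != k0 -> (J < k.+3)%N -> (s <= k)%N -> eig_valid k l J ->
    c k J s l = 0.
Proof.
move=> W.
pose V (f : R * R * R -> R) k J s := \sum_(0 <= l < 4 | eig_valid k l J)
  c k J s l * (f (eig_vec a b k l J))%:C.
have S t (f : R * R * R -> R) (lam nu : C) (pr : ('I_3 -> C) -> C) x : nu != 0 ->
    (forall k l J s x, pr (eig_form a b k l J s ^~ x) =
       nu * ((f (eig_vec a b k l J))%:C * ecoef k s (J + t) x)) ->
    (forall (I : Type) (r : seq I) (P : pred I) (g : I -> C) (F : I -> 'I_3 -> C),
       pr (fun i => \sum_(q <- r | P q) g q * F q i) = \sum_(q <- r | P q) g q * pr (F q)) ->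
    \sum_(0 <= k < N) \sum_(0 <= J < k.+3) \sum_(0 <= s < k.+1)
     V f k J s * ecoef k s (J + t) x = nu^-1 * pr (eig_sum N c ^~ x).
  move=> nu0 prE prS.
  have prS1 (I : Type) (r : seq I) (F : I -> 'I_3 -> C) :
      pr (fun i => \sum_(q <- r) F q i) = \sum_(q <- r) pr (F q).
    have := prS I r xpredT (fun=> 1) F.
    under eq_bigr do rewrite mul1r.
    move=> <-; congr pr; apply/funext => i; by under [RHS]eq_bigr do rewrite mul1r.
  rewrite /eig_sum prS1 mulr_sumr; apply: eq_bigr => k _.
  rewrite prS1 mulr_sumr; apply: eq_bigr => J _.
  rewrite prS1 mulr_sumr; apply: eq_bigr => s _.
  rewrite prS mulr_sumr /V mulr_suml; apply: eq_bigr => l _.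
  by rewrite prE; field.
have nI : iC R != 0.
  by apply/eqP => I0; have := iC_sq R; rewrite I0 mul0r => /eqP; rewrite eq_sym oppr_eq0 oner_eq0.
have bE k l J s := bformE k s J (eig_vec a b k l J).1.1 (eig_vec a b k l J).1.2 (eig_vec a b k l J).2.
have S0 x := @S 1%N (fun v => v.1.1) 0 1 (fun w => w i0) x (oner_neq0 _).
have S1 x := @S 0%N (fun v => v.1.2) 0 (- iC R) (fun w => w i1 + iC R * w i2) x.
have S2 x := @S 2%N (fun v => v.2) 0 (- iC R) (fun w => w i1 + (- iC R) * w i2) x.
have I2 := iC_sq R.
have lin (p : C) (I : Type) (r : seq I) (P : pred I) (g : I -> C) (F : I -> 'I_3 -> C) :
    \sum_(q <- r | P q) g q * F q i1 + p * (\sum_(q <- r | P q) g q * F q i2) =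
    \sum_(q <- r | P q) g q * (F q i1 + p * F q i2).
  by rewrite mulr_sumr -big_split /=; apply: eq_bigr => q _; ring.
move=> k J s l kN kk0 Jk sk.
apply: (eig_vec_free a0 b0 (c := c k J s) Jk) => JJ.
- apply: (@ecoef_free N k0 1 (V (fun v => v.1.1)) (eig_sum N c i0)) => //; last by rewrite addn1.
  move=> x xS; rewrite S0 ?invr1 ?mul1r // => k1 l1 J1 s1 y.
  by have [E0 _ _] := bE k1 l1 J1 s1; rewrite /eig_form E0 mul1r addn1.
- apply: (@ecoef_free N k0 0 (V (fun v => v.1.2))
    (fun x => 0 + (- iC R)^-1 * (eig_sum N c i1 x + iC R * eig_sum N c i2 x))) => //; last by rewrite addn0.
    by apply: weight_fun_lin; [exact: weight_fun0|exact: weight_fun_lin].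
  move=> x xS; rewrite S1 ?oppr_eq0 ?add0r // => k1 l1 J1 s1 y.
  have [_ E1 E2] := bE k1 l1 J1 s1; rewrite /eig_form E1 E2 addn0.
  move: (ecoef _ _ _ _) (ecoef _ _ _ _) (_%:C) (_%:C) => u v p q.
  by field.
- apply: (@ecoef_free N k0 2 (V (fun v => v.2))
    (fun x => 0 + (- iC R)^-1 * (eig_sum N c i1 x + (- iC R) * eig_sum N c i2 x))) => //; last by rewrite addn2.
    by apply: weight_fun_lin; [exact: weight_fun0|exact: weight_fun_lin].
  move=> x xS; rewrite S2 ?oppr_eq0 ?add0r // => k1 l1 J1 s1 y.
  have [_ E1 E2] := bE k1 l1 J1 s1; rewrite /eig_form E1 E2 addn2.
  move: (ecoef _ _ _ _) (ecoef _ _ _ _) (_%:C) (_%:C) => u v p q.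
  by field.
Qed.

End Independence.

(** * Isotypical components *)

Section Isotypic.
Variables (R : realType) (a b : R).
Hypotheses (a0 : 0 < a) (b0 : 0 < b).
Local Notation C := R[i].
Local Notation M2 := 'M[C]_2.

(** It restores a homogeneous polynomial of degree k from its affine form at z = (1, X), to compare
    [mpol] with [hpoly]. *)
Definition homogenize (k : nat) (P : {poly C}) (z0 z1 : C) : C :=
  \sum_(j < k.+1) P`_j * z0 ^+ (k - j) * z1 ^+ j.

Lemma homogenize_mul k (P : {poly C}) (p0 p1 z0 z1 : C) : (size P <= k.+1)%N ->
  homogenize k.+1 ((p0%:P + p1 *: 'X) * P) z0 z1 =
  (p0 * z0 + p1 * z1) * homogenize k P z0 z1.
Proof.
move=> sP; rewrite /homogenize.
have cE j : ((p0%:P + p1 *: 'X) * P)`_j = p0 * P`_j + p1 * (if j == 0%N then 0 else P`_j.-1).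
  by rewrite mulrDl coefD coefCM -scalerAl coefZ -commr_polyX coefMX.
transitivity (\sum_(j < k.+2) p0 * P`_j * z0 ^+ (k.+1 - j) * z1 ^+ j +
  \sum_(j < k.+2) p1 * (if nat_of_ord j == 0%N then 0 else P`_j.-1) * z0 ^+ (k.+1 - j) * z1 ^+ j).
  rewrite -big_split; apply: eq_bigr => j _; rewrite cE; move: (P`_j) => p.
  by move: (if _ then _ else _) => q; rewrite /=; ring.
rewrite mulrDl; congr (_ + _).
  rewrite big_ord_recr /= nth_default // mulr0 !mul0r addr0 mulr_sumr.
  apply: eq_bigr => j _; rewrite subSn; last by rewrite -ltnS.
  by rewrite exprS; ring.
rewrite big_ord_recl /= mulr0 !mul0r add0r mulr_sumr; apply: eq_bigr => j _.
by rewrite /= /bump /= add1n subSS exprS; ring.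
Qed.

Lemma homogenize_mpol n m x z0 z1 : homogenize (n + m) (mpol n m x) z0 z1 =
  (x o1 o1 * z0 + - x o1 o0 * z1) ^+ n * (- x o0 o1 * z0 + x o0 o0 * z1) ^+ m.
Proof.
have AE : Alin x = (x o1 o1)%:P + (- x o1 o0) *: 'X by rewrite /Alin scaleNr.
have BE : Blin x = (- x o0 o1)%:P + (x o0 o0) *: 'X by rewrite /Blin polyCN.
elim: n => [|n IH].
  elim: m => [|m IH].
    by rewrite /homogenize /mpol big_ord1 !expr0 !mulr1 coef1.
  have M0 l : mpol 0 l x = Blin x ^+ l by rewrite /mpol expr0 mul1r.
  rewrite add0n M0 exprS -M0 [Blin x]BE homogenize_mul; last exact: (size_mpol 0 m).
  by rewrite -{1}[m]add0n IH !expr0 !mul1r exprS.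
have MS : mpol n.+1 m x = Alin x * mpol n m x by rewrite /mpol exprS mulrA.
rewrite addSn MS [Alin x]AE homogenize_mul; last exact: size_mpol.
by rewrite IH exprS mulrA.
Qed.

Lemma hpoly_adj2 k (u : 'rV[C]_k.+1) (z : 'rV[C]_2) x :
  hpoly u (z *m adj2 x) =
  \sum_(j < k.+1) (\sum_(s < k.+1) u 0 s * mcoef k s j x) * z 0 0 ^+ (k - j) * z 0 1 ^+ j.
Proof.
have E (s : 'I_k.+1) : homogenize k (mpol (k - s) s x) (z 0 0) (z 0 1) =
   (z *m adj2 x) 0 0 ^+ (k - s) * (z *m adj2 x) 0 1 ^+ s.
  have {1}-> : k = (k - s + s)%N by rewrite subnK // -ltnS.
  have e1 : (1 : 'I_2) = o1 by apply: val_inj.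
  rewrite homogenize_mpol !mxE !sum2 /adj2 !mxE /= e1 -/o0.
  by congr (_ ^+ _ * _ ^+ _); ring.
transitivity (\sum_(s < k.+1) u 0 s * homogenize k (mpol (k - s) s x) (z 0 0) (z 0 1)).
  by apply: eq_bigr => s _; rewrite E mulrA.
rewrite /homogenize; under eq_bigr do rewrite mulr_sumr.
rewrite exchange_big; apply: eq_bigr => j _ /=.
by rewrite !mulr_suml; apply: eq_bigr => s _; rewrite /mcoef !mulrA.
Qed.

(** For fixed [j], pairing a vector with the coefficients over [s] is thus an intertwiner into
    functions under left translation. Both sides are coefficients of polynomials that agree at all z
    = (1, n), since adj(g^-1 x) = adj(x) g. *)
Lemma hpoly_mcoef k (u u' : 'rV[C]_k.+1) (g x : M2) j : SU2 g ->
  (forall z, hpoly u' z = hpoly u (z *m g)) ->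
  \sum_(s < k.+1) u' 0 s * mcoef k s j x =
  \sum_(s < k.+1) u 0 s * mcoef k s j (invmx g *m x).
Proof.
move=> gS H.
case: (ltnP k j) => [kj|jk].
  by rewrite !big1 // => s _; rewrite mcoef_high ?mulr0 // -ltnS.
pose p (v : 'rV[C]_k.+1) y := \poly_(j < k.+1) \sum_(s < k.+1) v 0 s * mcoef k s j y.
have pE v y i : (i <= k)%N -> (p v y)`_i = \sum_(s < k.+1) v 0 s * mcoef k s i y.
  by move=> ik; rewrite coef_poly ltnS ik.
rewrite -!pE //; suff -> : p u' x = p u (invmx g *m x) by [].
apply/eqP; rewrite -subr_eq0; apply/eqP.
apply: poly0_nat => n; rewrite hornerD hornerN.
pose z : 'rV[C]_2 := \row_i (if i == 0 then 1 else n%:R).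
have ev v y : (p v y).[n%:R] = hpoly v (z *m adj2 y).
  rewrite hpoly_adj2 horner_poly; apply: eq_bigr => i _.
  by rewrite /z !mxE /= expr1n mulr1.
by rewrite !ev H SU2_invmx // adj2M adj2K mulmxA subrr.
Qed.

Lemma hpoly_ecoef k (u u' : 'rV[C]_k.+1) (g x : M2) J : SU2 g ->
  (forall z, hpoly u' z = hpoly u (z *m g)) ->
  \sum_(s < k.+1) u' 0 s * ecoef k s J x =
  \sum_(s < k.+1) u 0 s * ecoef k s J (invmx g *m x).
Proof.
move=> gS H; case: J => [|[|j]]; last exact: hpoly_mcoef.
  by rewrite !big1 // => s _; rewrite mulr0.
by rewrite !big1 // => s _; rewrite mulr0.
Qed.

Lemma bform_lin k J al be ga (u : 'rV[C]_k.+1) i x :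
  \sum_(s < k.+1) u 0 s * bform k s J al be ga i x =
  nth 0 [:: al%:C * \sum_(s < k.+1) u 0 s * ecoef k s J.+1 x;
    (- (iC R / 2) * be%:C) * (\sum_(s < k.+1) u 0 s * ecoef k s J x) +
    (- (iC R / 2) * ga%:C) * \sum_(s < k.+1) u 0 s * ecoef k s J.+2 x;
    (- 2^-1 * be%:C) * (\sum_(s < k.+1) u 0 s * ecoef k s J x) +
    (2^-1 * ga%:C) * \sum_(s < k.+1) u 0 s * ecoef k s J.+2 x] i.
Proof.
case: i => [[|[|[|i]]] Hi] //=; rewrite ?mulr_sumr -?big_split; apply: eq_bigr => s _;
  by rewrite /bform /=; ring.
Qed.

(** All indices [s] together form one intertwiner, and the given form is the image of a basis
    vector. *)
Lemma isotypic_bform k s J al be ga : (s <= k)%N ->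
  isotypic k (bform k s J al be ga : form1 (gSU2 a0 b0 b0)).
Proof.
move=> sk.
pose T (u : 'rV[C]_k.+1) : form1 (gSU2 a0 b0 b0) :=
  fun i x => \sum_(s < k.+1) u 0 s * bform k s J al be ga i x.
exists 1%N, (fun _ => T), (fun _ => delta_mx 0 (inord s)); split.
  move=> _; split.
  - move=> u i; apply: smooth_sum => s'; apply: smoothZ; exact: smooth_bform.
  - move=> c u u' x _ i; rewrite /T mulr_sumr -big_split; apply: eq_bigr => s' _ /=.
    by rewrite !mxE; ring.
  - move=> g u u' gS H x _ i; rewrite /T /ltrans !bform_lin.
    by rewrite !(hpoly_ecoef _ _ gS H).
move=> x _ i; rewrite big_ord1 /T (bigD1 (inord s)) //= mxE !eqxx mul1r.
rewrite big1 ?addr0 ?inordK // => s' /negPf ss'.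
by rewrite mxE ss' andbF mul0r.
Qed.

Lemma intertwiner_sum k (T : 'rV[C]_k.+1 -> form1 (gSU2 a0 b0 b0)) u i x :
  intertwiner T -> SU2 x -> T u i x = \sum_j u 0 j * T (delta_mx 0 j) i x.
Proof.
move=> [_ L _] xS.
have T0 : T 0 i x = 0.
  have := L 0 0 0 x xS i; rewrite scaler0 addr0 mul0r add0r.
  have := L 1 0 0 x xS i; rewrite scaler0 addr0 mul1r => /eqP.
  by rewrite -subr_eq0 opprD addrA subrr sub0r oppr_eq0 => /eqP.
have S (r : seq 'I_k.+1) : T (\sum_(j <- r) u 0 j *: delta_mx 0 j) i x =
    \sum_(j <- r) u 0 j * T (delta_mx 0 j) i x.
  elim: r => [|j r IH]; first by rewrite !big_nil.
  by rewrite !big_cons L // IH.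
by rewrite -S -row_sum_delta.
Qed.

(** An intertwiner is determined by its values at the identity: (T u)(x) = (T (x^-1 u))(1), and the
    coordinates of x^-1 u are combinations of the [mcoef k s j x]. *)
Lemma isotypic_weight k (w : form1 (gSU2 a0 b0 b0)) i : isotypic k w -> weight_fun k (w i).
Proof.
move=> [n [T [u [IT wE]]]].
exists (fun j s => \sum_r T r (delta_mx 0 (inord j)) i 1%:M * u r 0 (inord s)) => x xS.
rewrite wE //.
have Tx r : T r (u r) i x =
    \sum_(j < k.+1) (\sum_(s < k.+1) u r 0 s * mcoef k s j x) * T r (delta_mx 0 j) i 1%:M.
  pose u' : 'rV[C]_k.+1 := \row_j \sum_(s < k.+1) u r 0 s * mcoef k s j x.
  have [_ _ E] := IT r.
  have H z : hpoly u' z = hpoly (u r) (z *m adj2 x).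
    by rewrite hpoly_adj2; apply: eq_bigr => j _; rewrite mxE.
  have := E _ _ _ (SU2_adj xS) H 1%:M (SU2_1 R) i.
  rewrite /ltrans SU2_invmx ?adj2K; last exact: SU2_adj.
  rewrite mulmx1 => <-; rewrite (intertwiner_sum _ _ (IT r) (SU2_1 R)).
  by apply: eq_bigr => j _; rewrite mxE.
under eq_bigr do rewrite Tx.
rewrite exchange_big big_mkord; apply: eq_bigr => j _ /=.
under eq_bigr do rewrite mulr_suml.
rewrite exchange_big big_mkord; apply: eq_bigr => s _ /=.
rewrite mulr_suml; apply: eq_bigr => r _.
by rewrite !inord_val; ring.
Qed.

End Isotypic.

(** * Self-adjointness and completeness *)

Section Hermitian.
Variables (R : realType) (a b : R).
Hypotheses (a0 : 0 < a) (b0 : 0 < b).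
Local Notation C := R[i].
Local Notation M2 := 'M[C]_2.
Local Notation G := (gSU2 a0 b0 b0).
Local Notation form := ('I_3 -> M2 -> C).
Local Notation i0 := (ord0 : 'I_3).
Local Notation i1 := (inord 1 : 'I_3).
Local Notation i2 := (inord 2 : 'I_3).
Implicit Types (f g h : M2 -> C) (w p q u : form).

(** Bilinear at first, so that integration by parts involves no conjugates; conjugation is inserted
    later, using that the operators are real. *)
Definition pair f g : C := Imean (fun x => f x * g x).

Lemma pairC f g : pair f g = pair g f.
Proof. by congr Imean; apply/funext => x; rewrite mulrC. Qed.

Lemma pair_ext f f' g g' : (forall x, SU2 x -> f x = f' x) ->
  (forall x, SU2 x -> g x = g' x) -> pair f g = pair f' g'.
Proof. by move=> ff gg; apply: Imean_ext => x xS; rewrite ff ?gg. Qed.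

Lemma pairDl f g h (c : C) : smooth f -> smooth g -> smooth h ->
  pair (fun x => f x + c * g x) h = pair f h + c * pair g h.
Proof.
move=> sf sg sh; rewrite /pair -ImeanZ; last exact: smoothM.
have sfh := smoothM sf sh; have sgh := smoothM sg sh.
rewrite -ImeanD //; last exact: smoothZ.
by congr Imean; apply/funext => x; rewrite mulrDl mulrA.
Qed.

Lemma pair_Yop i f g : smooth f -> smooth g -> pair (Yop a b i f) g = - pair f (Yop a b i g).
Proof.
move=> sf sg; have := Imean_suX i (smoothM sf sg).
have -> : suX i (fun y => f y * g y) = (fun x => suX i f x * g x + f x * suX i g x).
  by apply/funext => x; apply: suXM.
have sfg := smoothM (smooth_suX i sf) sg; have sgf := smoothM sf (smooth_suX i sg).
rewrite ImeanD // => H; rewrite /pair /Yop.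
have -> : (fun x => (scal a b b i)%:C * suX i f x * g x) =
    (fun x => (scal a b b i)%:C * (suX i f x * g x)).
  by apply/funext => x; rewrite mulrA.
have -> : (fun x => f x * ((scal a b b i)%:C * suX i g x)) =
    (fun x => (scal a b b i)%:C * (f x * suX i g x)).
  by apply/funext => x; rewrite mulrCA.
rewrite !ImeanZ // -mulrN; congr (_ * _).
by apply/eqP; rewrite -subr_eq0 opprK H.
Qed.

Lemma pairE f g : pair f g = Imean (fun x => f x * g x).
Proof. by []. Qed.

Opaque pair.

Definition bil w q : C := pair (w i0) (q i0) + pair (w i1) (q i1) + pair (w i2) (q i2).

Lemma bilE w q : bil w q = pair (w i0) (q i0) + pair (w i1) (q i1) + pair (w i2) (q i2).
Proof. by []. Qed.

Lemma bilC w q : bil w q = bil q w.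
Proof. by rewrite /bil ![pair (w _) _]pairC. Qed.

Lemma pair_sub3 f g h k (c : C) : smooth f -> smooth g -> smooth h -> smooth k ->
  pair (fun x => f x - g x - c * h x) k = pair f k - pair g k - c * pair h k.
Proof.
move=> sf sg sh sk.
have -> : (fun x => f x - g x - c * h x) = (fun x => (f x + -1 * g x) + - c * h x).
  by apply/funext => x; rewrite mulN1r mulNr.
rewrite pairDl ?pairDl ?mulN1r ?mulNr //.
by apply: smoothD => //; apply: smoothZ.
Qed.

(** Integration by parts changes the sign, and so does exchanging the two derivative terms of a curl
    component; the zero-order part is diagonal. *)
Lemma bil_ccurl w q : (forall i, smooth (w i)) -> (forall i, smooth (q i)) ->
  bil (ccurl a b w) q = bil w (ccurl a b q).
Proof.
move=> sw sq.
have E v : [/\ ccurl a b v i0 = (fun x => Yop a b i1 (v i2) x - Yop a b i2 (v i1) x - (2 * (b ^+ 2 / a))%:C * v i0 x),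
   ccurl a b v i1 = (fun x => Yop a b i2 (v i0) x - Yop a b i0 (v i2) x - (2 * a)%:C * v i1 x) &
   ccurl a b v i2 = (fun x => Yop a b i0 (v i1) x - Yop a b i1 (v i0) x - (2 * a)%:C * v i2 x)].
  by split; apply/funext => x; [have [h _ _] := ccurlE a b v x|have [_ h _] := ccurlE a b v x|
    have [_ _ h] := ccurlE a b v x]; exact: h.
have sY v i j : (forall i, smooth (v i)) -> smooth (Yop a b i (v j)).
  by move=> sv; apply: smooth_Yop.
have F v p : (forall i, smooth (v i)) -> (forall i, smooth (p i)) -> bil (ccurl a b v) p =
    pair (Yop a b i1 (v i2)) (p i0) - pair (Yop a b i2 (v i1)) (p i0)
      - (2 * (b ^+ 2 / a))%:C * pair (v i0) (p i0) +
    (pair (Yop a b i2 (v i0)) (p i1) - pair (Yop a b i0 (v i2)) (p i1)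
      - (2 * a)%:C * pair (v i1) (p i1)) +
    (pair (Yop a b i0 (v i1)) (p i2) - pair (Yop a b i1 (v i0)) (p i2)
      - (2 * a)%:C * pair (v i2) (p i2)).
  move=> sv sp; rewrite /bil; have [-> -> ->] : [/\ pair (ccurl a b v i0) (p i0) = pair (Yop a b i1 (v i2)) (p i0)
      - pair (Yop a b i2 (v i1)) (p i0) - (2 * (b ^+ 2 / a))%:C * pair (v i0) (p i0),
      pair (ccurl a b v i1) (p i1) = pair (Yop a b i2 (v i0)) (p i1)
      - pair (Yop a b i0 (v i2)) (p i1) - (2 * a)%:C * pair (v i1) (p i1) &
      pair (ccurl a b v i2) (p i2) = pair (Yop a b i0 (v i1)) (p i2)
      - pair (Yop a b i1 (v i0)) (p i2) - (2 * a)%:C * pair (v i2) (p i2)].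
    have [-> -> ->] := E v.
    by split; (rewrite pair_sub3; [done|exact: sY|exact: sY|done|done]).
  by [].
rewrite (F w q) // (bilC w) (F q w) //.
have Yp i j k : pair (Yop a b i (w j)) (q k) = - pair (Yop a b i (q k)) (w j).
  by rewrite pair_Yop // pairC.
have := Yp; have := pairC; move: (Yop a b) (pair) (i0) (i1) (i2) => Y P j0 j1 j2 PC YP.
rewrite (PC (q j0)) (PC (q j1)) (PC (q j2)) (YP j1 j2 j0) (YP j2 j1 j0) (YP j2 j0 j1)
  (YP j0 j2 j1) (YP j0 j1 j2) (YP j1 j0 j2).
by ring.
Qed.

Lemma bil_grad f q : smooth f -> (forall i, smooth (q i)) ->
  bil (fun i => Yop a b i f) q = - pair f (cdiv a b q).
Proof.
move=> sf sq; have sY i : smooth (Yop a b i (q i)) by apply: smooth_Yop.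
rewrite /bil; transitivity (- pair f (Yop a b i0 (q i0)) - pair f (Yop a b i1 (q i1))
    - pair f (Yop a b i2 (q i2))); first by congr (_ + _ + _); apply: pair_Yop.
have -> : cdiv a b q = (fun x => (Yop a b i0 (q i0) x + 1 * Yop a b i1 (q i1) x) + 1 * Yop a b i2 (q i2) x).
  apply/funext => x; rewrite /cdiv; move: (Yop _ _ i0 _ x) (Yop _ _ i1 _ x) (Yop _ _ i2 _ x).
  by move=> *; rewrite !mul1r.
move: (Yop a b i0 (q i0)) (Yop a b i1 (q i1)) (Yop a b i2 (q i2)) (sY i0) (sY i1) (sY i2).
move=> y0 y1 y2 s0 s1 s2.
rewrite [in RHS]pairC pairDl //; last by apply: smoothD => //; apply: smoothZ.
by rewrite pairDl // !mul1r !(pairC f) !opprD.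
Qed.

Lemma bilDl w q p (c : C) : (forall i, smooth (w i)) -> (forall i, smooth (q i)) ->
  (forall i, smooth (p i)) ->
  bil (fun i x => w i x + c * q i x) p = bil w p + c * bil q p.
Proof. by move=> sw sq sp; rewrite /bil !pairDl //; ring. Qed.

Lemma bil_ext w w' q q' : (forall x, SU2 x -> forall i, w i x = w' i x) ->
  (forall x, SU2 x -> forall i, q i x = q' i x) -> bil w q = bil w' q'.
Proof.
by move=> ww qq; rewrite /bil; congr (_ + _ + _); apply: pair_ext => x xS; rewrite ?ww ?qq.
Qed.

Opaque bil.

Lemma Delta1_ccurl w : (forall i, smooth (w i)) -> Delta1 (G := G) w =
  (fun i x => ccurl a b (ccurl a b w) i x + -1 * Yop a b i (cdiv a b w) x).
Proof.
move=> sw; apply/funext => i; apply/funext => x; rewrite Delta1E // mulN1r addrC.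
by move: (Yop _ _ _ _ _) (ccurl _ _ _ _ _).
Qed.

Lemma bil_Delta1 w q : (forall i, smooth (w i)) -> (forall i, smooth (q i)) ->
  bil (Delta1 (G := G) w) q = bil w (Delta1 (G := G) q).
Proof.
have H v p : (forall i, smooth (v i)) -> (forall i, smooth (p i)) ->
    bil (Delta1 (G := G) v) p = bil (ccurl a b v) (ccurl a b p) + pair (cdiv a b v) (cdiv a b p).
  move=> sv sp; have sc := smooth_ccurl a b sv; have sd := smooth_cdiv a b sv.
  rewrite Delta1_ccurl // bilDl //; [|exact: smooth_ccurl|by move=> i; exact: smooth_Yop].
  by rewrite bil_grad // mulN1r opprK (bil_ccurl sc sp).
move=> sw sq; rewrite (H w q sw sq) (bilC w) (H q w sq sw).
by rewrite (bilC (ccurl a b q)) (pairC (cdiv a b q)).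
Qed.

Definition fconj w : form := fun i x => conjc (w i x).

Lemma smooth_fconj w : (forall i, smooth (w i)) -> forall i, smooth (fconj w i).
Proof. by move=> sw i; apply: smooth_conj. Qed.

Lemma Yop_conj i f : smooth f -> Yop a b i (fun x => conjc (f x)) = (fun x => conjc (Yop a b i f x)).
Proof.
move=> sf; apply/funext => x; rewrite /Yop suX_conj //.
by move: (suX _ _ _) => [u v]; apply/eqP; rewrite eq_complex /= !mul0r !subr0 !addr0 mulrN !eqxx.
Qed.

Lemma ccurl_conj w : (forall i, smooth (w i)) -> ccurl a b (fconj w) = fconj (ccurl a b w).
Proof.
move=> sw; apply/funext => i; apply/funext => x.
have [C0 C1 C2] := ccurlE a b w x; have [D0 D1 D2] := ccurlE a b (fconj w) x.
have Z (c : R) (y z t : C) : conjc (y - z - c%:C * t) = conjc y - conjc z - c%:C * conjc t.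
  by case: y z t => [? ?] [? ?] [? ?]; apply/eqP; rewrite eq_complex /=; apply/andP; split; apply/eqP; ring.
by case: (ord3P i) => ->; rewrite ?D0 ?D1 ?D2 /fconj ?C0 ?C1 ?C2 Z !Yop_conj.
Qed.

Lemma cdiv_conj w : (forall i, smooth (w i)) -> cdiv a b (fconj w) = (fun x => conjc (cdiv a b w x)).
Proof.
move=> sw; apply/funext => x; rewrite /cdiv /fconj !Yop_conj //.
by move: (Yop _ _ _ _ _) (Yop _ _ _ _ _) (Yop _ _ _ _ _) => [? ?] [? ?] [? ?];
  apply/eqP; rewrite eq_complex /=; apply/andP; split; apply/eqP; ring.
Qed.

Lemma Delta1_conj w : (forall i, smooth (w i)) ->
  Delta1 (G := G) (fconj w) = fconj (Delta1 (G := G) w).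
Proof.
move=> sw; have sc := smooth_fconj sw; rewrite !Delta1_ccurl //.
rewrite !ccurl_conj //; last exact: smooth_ccurl.
rewrite cdiv_conj //; apply/funext => i; apply/funext => x.
rewrite Yop_conj; last exact: smooth_cdiv.
rewrite /fconj; move: (ccurl _ _ _ _ _) (Yop _ _ _ _ _) => [? ?] [? ?].
by apply/eqP; rewrite eq_complex /=; apply/andP; split; apply/eqP; ring.
Qed.

Definition herm w p : C := bil w (fconj p).

Lemma herm_lin w q p (c : C) : (forall i, smooth (w i)) -> (forall i, smooth (q i)) ->
  (forall i, smooth (p i)) ->
  herm (fun i x => w i x + c * q i x) p = herm w p + c * herm q p.
Proof. by move=> sw sq sp; apply: bilDl => // i; apply: smooth_fconj. Qed.

Lemma herm_linr w q p (c : C) : (forall i, smooth (w i)) -> (forall i, smooth (q i)) ->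
  (forall i, smooth (p i)) ->
  herm w (fun i x => q i x + c * p i x) = herm w q + conjc c * herm w p.
Proof.
move=> sw sq sp; rewrite /herm bilC.
have -> : fconj (fun i x => q i x + c * p i x) = (fun i x => fconj q i x + conjc c * fconj p i x).
  by apply/funext => i; apply/funext => x; rewrite /fconj conjcD conjcM.
by rewrite bilDl // ?[bil _ w]bilC //; apply: smooth_fconj.
Qed.

Lemma bil0l v : (forall i, smooth (v i)) -> bil (fun _ _ => 0) v = 0.
Proof.
move=> sv; have s0 (i : 'I_3) : smooth ((fun=> 0) : M2 -> C) by apply: smooth_cst.
rewrite -[RHS](subrr (bil (fun _ _ => 0) v)) -[in RHS]mulN1r.
rewrite -(@bilDl (fun _ _ => 0) (fun _ _ => 0) v (-1) s0 s0 sv).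
by apply: bil_ext => // x _ i; rewrite mulr0 addr0.
Qed.

Lemma bilZl w v c : (forall i, smooth (w i)) -> (forall i, smooth (v i)) ->
  bil (fun i x => c * w i x) v = c * bil w v.
Proof.
move=> sw sv; have s0 (i : 'I_3) : smooth ((fun=> 0) : M2 -> C) by apply: smooth_cst.
have := @bilDl (fun _ _ => 0) w v c s0 sw sv.
rewrite bil0l // add0r => <-; apply: bil_ext => // x _ i.
by rewrite add0r.
Qed.

Lemma fconj0 : fconj (fun _ _ => 0) = (fun _ _ => 0).
Proof. by apply/funext => i; apply/funext => x; apply/eqP; rewrite eq_complex /= oppr0 !eqxx. Qed.

(** The conjugate of [p] has the same real eigenvalue [mu]. As [lambda] may be any complex number,
    the lemma also serves to exclude non-real eigenvalues. *)
Lemma herm_eigen w p (lambda : C) (mu : R) : (forall i, smooth (w i)) -> (forall i, smooth (p i)) ->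
  (forall x, SU2 x -> forall i, Delta1 (G := G) w i x = lambda * w i x) ->
  (forall i x, Delta1 (G := G) p i x = mu%:C * p i x) -> lambda != mu%:C -> herm w p = 0.
Proof.
move=> sw sp Ew Ep lm; have sc := smooth_fconj sp.
have := bil_Delta1 sw sc; rewrite Delta1_conj //.
have -> : bil (Delta1 (G := G) w) (fconj p) = lambda * bil w (fconj p).
  by rewrite -bilZl //; apply: bil_ext.
have -> : bil w (fconj (Delta1 (G := G) p)) = mu%:C * bil w (fconj p).
  rewrite bilC (bilC w) -bilZl //; apply: bil_ext => // x xS i; rewrite /fconj Ep.
  by move: (p i x) => [u v]; apply/eqP; rewrite eq_complex /= !mul0r !subr0 !addr0 mulrN !eqxx.
move/eqP; rewrite -subr_eq0 -mulrBl mulf_eq0 subr_eq0 (negPf lm) => /eqP; exact.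
Qed.

(** For definiteness: if |f|^2 > 0 at a point, it is at least half that value on a ball, and
    [smean_lower_bound] makes its mean positive. *)
Lemma pair_conj_ge0 f : smooth f -> 0 <= complex.Re (pair f (fun x => conjc (f x))) /\
  (complex.Re (pair f (fun x => conjc (f x))) = 0 -> forall x, SU2 x -> f x = 0).
Proof.
move=> sf; have sff := smoothM sf (smooth_conj sf).
have [L1 _] := smooth_lip sff; rewrite pairE /Imean /=.
pose h x := complex.Re (f x * conjc (f x)).
have hE x : h x = complex.Re (f x) ^+ 2 + complex.Im (f x) ^+ 2.
  by rewrite /h; case: (f x) => u v /=; rewrite mulrN opprK !expr2.
have h0 x : 0 <= h x by rewrite hE addr_ge0 ?sqr_ge0.
split; first by apply: smean_ge0 => // x; apply: h0.
move=> m0 x xS; case: L1 => L L0 LP.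
suff : h x = 0.
  move/eqP; rewrite hE paddr_eq0 ?sqr_ge0 // !sqrf_eq0 => /andP[/eqP u0 /eqP v0].
  by move: u0 v0; case: (f x) => u v /= -> ->.
apply/eqP; rewrite eq_le h0 andbT leNgt; apply/negP => hx.
have e0 : 0 < h x / 2 / (L + 1) by rewrite !divr_gt0 // ltr_wpDl.
have [n n0 nP] := smean_lower_bound e0.
have := nP _ (exist _ x xS) (h x / 2) (ex_intro2 _ _ L L0 LP) (fun y => h0 (sval y)).
have near y : sd y (exist _ x xS) <= h x / 2 / (L + 1) -> h x / 2 <= h (sval y).
  move=> yx; have := LP y (exist _ x xS); rewrite -/(h (sval y)) -/(h x) => H.
  have : L * sd y (exist _ x xS) <= h x / 2.
    apply: le_trans (ler_wpM2l L0 yx) _; rewrite mulrCA ler_piMr ?divr_ge0 ?h0 //.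
    by rewrite ler_pdivrMr ?ltr_wpDl // mul1r lerDl.
  move=> H2; have {}H := le_trans H H2; move: H; rewrite ler_norml => /andP[H _].
  by move: (h x) (h (sval y)) H => u v; lra.
move=> /(_ near); have -> : smean (fun y => h (sval y)) = 0 by [].
by rewrite mulr0 leNgt divr_gt0.
Qed.

Lemma herm_eq0 u : (forall i, smooth (u i)) -> herm u u = 0 ->
  forall x, SU2 x -> forall i, u i x = 0.
Proof.
move=> su; rewrite /herm bilE /fconj => /(congr1 (@complex.Re R)); rewrite !cReD /=.
have H i := pair_conj_ge0 (su i).
move: (H i0) (H i1) (H i2) => [p0 z0] [p1 z1] [p2 z2] /eqP.
rewrite paddr_eq0 ?addr_ge0 // paddr_eq0 // => /andP[/andP[/eqP e0 /eqP e1] /eqP e2].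
by move=> x xS i; case: (ord3P i) => ->; [exact: z0|exact: z1|exact: z2].
Qed.

Lemma herm_sum (T : Type) (r : seq T) (c : T -> C) (B : T -> form) p :
  (forall t i, smooth (B t i)) -> (forall i, smooth (p i)) ->
  herm (fun i x => \sum_(t <- r) c t * B t i x) p = \sum_(t <- r) c t * herm (B t) p.
Proof.
move=> sB sp; have ss (s : seq T) i : smooth (fun x => \sum_(t <- s) c t * B t i x).
  by apply: smooth_sum => t; apply: smoothZ.
elim: r => [|t r IH].
  rewrite [RHS]big_nil (_ : (fun i x => _) = (fun _ _ => 0)).
    exact: bil0l (smooth_fconj sp).
  by apply/funext => i; apply/funext => x; rewrite big_nil.
rewrite big_cons -IH addrC -herm_lin //.
rewrite (_ : (fun i x => \sum_(t' <- t :: r) _) =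
  (fun i x => \sum_(t' <- r) c t' * B t' i x + c t * B t i x)) //.
by apply/funext => i; apply/funext => x; rewrite big_cons addrC.
Qed.

Lemma herm_sumr (T : Type) (r : seq T) (c : T -> C) (B : T -> form) p :
  (forall t i, smooth (B t i)) -> (forall i, smooth (p i)) ->
  herm p (fun i x => \sum_(t <- r) c t * B t i x) = \sum_(t <- r) conjc (c t) * herm p (B t).
Proof.
move=> sB sp; have ss (s : seq T) i : smooth (fun x => \sum_(t <- s) c t * B t i x).
  by apply: smooth_sum => t; apply: smoothZ.
elim: r => [|t r IH].
  rewrite [RHS]big_nil (_ : (fun i x => _) = (fun _ _ => 0)).
    by rewrite /herm fconj0 bilC; exact: bil0l.
  by apply/funext => i; apply/funext => x; rewrite big_nil.
rewrite big_cons -IH addrC -herm_linr //.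
rewrite (_ : (fun i x => \sum_(t' <- t :: r) _) =
  (fun i x => \sum_(t' <- r) c t' * B t' i x + c t * B t i x)) //.
by apply/funext => i; apply/funext => x; rewrite big_cons addrC.
Qed.

(** The first form is itself orthogonalised against the rest by the induction hypothesis, and its
    remainder [u] gives the one new correction to [w]. *)
Lemma gram_schmidt (T : eqType) (r : seq T) (B : T -> form) w : uniq r ->
  (forall t i, smooth (B t i)) -> (forall i, smooth (w i)) ->
  exists c : T -> C, forall t, t \in r ->
    herm (fun i x => w i x + -1 * \sum_(t' <- r) c t' * B t' i x) (B t) = 0.
Proof.
move=> ur sB; elim: r ur w => [|t0 r IH] /=.
  by move=> _ w _; exists (fun=> 0).
move=> /andP[t0r /IH{}IH] w sw.
have ss (c : T -> C) i : smooth (fun x => \sum_(t <- r) c t * B t i x).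
  by apply: smooth_sum => t; apply: smoothZ.
have [c cP] := IH _ sw; have [d dP] := IH _ (sB t0).
pose w1 : form := fun i x => w i x + -1 * \sum_(t' <- r) c t' * B t' i x.
pose u : form := fun i x => B t0 i x + -1 * \sum_(t' <- r) d t' * B t' i x.
have sw1 i : smooth (w1 i) by apply: smoothD => //; apply: smoothZ; apply: ss.
have su i : smooth (u i) by apply: smoothD => //; apply: smoothZ; apply: ss.
pose al := herm w1 u / herm u u.
exists (fun t => if t == t0 then al else c t - al * d t).
have E : (fun i x => w i x + -1 * \sum_(t' <- t0 :: r)
    (if t' == t0 then al else c t' - al * d t') * B t' i x) = (fun i x => w1 i x + - al * u i x).
  apply/funext => i; apply/funext => x; rewrite big_cons eqxx /w1 /u.
  have -> : \sum_(t' <- r) (if t' == t0 then al else c t' - al * d t') * B t' i x =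
     \sum_(t' <- r) c t' * B t' i x - al * \sum_(t' <- r) d t' * B t' i x.
    rewrite mulr_sumr -sumrB [LHS]big_seq [RHS]big_seq; apply: eq_bigr => t tr.
    have /negPf-> : t != t0 by apply: contraNneq t0r => <-.
    by rewrite mulrBl mulrA.
  ring.
rewrite E => t; rewrite inE => tr.
have orth t' : t' \in r -> herm (fun i x => w1 i x + - al * u i x) (B t') = 0.
  by move=> t'r; rewrite herm_lin // cP // dP // mulr0 addr0.
case/orP: tr => [/eqP ->|]; last exact: orth.
have uu : herm (fun i x => w1 i x + - al * u i x) u = 0.
  rewrite herm_lin // /al; have [u0|u0] := eqVneq (herm u u) 0.
    rewrite u0 !mulr0 addr0.
    have U := herm_eq0 su u0; rewrite /herm bilC.
    rewrite -(bil0l sw1); apply: bil_ext => // x xS i.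
    by rewrite /fconj (U x xS i); apply/eqP; rewrite eq_complex /= ?oppr0 !eqxx.
  by rewrite mulNr divfK // subrr.
pose W : form := fun i x => w1 i x + - al * u i x.
have sW i : smooth (W i) by apply: smoothD => //; apply: smoothZ.
have -> : B t0 = (fun i x => u i x + 1 * \sum_(t' <- r) d t' * B t' i x).
  by apply/funext => i; apply/funext => x; rewrite /u; ring.
rewrite herm_linr // -/W; try by move=> i; apply: ss.
rewrite uu add0r herm_sumr // big_seq big1 ?mulr0 // => t1 tr'.
by rewrite orth // mulr0.
Qed.

End Hermitian.

(** * Completeness of the eigenforms *)

Section Complete.
Variables (R : realType) (a b : R).
Hypotheses (a0 : 0 < a) (b0 : 0 < b).
Local Notation C := R[i].
Local Notation M2 := 'M[C]_2.
Local Notation G := (gSU2 a0 b0 b0).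
Local Notation form := ('I_3 -> M2 -> C).
Local Notation i0 := (ord0 : 'I_3).
Local Notation i1 := (inord 1 : 'I_3).
Local Notation i2 := (inord 2 : 'I_3).
Implicit Types (f g h : M2 -> C) (w p q u : form).

Lemma Imean_conj f : smooth f -> Imean (fun x => conjc (f x)) = conjc (Imean f).
Proof.
move=> sf; have [L1 L2] := smooth_lip sf; rewrite /Imean.
have E x : complex.Re (conjc (f x)) = complex.Re (f x) by case: (f x).
have E' x : complex.Im (conjc (f x)) = -1 * complex.Im (f x).
  by case: (f x) => u v /=; rewrite mulN1r.
have -> : (fun x : su2 R => complex.Im (conjc (f (sval x)))) = (fun x => -1 * complex.Im (f (sval x))).
  by apply/funext => x; rewrite E'.
have -> : (fun x : su2 R => complex.Re (conjc (f (sval x)))) = (fun x => complex.Re (f (sval x))).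
  by apply/funext => x; rewrite E.
by rewrite smeanZ // mulN1r.
Qed.

Definition pairc f g : C := pair f (fun x => conjc (g x)).

Lemma pairc_lin f g h (c d : C) : smooth f -> smooth g -> smooth h ->
  pairc f (fun x => c * g x + d * h x) = conjc c * pairc f g + conjc d * pairc f h.
Proof.
move=> sf sg sh; have cg := smooth_conj sg; have ch := smooth_conj sh.
rewrite /pairc (pairC f) (pairC f (fun x => conjc (g x))) (pairC f (fun x => conjc (h x))).
have -> : (fun x => conjc (c * g x + d * h x)) =
   (fun x => conjc c * conjc (g x) + conjc d * conjc (h x)).
  by apply/funext => x; rewrite conjcD !conjcM.
rewrite pairDl //; last exact: smoothZ.
by congr (_ + _); rewrite !pairE -ImeanZ; [congr Imean; apply/funext => x; rewrite mulrA|exact: smoothM].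
Qed.

Lemma pairc0 f g : smooth f -> (forall x, g x = 0) -> pairc f g = 0.
Proof.
move=> sf g0; have s0 : smooth ((fun=> 0) : M2 -> C) by apply: smooth_cst.
have -> : g = (fun x => 0 * 0 + 0 * 0) by apply/funext => x; rewrite g0 mul0r addr0.
by rewrite pairc_lin // conjc0 !mul0r addr0.
Qed.

Lemma herm_bform w k s J al be ga : (forall i, smooth (w i)) ->
  herm w (bform k s J al be ga) = al%:C * pairc (w i0) (ecoef k s J.+1) +
    be%:C * (iC R / 2 * pairc (w i1) (ecoef k s J) - 2^-1 * pairc (w i2) (ecoef k s J)) +
    ga%:C * (iC R / 2 * pairc (w i1) (ecoef k s J.+2) + 2^-1 * pairc (w i2) (ecoef k s J.+2)).
Proof.
move=> sw; have se n := smooth_ecoef R k s n.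
have [E0 E1 E2] := bformE k s J al be ga.
rewrite /herm bilE /fconj -!/(pairc _ _).
transitivity (pairc (w i0) (bform k s J al be ga i0) + pairc (w i1) (bform k s J al be ga i1) +
  pairc (w i2) (bform k s J al be ga i2)); first by [].
rewrite E0 E1 E2 !pairc_lin //.
have -> : pairc (w i0) (fun x => al%:C * ecoef k s J.+1 x) = al%:C * pairc (w i0) (ecoef k s J.+1).
  have -> : (fun x => al%:C * ecoef k s J.+1 x) = (fun x => al%:C * ecoef k s J.+1 x + 0 * ecoef k s J.+1 x).
    by apply/funext => x; rewrite mul0r addr0.
  rewrite pairc_lin // conjc0 mul0r addr0; congr (_ * _).
  by apply/eqP; rewrite eq_complex /= oppr0 !eqxx.
have c2 : conjc (2^-1 : C) = 2^-1 by rewrite conjc_inv conjc_nat.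
have cI : conjc (iC R) = - iC R by apply/eqP; rewrite eq_complex /= oppr0 !eqxx.
have cR (t : R) : conjc t%:C = t%:C by apply/eqP; rewrite eq_complex /= oppr0 !eqxx.
rewrite !conjcM !conjcN !conjcM !cR c2 cI.
move: (pairc _ _) (pairc _ _) (pairc _ _) (pairc _ _) (pairc _ _) => *.
by ring.
Qed.

(** In each block, orthogonality to the eigenforms is orthogonality of a coordinate vector to all
    valid eigenvectors, so [eig_vec_sep] makes it 0. All components are then orthogonal to all
    matrix coefficients. *)
Lemma herm_eig_form_complete w : (forall i, smooth (w i)) ->
  (forall k J s l, (J < k.+3)%N -> (s <= k)%N -> eig_valid k l J ->
     herm w (eig_form a b k l J s) = 0) ->
  forall x, SU2 x -> forall i, w i x = 0.
Proof.
move=> sw H.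
have K k s J : (J < k.+3)%N -> (s <= k)%N ->
   [/\ pairc (w i0) (ecoef k s J.+1) = 0,
     iC R / 2 * pairc (w i1) (ecoef k s J) - 2^-1 * pairc (w i2) (ecoef k s J) = 0 &
     iC R / 2 * pairc (w i1) (ecoef k s J.+2) + 2^-1 * pairc (w i2) (ecoef k s J.+2) = 0].
  move=> Jk sk; apply: (eig_vec_sep a0 b0 Jk).
  - move=> JJ; apply: pairc0 => // x; case: J JJ {Jk} => [|J] // JJ.
    by rewrite /ecoef mcoef_high //; lia.
  - move=> JJ; have e0 x : ecoef k s J x = 0 by case: J JJ {Jk} => [|[|J]].
    by rewrite !pairc0 // !mulr0 subr0.
  - rewrite -ltnNge => kJ; have e0 x : ecoef k s J.+2 x = 0 by rewrite /ecoef mcoef_high.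
    by rewrite !pairc0 // !mulr0 addr0.
  - move=> l V; have := H k J s l Jk sk V; rewrite /eig_form herm_bform //.
have nI : iC R != 0.
  by apply/eqP => I0; have := iC_sq R; rewrite I0 mul0r => /eqP; rewrite eq_sym oppr_eq0 oner_eq0.
have n2 : (2 : C) != 0 by rewrite pnatr_eq0.
have Z k s j i : (s <= k)%N -> (j <= k)%N -> pairc (w i) (mcoef k s j) = 0.
  move=> sk jk.
  (* The coefficient of index j is the middle function of block j + 1, the first of block j + 2 and
     the last of block j; the latter two give independent combinations of the pairings of w_1 and
     w_2. *)
  have [Z0 _ _] := K k s j.+1 ltac:(lia) sk.
  have [_ Z1 _] := K k s j.+2 ltac:(lia) sk.
  have [_ _ Z2] := K k s j ltac:(lia) sk.
  move: Z0 Z1 Z2; rewrite /ecoef -!/(mcoef k s j) => Z0 Z1 Z2.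
  have P1 : pairc (w i1) (mcoef k s j) = 0.
    apply: (mulfI nI); rewrite mulr0 -[RHS](addr0 0) -{1}Z1 -Z2.
    by move: (pairc _ _) (pairc _ _) => u v; field.
  have P2 : pairc (w i2) (mcoef k s j) = 0.
    rewrite -[RHS](subr0 0) -{1}Z2 -Z1.
    by move: (pairc _ _) (pairc _ _) => u v; field.
  by case: (ord3P i) => ->.
move=> x xS i; have sc := smooth_conj (sw i).
have : conjc (w i x) = 0.
  apply: (mcoef_complete sc) xS => k s j sk jk.
  rewrite -[RHS]conjc0 -(Z k s j i sk jk) /pairc pairE -Imean_conj.
    by congr Imean; apply/funext => y; rewrite conjcM conjcK.
  by apply: smoothM => //; apply: smooth_conj; apply: smooth_mcoef.
by move=> /(congr1 (@conjc R)); rewrite conjcK conjc0.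
Qed.

End Complete.

(** * Dimensions of the eigenspaces *)

Section Dimension.
Variables (R : realType) (G : framedGroup R).
Local Notation C := R[i].

Lemma has_dim_seq (T : eqType) (r : seq T) (B : T -> form1 G) (E : form1 G -> Prop) :
  uniq r -> (forall t, t \in r -> E (B t)) ->
  (forall c : T -> C, eq1 (fun i x => \sum_(t <- r) c t * B t i x) (fun _ _ => 0) ->
     forall t, t \in r -> c t = 0) ->
  (forall w, E w -> exists c : T -> C, eq1 w (fun i x => \sum_(t <- r) c t * B t i x)) ->
  has_dim E (size r).
Proof.
move=> ur EB free span; pose B' (l : 'I_(size r)) := B (tnth (in_tuple r) l).
have S (c : T -> C) i x : \sum_(t <- r) c t * B t i x =
    \sum_(l < size r) c (tnth (in_tuple r) l) * B' l i x by rewrite big_tnth.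
exists B'; split.
- by move=> l; apply: EB; apply: mem_tnth.
- move=> c c0 l.
  (* Coefficients given by position become coefficients by label. *)
  pose c' t := if insub (index t r) is Some l then c l else 0.
  have c'E l' : c' (tnth (in_tuple r) l') = c l'.
    rewrite /c' (tnth_nth (tnth (in_tuple r) l')) /= index_uniq // valK //.
  rewrite -c'E; apply: free; last exact: mem_tnth.
  move=> x xG i; rewrite S; apply: etrans (c0 x xG i); apply: eq_bigr => l' _.
  by rewrite c'E.
- move=> w /span[c wE]; exists (fun l => c (tnth (in_tuple r) l)) => x xG i.
  by rewrite wE // S.
Qed.

End Dimension.

(** * The finite list of eigenforms with a given eigenvalue *)

Section Indices.
Variables (R : realType) (a b : R).
Hypotheses (a0 : 0 < a) (b0 : 0 < b).
Local Notation C := R[i].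
Local Notation M2 := 'M[C]_2.
Local Notation G := (gSU2 a0 b0 b0).

Notation index := ((nat * nat) * (nat * nat))%type.

Definition eig_index (N : nat) : seq index :=
  [seq (kJ, sl) | kJ <- [seq (k, J) | k <- index_iota 0 N, J <- index_iota 0 k.+3],
                  sl <- [seq (s, l) | s <- index_iota 0 kJ.1.+1, l <- index_iota 0 4]].

Definition eig_select (P : pred nat) (lambda : C) (r : index) : bool :=
  [&& P r.1.1, eig_valid r.1.1 r.2.2 r.1.2 & (eig_mu a b r.1.1 r.2.2 r.1.2)%:C == lambda].

Definition eig_list P lambda N := [seq r <- eig_index N | eig_select P lambda r].

Definition eig_base (r : index) : form1 G := eig_form a b r.1.1 r.2.2 r.1.2 r.2.1.

Lemma uniq_eig_list P lambda N : uniq (eig_list P lambda N).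
Proof.
apply: filter_uniq; apply: allpairs_uniq_dep => //.
- apply: allpairs_uniq_dep => //; first exact: iota_uniq.
    by move=> *; apply: iota_uniq.
  by move=> [? ?] [? ?] _ _ [-> ->].
- by move=> *; apply: allpairs_uniq; rewrite ?iota_uniq // => [[? ?] [? ?]] _ _ [-> ->].
- by move=> [? ?] [? ?] _ _ [-> ->].
Qed.

Lemma mem_eig_index N k J s l : (((k, J), (s, l)) \in eig_index N) =
  [&& (k < N)%N, (J < k.+3)%N, (s <= k)%N & (l < 4)%N].
Proof.
apply/allpairsPdep/and4P.
  case=> [[k' J'] [[s' l'] [/allpairsPdep[k1 [J1 [kN Jk [-> ->]]]] /allpairsPdep[s1 [l1 [sk l4 [-> ->]]]] ]]].
  by case=> -> -> -> ->; move: kN Jk sk l4; rewrite !mem_index_iota !leq0n ltnS.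
case=> kN Jk sk l4; exists (k, J), (s, l); split => //; apply/allpairsPdep.
  by exists k, J; rewrite !mem_index_iota.
by exists s, l; rewrite !mem_index_iota.
Qed.

Lemma big_eig_list (V : nmodType) (F : index -> V) P lambda N :
  \sum_(r <- eig_list P lambda N) F r =
  \sum_(0 <= k < N) \sum_(0 <= J < k.+3) \sum_(0 <= s < k.+1) \sum_(0 <= l < 4)
    (if eig_select P lambda ((k, J), (s, l)) then F ((k, J), (s, l)) else 0).
Proof.
rewrite big_filter big_mkcond /eig_index !big_allpairs_dep.
by apply: eq_bigr => k _; apply: eq_bigr => J _; rewrite big_allpairs_dep.
Qed.

Lemma size_eig_list P lambda N : size (eig_list P lambda N) =
  (\sum_(0 <= k < N | P k) count_mem lambda [seq r%:C | r <- spec1 a b k])%N.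
Proof.
rewrite -sum1_size big_eig_list [RHS]big_mkcond; apply: eq_bigr => k _.
case: ifP => Pk; last first.
  rewrite big1 // => J _; rewrite big1 // => s _; rewrite big1 // => l _.
  by rewrite /eig_select Pk.
rewrite eig_count //; apply: eq_bigr => J _; apply: eq_bigr => s _; apply: eq_bigr => l _.
by rewrite /eig_select Pk /=; case: ifP.
Qed.

Lemma eig_list_sum P lambda N (c : index -> C) i x :
  \sum_(r <- eig_list P lambda N) c r * eig_base r i x =
  eig_sum a b N (fun k J s l => if eig_select P lambda ((k, J), (s, l))
    then c ((k, J), (s, l)) else 0) i x.
Proof.
rewrite big_eig_list; apply: eq_bigr => k _; apply: eq_bigr => J _; apply: eq_bigr => s _.
rewrite [RHS]big_mkcond; apply: eq_bigr => l _.
case: ifP => [/and3P[_ /= -> _]|_] //.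
by rewrite mul0r if_same.
Qed.

Lemma eig_list_free P lambda N k0 (c : index -> C) :
  (forall i, weight_fun k0 (fun x => \sum_(r <- eig_list P lambda N) c r * eig_base r i x)) ->
  forall r, r \in eig_list P lambda N -> r.1.1 != k0 -> c r = 0.
Proof.
move=> W [[k J] [s l]]; rewrite mem_filter mem_eig_index => /andP[S /and4P[kN Jk sk l4]] kk0.
have V : eig_valid k l J by case/and3P: S.
have H := @eig_free _ _ _ a0 b0 N k0 (fun k J s l => if eig_select P lambda ((k, J), (s, l))
    then c ((k, J), (s, l)) else 0) _ k J s l kN kk0 Jk sk V.
rewrite /= S in H; apply: H => i; have [be wE] := W i; exists be => x xS.
by rewrite -wE // eig_list_sum.
Qed.

Lemma eig_list_independent P lambda N (c : index -> C) :
  (forall x, SU2 x -> forall i, \sum_(r <- eig_list P lambda N) c r * eig_base r i x = 0) ->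
  forall r, r \in eig_list P lambda N -> c r = 0.
Proof.
(* The weight [N] exceeds all weights in the list, so no term escapes. *)
move=> W r rL; apply: (eig_list_free (k0 := N) _ rL).
  move=> i; have [be E] := weight_fun0 R N; exists be => x xS.
  by rewrite W // -E.
move: rL; case: r => [[k J] [s l]]; rewrite mem_filter mem_eig_index => /andP[_ /and4P[kN _ _ _]].
by rewrite ltn_eqF.
Qed.

Lemma eig_list_eigen P lambda N r : r \in eig_list P lambda N -> eigenform lambda (eig_base r).
Proof.
case: r => [[k J] [s l]]; rewrite mem_filter mem_eig_index => /andP[/and3P[_ V /eqP <-] /and4P[_ _ sk _]].
split; first by move=> i; apply: smooth_eig_form.
by move=> x xS i; rewrite /eig_base eig_formP.
Qed.

Definition eig_bounded (lambda : C) (N : nat) : Prop := forall k l J, (N <= k)%N ->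
  eig_valid k l J -> (eig_mu a b k l J)%:C != lambda.

(** After subtraction of the projection, the remainder is orthogonal to the listed forms by
    construction and to all others because their eigenvalue differs. By [eig_bounded] the list
    misses no eigenform of eigenvalue [lambda]. *)
Lemma eigenform_span lambda N (w : form1 G) : eig_bounded lambda N -> eigenform lambda w ->
  exists c : index -> C,
    eq1 w (fun i x => \sum_(r <- eig_list predT lambda N) c r * eig_base r i x).
Proof.
move=> NP [sw Ew]; have sB (r : index) i : smooth (eig_base r i) by apply: smooth_eig_form.
have [c cP] := gram_schmidt (uniq_eig_list predT lambda N) sB sw; exists c.
pose w' : 'I_3 -> M2 -> C := fun i x =>
  w i x + -1 * \sum_(r <- eig_list predT lambda N) c r * eig_base r i x.
have ss i : smooth (fun x => \sum_(r <- eig_list predT lambda N) c r * eig_base r i x).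
  by apply: smooth_sum => r; apply: smoothZ.
have sw' i : smooth (w' i) by apply: smoothD => //; apply: smoothZ.
suff W : forall x, SU2 x -> forall i, w' i x = 0.
  move=> x xS i; have := W x xS i; rewrite /w' mulN1r => /eqP.
  by rewrite subr_eq0 => /eqP.
apply: (herm_eig_form_complete a0 b0 sw') => k J s l Jk sk V.
have [E|ne] := eqVneq (eig_mu a b k l J)%:C lambda.
  have kN : (k < N)%N by rewrite ltnNge; apply/negP => Nk; move: (NP k l J Nk V); rewrite E eqxx.
  apply: (cP ((k, J), (s, l))); rewrite mem_filter mem_eig_index /eig_select /= V E eqxx kN Jk sk.
  by case: (l) V => [|[|[|[|]]]].
rewrite /w' herm_lin //; last by move=> i; apply: smooth_eig_form.
have ev i x := eig_formP (a0 := a0) (b0 := b0) i x V sk.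
have sb := smooth_eig_form a b k l J s.
rewrite (herm_eigen (a0 := a0) (b0 := b0) sw sb Ew ev) 1?eq_sym // herm_sum // big_seq big1 ?mulr0 ?addr0 //.
move=> r rL; have [sr Er] := eig_list_eigen rL.
by rewrite (herm_eigen (a0 := a0) (b0 := b0) sr sb Er ev) ?mulr0 // eq_sym.
Qed.

Lemma eigenform_SU2_dim lambda N : eig_bounded lambda N ->
  has_dim (eigenform (G := G) lambda) (size (eig_list predT lambda N)).
Proof.
move=> NP; apply: (has_dim_seq (B := eig_base)).
- exact: uniq_eig_list.
- by move=> r; apply: eig_list_eigen.
- by move=> c c0; apply: eig_list_independent.
- by move=> w; apply: eigenform_span.
Qed.

Lemma isotypic_eigenform_dim k lambda : exists N, [/\ (k < N)%N, eig_bounded lambda N &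
  has_dim (fun w => @isotypic R a b b a0 b0 b0 k w /\ eigenform lambda w)
    (size (eig_list (pred1 k) lambda N))].
Proof.
have [N1 NP1] := eig_bound a0 b0 lambda; exists (maxn N1 k.+1).
have NP : eig_bounded lambda (maxn N1 k.+1).
  by move=> k' l J; rewrite geq_max => /andP[Nk _]; apply: NP1.
split=> //; first by rewrite leq_max ltnSn orbT.
apply: (has_dim_seq (B := eig_base)).
- exact: uniq_eig_list.
- move=> r rL; split; last exact: eig_list_eigen rL.
  move: rL; case: r => [[k' J] [s l]]; rewrite mem_filter mem_eig_index.
  move=> /andP[/and3P[/= /eqP -> _ _] /and4P[_ _ sk _]].
  by apply: isotypic_bform; move: sk.
- by move=> c c0; apply: eig_list_independent.
- move=> w [iw Ew]; have [c wE] := eigenform_span NP Ew; exists c => x xS i.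
  rewrite wE // /eig_list !big_filter [LHS]big_seq_cond [RHS]big_seq_cond.
  rewrite (bigID (fun r : index => r.1.1 == k)) /= [X in _ + X]big1 ?addr0.
    by apply: eq_bigl => r; rewrite /eig_select /= -andbA; congr (_ && _); rewrite andbC.
  move=> r /andP[/andP[rI rS] rk].
  have W j : weight_fun k (fun x => \sum_(r <- eig_list predT lambda (maxn N1 k.+1)) c r * eig_base r j x).
    have [be E] := isotypic_weight j iw; exists be => y yS.
    by rewrite -E // wE.
  by rewrite (eig_list_free W) ?mul0r // mem_filter rS.
Qed.

End Indices.

(** * The covering of SO(3) *)

Section Adjoint.
Variables (R : realType).
Local Notation C := R[i].
Local Notation M2 := 'M[C]_2.
Local Notation M3 := 'M[C]_3.
Implicit Types (x y z v : M2).

(** Coefficients of the functionals dual to E_1, E_2, E_3 that vanish on scalar matrices. *)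
Definition crdE_coef (j : 'I_3) : M2 :=
  nth 0 [:: mx22 (- (iC R / 2)) 0 0 (iC R / 2); mx22 0 2^-1 (- 2^-1) 0;
            mx22 0 (- (iC R / 2)) (- (iC R / 2)) 0] j.

(* The coordinates of the traceless part in the basis [suE]. *)
Definition crdE (j : 'I_3) y : C := \sum_p \sum_q crdE_coef j p q * y p q.

Lemma crdE_lin j (c : C) y z : crdE j (c *: y + z) = c * crdE j y + crdE j z.
Proof.
rewrite /crdE mulr_sumr -big_split; apply: eq_bigr => p _ /=.
rewrite mulr_sumr -big_split; apply: eq_bigr => q _ /=.
by rewrite !mxE; ring.
Qed.

Lemma crdE0 j : crdE j 0 = 0.
Proof. by rewrite /crdE big1 // => p _; rewrite big1 // => q _; rewrite mxE mulr0. Qed.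

Lemma crdE_sum j (I : finType) (c : I -> C) (Y : I -> M2) :
  crdE j (\sum_l c l *: Y l) = \sum_l c l * crdE j (Y l).
Proof.
have H (r : seq I) : crdE j (\sum_(l <- r) c l *: Y l) = \sum_(l <- r) c l * crdE j (Y l).
  elim: r => [|l r IH]; first by rewrite !big_nil crdE0.
  by rewrite !big_cons crdE_lin IH.
exact: H.
Qed.

Lemma crdE_decomp y : y = ((y o0 o0 + y o1 o1) / 2)%:M + \sum_j crdE j y *: suE R j.
Proof.
have n2 : (2 : C) != 0 by rewrite pnatr_eq0.
have I := iC_sq R.
have iCE : (0 : R) +i* 1 = iC R by [].
have iCN : (0 : R) -i* 1 = - iC R by apply/eqP; rewrite eq_complex /= oppr0 !eqxx.
rewrite !big_ord_recl big_ord0 /crdE !sum2 /crdE_coef /suE /=.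
apply/mx2P; rewrite !mxE /= ?iCE ?iCN; move: (iC R) I => ii I.
- by field: I.
- by field: I.
- by field: I.
- by field: I.
Qed.

Lemma suE_trace l : suE R l o0 o0 + suE R l o1 o1 = 0.
Proof.
case: l => [[|[|[|l]]] Hl] //; rewrite /suE /= !mxE /=.
- by apply/eqP; rewrite eq_complex /= addr0 subrr !eqxx.
- by rewrite addr0.
- by rewrite addr0.
Qed.

Lemma adj2_suE l : adj2 (suE R l) = - suE R l.
Proof.
have H := suE_trace l; have H0 : suE R l o0 o0 = - suE R l o1 o1.
  by apply/eqP; rewrite -subr_eq0 opprK H.
by apply/mx2P; rewrite /adj2 !mxE /= ?H0 ?opprK.
Qed.

(** With [adj2] in place of the inverse, the adjoint representation extends to all matrices as a
    quadratic polynomial map. *)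
Definition Ad x : M3 := \matrix_(j, l) crdE j (x *m suE R l *m adj2 x).

Lemma conj_trace x e : (x *m e *m adj2 x) o0 o0 + (x *m e *m adj2 x) o1 o1 =
  \det x * (e o0 o0 + e o1 o1).
Proof.
have T (y : M2) : y o0 o0 + y o1 o1 = \tr y by rewrite /mxtrace sum2.
rewrite !T mxtrace_mulC mulmxA.
have -> : adj2 x *m x = (\det x)%:M by rewrite -{2}(adj2K x) mul_adj2 det_adj2.
by rewrite mul_scalar_mx mxtraceZ.
Qed.

Lemma Ad_action x l : x *m suE R l *m adj2 x = \sum_j Ad x j l *: suE R j.
Proof.
rewrite [LHS]crdE_decomp conj_trace suE_trace mulr0 mul0r raddf0 add0r.
by apply: eq_bigr => j _; rewrite mxE.
Qed.

Lemma Ad_mul x y : Ad (x *m y) = Ad x *m Ad y.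
Proof.
apply/matrixP => j l; rewrite !mxE adj2M.
have -> : x *m y *m suE R l *m (adj2 y *m adj2 x) =
    x *m (y *m suE R l *m adj2 y) *m adj2 x by rewrite !mulmxA.
rewrite Ad_action mulmx_sumr mulmx_suml.
under eq_bigr do rewrite -scalemxAr -scalemxAl.
by rewrite crdE_sum; apply: eq_bigr => m _; rewrite [in RHS]mxE mulrC.
Qed.

Lemma Ad_opp x : Ad (- x) = Ad x.
Proof.
apply/matrixP => j l; rewrite !mxE; congr crdE.
have -> : adj2 (- x) = - adj2 x by apply/mx2P; rewrite /adj2 !mxE /=.
by rewrite mulmxN !mulNmx opprK.
Qed.

Lemma is_rd_adj2 p q v x : is_rd (fun y : M2 => adj2 y p q) v x (adj2 v p q).
Proof.
have N i j : is_rd (fun y : M2 => - y i j) v x (- v i j).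
  have := is_rdM (is_rd_cst (-1) v x) (is_rd_entry i j v x).
  by rewrite mul0r add0r mulN1r; under eq_fun do rewrite mulN1r.
case: (ord2P p) => ->; case: (ord2P q) => ->; rewrite /adj2 !mxE /=;
  (under eq_fun do rewrite mxE /=); first [exact: is_rd_entry|exact: N].
Qed.

Lemma smooth_adj2 p q : smooth (fun y : M2 => adj2 y p q).
Proof.
have H (f : M2 -> C) : smooth f -> (forall y, adj2 y p q = f y) -> smooth (fun y => adj2 y p q).
  by move=> sf E; rewrite (_ : (fun y => _) = f) //; apply/funext.
case: (ord2P p) H => ->; case: (ord2P q) => -> H.
- by apply: (H _ (smooth_entry R o1 o1)) => y; rewrite /adj2 mxE.
- by apply: (H _ (smoothN (smooth_entry R o0 o1))) => y; rewrite /adj2 mxE.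
- by apply: (H _ (smoothN (smooth_entry R o1 o0))) => y; rewrite /adj2 mxE.
- by apply: (H _ (smooth_entry R o0 o0)) => y; rewrite /adj2 mxE.
Qed.

Lemma smooth_Ad j l : smooth (fun x => Ad x j l).
Proof.
rewrite (_ : (fun x => _) = (fun x => \sum_p \sum_q crdE_coef j p q *
   (\sum_r (\sum_s x p s * suE R l s r) * adj2 x r q))).
  apply: smooth_sum => p; apply: smooth_sum => q; apply: smoothZ.
  apply: smooth_sum => r; apply: smoothM; last exact: smooth_adj2.
  by apply: smooth_sum => s; apply: smoothM; [exact: smooth_entry|exact: smooth_cst].
apply/funext => x; rewrite mxE /crdE; apply: eq_bigr => p _; apply: eq_bigr => q _.
by congr (_ * _); rewrite mxE; apply: eq_bigr => r _; rewrite mxE.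
Qed.

Lemma is_rd_Ad j l v x : is_rd (fun y => Ad y j l) v x
  (crdE j (v *m suE R l *m adj2 x + x *m suE R l *m adj2 v)).
Proof.
rewrite (_ : (fun x => _) = (fun x => \sum_p \sum_q crdE_coef j p q *
   (\sum_r (\sum_s x p s * suE R l s r) * adj2 x r q))); last first.
  apply/funext => y; rewrite mxE /crdE; apply: eq_bigr => p _; apply: eq_bigr => q _.
  by congr (_ * _); rewrite mxE; apply: eq_bigr => r _; rewrite mxE.
rewrite /crdE; apply: is_rd_sum => p; apply: is_rd_sum => q.
have H : is_rd (fun x0 : M2 => \sum_r (\sum_s x0 p s * suE R l s r) * adj2 x0 r q) v x
   ((v *m suE R l *m adj2 x + x *m suE R l *m adj2 v) p q).
  rewrite !mxE -big_split /=; apply: is_rd_sum => r.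
  have H2 : is_rd (fun x0 : M2 => \sum_s x0 p s * suE R l s r) v x ((v *m suE R l) p r).
    rewrite mxE; apply: is_rd_sum => s.
    have := is_rdM (is_rd_entry p s v x) (is_rd_cst (suE R l s r) v x).
    by rewrite mulr0 addr0.
  have -> : (x *m suE R l) p r = \sum_s x p s * suE R l s r by rewrite mxE.
  exact: is_rdM H2 (is_rd_adj2 r q v x).
have := is_rdM (is_rd_cst (crdE_coef j p q) v x) H.
by rewrite mul0r add0r.
Qed.

(** The differential of Ad takes the left-invariant field of E_i to that of ad (E_i), whose matrix
    is [soE i]; hence Ad relates the frames of the two groups. *)
Lemma is_rd_Ad_suE (c : R) i j l x :
  is_rd (fun y => Ad y j l) (x *m (c%:C *: suE R i)) x ((Ad x *m (c%:C *: soE R i)) j l).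
Proof.
have := is_rd_Ad j l (x *m (c%:C *: suE R i)) x.
suff -> : crdE j (x *m (c%:C *: suE R i) *m suE R l *m adj2 x +
   x *m suE R l *m adj2 (x *m (c%:C *: suE R i))) = (Ad x *m (c%:C *: soE R i)) j l by [].
have -> : adj2 (x *m (c%:C *: suE R i)) = - (c%:C *: suE R i) *m adj2 x.
  have Z y : adj2 (c%:C *: y) = c%:C *: adj2 y by apply/mx2P; rewrite /adj2 !mxE /= ?mulrN.
  by rewrite adj2M Z adj2_suE scalerN.
have -> : x *m (c%:C *: suE R i) *m suE R l *m adj2 x + x *m suE R l *m (- (c%:C *: suE R i) *m adj2 x)
  = \sum_m (c%:C * soE R i m l) *: (x *m suE R m *m adj2 x).
  transitivity (x *m (c%:C *: (suE R i *m suE R l - suE R l *m suE R i)) *m adj2 x).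
    rewrite scalerBr mulmxBr mulmxBl mulNmx mulmxN !mulmxA; congr (_ - _).
      by rewrite -!scalemxAr -!scalemxAl !mulmxA.
    by rewrite -!scalemxAr -!scalemxAl !mulmxA.
  rewrite soE_ad scaler_sumr mulmx_sumr mulmx_suml; apply: eq_bigr => m _.
  by rewrite scalerA -scalemxAr -scalemxAl.
rewrite crdE_sum -scalemxAr !mxE mulr_sumr; apply: eq_bigr => m _.
by rewrite !mxE; ring.
Qed.

End Adjoint.

(** * Pullback by a map relating two frames *)

Section Pullback.
Variables (R : realType) (G H : framedGroup R).
Local Notation C := R[i].
Variable Q : 'M[C]_((deg G).+1) -> 'M[C]_((deg H).+1).
Hypothesis Q_struct : forall i j k, struct G i j k = struct H i j k.
Hypothesis Q_lfield : forall i (f : form0 H) x, smooth f ->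
  lfield (G := G) i (fun y => f (Q y)) x = lfield (G := H) i f (Q x).

Lemma smooth_lfield i (f : form0 H) : smooth f -> smooth (lfield (G := H) i f).
Proof.
move=> sf; apply: smooth_lderiv => // p q.
rewrite (_ : (fun x => _) = (fun x : 'M[C]_((deg H).+1) => \sum_s x p s * frame H i s q)).
  by apply: smooth_sum => s; apply: smoothM; [exact: smooth_entry|exact: smooth_cst].
by apply/funext => x; rewrite mxE.
Qed.

Definition pull1 (w : form1 H) : form1 G := fun i x => w i (Q x).

Lemma smooth_d1 (w : form1 H) i j : smooth1 w -> smooth (d1 w i j).
Proof.
move=> sw; apply: smoothB; first by apply: smoothB; apply: smooth_lfield.
by apply: smooth_sum => l; apply: smoothZ.
Qed.

Lemma smooth_star2 (h : form2 H) k : (forall i j, smooth (h i j)) -> smooth (star2 h k).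
Proof.
move=> sh; apply: smoothZ; apply: smooth_sum => i; apply: smooth_sum => j.
by apply: smoothZ.
Qed.

Lemma smooth_star1 (w : form1 H) i j : smooth1 w -> smooth (star1 w i j).
Proof. by move=> sw; apply: smooth_sum => k; apply: smoothZ. Qed.

Lemma smooth_delta1 (w : form1 H) : smooth1 w -> smooth (delta1 w).
Proof.
move=> sw; apply: smoothN; rewrite /star3 /d2.
have sL i j k : smooth (lfield i (star1 w j k)) by apply: smooth_lfield; apply: smooth_star1.
have sS i j k : smooth (fun x => \sum_l (struct H i j l)%:C * star1 w l k x).
  by apply: smooth_sum => l; apply: smoothZ; apply: smooth_star1.
by apply: smoothB => //; apply: smoothD => //; apply: smoothB => //; apply: smoothD => //; apply: smoothB.
Qed.

Lemma pull_d1 (w : form1 H) i j x : smooth1 w -> d1 (pull1 w) i j x = d1 w i j (Q x).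
Proof.
move=> sw; rewrite /d1 !Q_lfield //; congr (_ - _).
by apply: eq_bigr => l _; rewrite Q_struct.
Qed.

Lemma pull_delta1 (w : form1 H) x : smooth1 w -> delta1 (pull1 w) x = delta1 w (Q x).
Proof.
move=> sw; rewrite /delta1 /star3 /d2.
have E i j : star1 (pull1 w) i j = (fun x => star1 w i j (Q x)) by [].
have L i j k : lfield i (star1 (pull1 w) j k) x = lfield i (star1 w j k) (Q x).
  by rewrite E Q_lfield //; apply: smooth_star1.
have S i j k : \sum_l (struct G i j l)%:C * star1 (pull1 w) l k x =
    \sum_l (struct H i j l)%:C * star1 w l k (Q x).
  by apply: eq_bigr => l _; rewrite Q_struct.
by rewrite !L !S.
Qed.

Lemma pull_star2_d1 (w : form1 H) : smooth1 w ->
  star2 (d1 (pull1 w)) = pull1 (star2 (d1 w)).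
Proof.
move=> sw; apply/funext => k; apply/funext => x; rewrite /star2 /pull1; congr (_ * _).
by apply: eq_bigr => i _; apply: eq_bigr => j _; rewrite pull_d1.
Qed.

(** In the frames the Laplacian is built from the fields and the structure constants alone, and both
    correspond under [Q]. *)
Lemma pull_Delta1 (w : form1 H) i x : smooth1 w -> Delta1 (pull1 w) i x = Delta1 w i (Q x).
Proof.
move=> sw; have sd : smooth1 (star2 (d1 w)).
  by move=> k; apply: smooth_star2 => p q; apply: smooth_d1.
have E1 : d0 (delta1 (pull1 w)) i x = d0 (delta1 w) i (Q x).
  have E : delta1 (pull1 w) = (fun y => delta1 w (Q y)).
    by apply/funext => y; apply: pull_delta1.
  by rewrite /d0 E; apply: Q_lfield; apply: smooth_delta1.
have E2 : delta2 (d1 (pull1 w)) i x = delta2 (d1 w) i (Q x).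
  by rewrite /delta2 (pull_star2_d1 sw) (pull_star2_d1 sd).
by rewrite /Delta1 E1 E2.
Qed.

End Pullback.

(** * Descent of functions of even weight to SO(3) *)

Section SO3Pullback.
Variables (R : realType) (a b : R).
Hypotheses (a0 : 0 < a) (b0 : 0 < b).
Local Notation C := R[i].
Local Notation M2 := 'M[C]_2.
Local Notation M3 := 'M[C]_3.
Local Notation G := (gSU2 a0 b0 b0).
Local Notation H := (gSO3 a0 b0 b0).
Local Notation i0 := (ord0 : 'I_3).
Local Notation i1 := (inord 1 : 'I_3).
Local Notation i2 := (inord 2 : 'I_3).

Definition Ad_pull (w : form1 H) : form1 G := fun i x => w i (Ad x).

Lemma smooth_Ad_pull w : smooth1 w -> smooth1 (Ad_pull w).
Proof. by move=> sw i; apply: (smooth_comp (sw i)) => p q; apply: smooth_Ad. Qed.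

Lemma Ad_pull_Delta1 (w : form1 H) i x : smooth1 w ->
  Delta1 (Ad_pull w) i x = Delta1 w i (Ad x).
Proof.
apply: (@pull_Delta1 _ G H (@Ad R)) => // j f y sf.
apply: (rderiv_comp sf) => p q; exact: is_rd_Ad_suE.
Qed.

(** The fields are tangent to the group, so the Laplacian depends on restrictions only. It is needed
    because a descended form agrees with the original one on the group only. *)
Lemma Delta1_ext (w w' : form1 G) : smooth1 w -> smooth1 w' ->
  (forall x, SU2 x -> forall i, w i x = w' i x) ->
  forall x, SU2 x -> forall i, Delta1 w i x = Delta1 w' i x.
Proof.
move=> sw sw' E.
have Y i (f g : M2 -> C) : smooth f -> smooth g -> (forall x, SU2 x -> f x = g x) ->
    forall x, SU2 x -> Yop a b i f x = Yop a b i g x.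
  by move=> sf sg fg x xS; rewrite /Yop (suX_ext i sf sg fg xS).
have K (v v' : form1 G) : smooth1 v -> smooth1 v' -> (forall x, SU2 x -> forall i, v i x = v' i x) ->
    forall x, SU2 x -> forall i, ccurl a b v i x = ccurl a b v' i x.
  move=> sv sv' vE x xS i; have [C0 C1 C2] := ccurlE a b v x; have [D0 D1 D2] := ccurlE a b v' x.
  have L j k : Yop a b j (v k) x = Yop a b j (v' k) x by apply: Y => // y yS; apply: vE.
  have F3 (p p' q q' r r' c : C) : p = p' -> q = q' -> r = r' -> p - q - c * r = p' - q' - c * r'.
    by move=> -> -> ->.
  case: (ord3P i) => ->.
  - by rewrite C0 D0; apply: F3; [exact: L|exact: L|exact: vE].
  - by rewrite C1 D1; apply: F3; [exact: L|exact: L|exact: vE].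
  - by rewrite C2 D2; apply: F3; [exact: L|exact: L|exact: vE].
move=> x xS i.
have E1 : Yop a b i (cdiv a b w) x = Yop a b i (cdiv a b w') x.
  apply: (Y i _ _ (smooth_cdiv a b sw) (smooth_cdiv a b sw') _ x xS) => y yS.
  have L j : Yop a b j (w j) y = Yop a b j (w' j) y.
    by apply: Y => // z zS; apply: E.
  by rewrite /cdiv; move: (L i0) (L i1) (L i2) => -> -> ->.
have E2 : ccurl a b (ccurl a b w) i x = ccurl a b (ccurl a b w') i x.
  apply: (K _ _ (smooth_ccurl a b sw) (smooth_ccurl a b sw') _ x xS) => y yS j.
  exact: (K _ _ sw sw' E y yS).
by rewrite (Delta1E i x sw) (Delta1E i x sw') E1 E2.
Qed.

Definition lifts (f : M2 -> C) : Prop := exists2 g : M3 -> C, smooth g &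
  forall x, SU2 x -> f x = g (Ad x).

Lemma lifts_ext f g : (forall x, SU2 x -> f x = g x) -> lifts g -> lifts f.
Proof. by move=> E [h sh hE]; exists h => // x xS; rewrite E // hE. Qed.

Lemma lifts_cst c : lifts (fun=> c).
Proof. by exists (fun=> c) => //; apply: smooth_cst. Qed.

Lemma liftsD f g : lifts f -> lifts g -> lifts (fun x => f x + g x).
Proof.
move=> [f' sf fE] [g' sg gE]; exists (fun y => f' y + g' y); first exact: smoothD.
by move=> x xS; rewrite fE // gE.
Qed.

Lemma liftsM f g : lifts f -> lifts g -> lifts (fun x => f x * g x).
Proof.
move=> [f' sf fE] [g' sg gE]; exists (fun y => f' y * g' y); first exact: smoothM.
by move=> x xS; rewrite fE // gE.
Qed.

Lemma lifts_sum (I : Type) (r : seq I) (F : I -> M2 -> C) :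
  (forall i, lifts (F i)) -> lifts (fun x => \sum_(i <- r) F i x).
Proof.
move=> lF; elim: r => [|i r IH].
  by apply: (lifts_ext _ (lifts_cst 0)) => x _; rewrite big_nil.
by apply: (lifts_ext _ (liftsD (lF i) IH)) => x _; rewrite big_cons.
Qed.

Lemma lifts_Ad j l : lifts (fun x => Ad x j l).
Proof. by exists (fun y : M3 => y j l) => //; apply: smooth_entry. Qed.

(** Split [e] into a scalar, which conjugation fixes, and a combination of the E_l, whose conjugates
    have the entries of Ad as coordinates. *)
Lemma lifts_conj (e : M2) p q : lifts (fun x => (x *m e *m adj2 x) p q).
Proof.
pose c := (e o0 o0 + e o1 o1) / 2.
apply: (@lifts_ext _ (fun x => c * (1%:M : M2) p q +
   \sum_l (\sum_j crdE l e * suE R j p q * Ad x j l))); last first.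
  apply: liftsD; first exact: lifts_cst.
  apply: lifts_sum => l; apply: lifts_sum => j; apply: liftsM; [exact: lifts_cst|exact: lifts_Ad].
move=> x xS; rewrite {1}[e]crdE_decomp -/c mulmxDr mulmxDl mxE; congr (_ + _).
  by rewrite mul_mx_scalar -scalemxAl SU2_mulV // mxE.
rewrite mulmx_sumr mulmx_suml summxE; apply: eq_bigr => l _.
rewrite -scalemxAr -scalemxAl mxE Ad_action summxE mulr_sumr; apply: eq_bigr => j _.
by rewrite mxE; ring.
Qed.

(** For an elementary matrix e, the entries of x e adj(x) are products of an entry of x and one of
    adj(x), and the latter is an entry of x up to sign. So all quadratic monomials descend. *)
Lemma lifts_entries p q r s : lifts (fun x => x p q * x r s).
Proof.
have K p' q' r' s' : lifts (fun x => x p' q' * adj2 x r' s').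
  apply: (lifts_ext _ (lifts_conj (delta_mx q' r') p' s')) => x _.
  rewrite !mxE (bigD1 r') //= big1 ?addr0.
    rewrite mxE (bigD1 q') //= big1 ?addr0; first by rewrite !mxE !eqxx mulr1.
    by move=> k /negPf kq; rewrite mxE kq mulr0.
  move=> k /negPf kr; rewrite mxE big1 ?mul0r // => l _.
  by rewrite mxE kr andbF mulr0.
have N p' q' r' s' : lifts (fun x => -1 * (x p' q' * adj2 x r' s')).
  by apply: liftsM; [exact: lifts_cst|exact: K].
case: (ord2P r) => ->; case: (ord2P s) => ->.
- by apply: (lifts_ext _ (K p q o1 o1)) => x _; rewrite /adj2 [mx22 _ _ _ _ _ _]mxE.
- by apply: (lifts_ext _ (N p q o0 o1)) => x _; rewrite /adj2 [mx22 _ _ _ _ _ _]mxE /=; ring.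
- by apply: (lifts_ext _ (N p q o1 o0)) => x _; rewrite /adj2 [mx22 _ _ _ _ _ _]mxE /=; ring.
- by apply: (lifts_ext _ (K p q o0 o0)) => x _; rewrite /adj2 [mx22 _ _ _ _ _ _]mxE.
Qed.

Definition liftsP (P : M2 -> {poly C}) : Prop := forall j, lifts (fun x => (P x)`_j).

Lemma liftsPM P Q : liftsP P -> liftsP Q -> liftsP (fun x => P x * Q x).
Proof.
move=> lP lQ j; apply: (@lifts_ext _ (fun x => \sum_(i < j.+1) (P x)`_i * (Q x)`_(j - i))).
  by move=> x _; rewrite coefM.
by apply: lifts_sum => i; apply: liftsM.
Qed.

Lemma liftsPX P n : liftsP P -> liftsP (fun x => P x ^+ n).
Proof.
move=> lP; elim: n => [|n IH] j.
  by apply: (lifts_ext _ (lifts_cst (1 : {poly C})`_j)) => x _; rewrite expr0.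
by apply: (lifts_ext _ (liftsPM lP IH j)) => x _; rewrite exprS.
Qed.

Let linP (P : M2 -> {poly C}) : Prop := exists (p q r s : 'I_2), exists c d : nat -> C,
  forall j x, (P x)`_j = x p q * c j + x r s * d j.

Let linP_lifts P Q : linP P -> linP Q -> liftsP (fun x => P x * Q x).
Proof.
move=> [p [q [r [s [c [d PE]]]]]] [p' [q' [r' [s' [c' [d' QE]]]]]] j.
apply: (@lifts_ext _ (fun x => \sum_(i < j.+1) (x p q * x p' q' * (c i * c' (j - i)%N) +
   x p q * x r' s' * (c i * d' (j - i)%N) + x r s * x p' q' * (d i * c' (j - i)%N) +
   x r s * x r' s' * (d i * d' (j - i)%N)))).
  by move=> x _; rewrite coefM; apply: eq_bigr => i _; rewrite PE QE; ring.
apply: lifts_sum => i; do !apply: liftsD;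
  by apply: liftsM; [exact: lifts_entries|exact: lifts_cst].
Qed.

Let linP_Alin : linP (@Alin R).
Proof.
exists o1, o1, o1, o0, (fun j => (j == 0)%N%:R), (fun j => - (j == 1)%N%:R) => j x.
by rewrite /Alin coefB coefC coefZ coefX mulrN; case: eqP; rewrite ?mulr1 ?mulr0.
Qed.

Let linP_Blin : linP (@Blin R).
Proof.
exists o0, o1, o0, o0, (fun j => - (j == 0)%N%:R), (fun j => (j == 1)%N%:R) => j x.
by rewrite /Blin coefD coefN coefC coefZ coefX mulrN; case: eqP; rewrite ?mulr1 ?mulr0.
Qed.

(** An even number of linear factors can be grouped in pairs; if [s] is odd, so is k - s, and one
    mixed pair is split off. *)
Lemma lifts_mcoef k s j : ~~ odd k -> (s <= k)%N -> lifts (@mcoef R k s j).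
Proof.
move=> ek sk; rewrite /mcoef /mpol.
have LA n : ~~ odd n -> liftsP (fun x => Alin x ^+ n).
  move=> en i; rewrite -(even_halfK en) -mul2n.
  apply: (lifts_ext _ (liftsPX n./2 (linP_lifts linP_Alin linP_Alin) i)) => x _.
  by rewrite exprM expr2.
have LB n : ~~ odd n -> liftsP (fun x => Blin x ^+ n).
  move=> en i; rewrite -(even_halfK en) -mul2n.
  apply: (lifts_ext _ (liftsPX n./2 (linP_lifts linP_Blin linP_Blin) i)) => x _.
  by rewrite exprM expr2.
case: (boolP (odd s)) => os; last first.
  by apply: liftsPM; [apply: LA; rewrite oddB // (negPf ek) (negPf os)|exact: LB].
have oks : odd (k - s) by rewrite oddB // (negPf ek) os.
case: s os oks {sk} => // s os; case: (k - s.+1)%N => // n on.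
apply: (lifts_ext _ (liftsPM (linP_lifts linP_Alin linP_Blin) (liftsPM (LA n _) (LB s _)) j)) => //.
by move=> x _; rewrite !exprS mulrACA.
Qed.

Lemma lifts_ecoef k s J : ~~ odd k -> (s <= k)%N -> lifts (@ecoef R k s J).
Proof.
by case: J => [|[|J]]; [move=> _ _; exact: lifts_cst|move=> _ _; exact: lifts_cst|exact: lifts_mcoef].
Qed.

Lemma lifts_bform k s J al be ga i : ~~ odd k -> (s <= k)%N -> lifts (@bform R k s J al be ga i).
Proof.
move=> ek sk; have [E0 E1 E2] := bformE k s J al be ga.
have L c n : lifts (fun x : M2 => c * ecoef k s n x).
  by apply: liftsM; [exact: lifts_cst|exact: lifts_ecoef].
by case: (ord3P i) => ->; rewrite ?E0 ?E1 ?E2; try apply: liftsD; apply: L.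
Qed.

Lemma bform_opp k s J al be ga i x : (s <= k)%N ->
  @bform R k s J al be ga i (- x) = (-1) ^+ k * bform k s J al be ga i x.
Proof.
move=> sk.
have AN : Alin (- x) = - Alin x by rewrite /Alin !mxE polyCN scaleNr opprB opprK addrC.
have BN : Blin (- x) = - Blin x by rewrite /Blin !mxE polyCN scaleNr opprD.
have M n m : mpol n m (- x) = (-1) ^+ (n + m) *: mpol n m x.
  rewrite /mpol AN BN -[- Alin x]scaleN1r -[- Blin x]scaleN1r !exprZn.
  by rewrite -scalerAl -scalerAr scalerA exprD.
have m0 j : mcoef k s j (- x) = (-1) ^+ k * mcoef k s j x.
  by rewrite /mcoef M coefZ subnK.
have e0 n : ecoef k s n (- x) = (-1) ^+ k * ecoef k s n x.
  by case: n => [|[|n]]; rewrite /ecoef ?mulr0.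
have [E0 E1 E2] := bformE k s J al be ga.
by case: (ord3P i) => ->; rewrite ?E0 ?E1 ?E2 !e0; ring.
Qed.

End SO3Pullback.

(** * Surjectivity of the covering onto SO(3) *)

Section Rotations.
Variables (R : realType).
Local Notation C := R[i].
Local Notation M3 := 'M[R]_3.
Local Notation i0 := (ord0 : 'I_3).
Local Notation i1 := (inord 1 : 'I_3).
Local Notation i2 := (inord 2 : 'I_3).
Implicit Types y : M3.

(** Entries indexed by natural numbers compute by simplification. *)
Definition mx33 (f : nat -> nat -> R) : M3 := \matrix_(i, j) f i j.

Lemma mx33_eta y : y = mx33 (fun i j => y (inord i) (inord j)).
Proof. by apply/matrixP => i j; rewrite mxE !inord_val. Qed.

Lemma mx33P (f g : nat -> nat -> R) :
  [/\ f 0%N 0%N = g 0%N 0%N, f 0%N 1%N = g 0%N 1%N & f 0%N 2%N = g 0%N 2%N] ->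
  [/\ f 1%N 0%N = g 1%N 0%N, f 1%N 1%N = g 1%N 1%N & f 1%N 2%N = g 1%N 2%N] ->
  [/\ f 2%N 0%N = g 2%N 0%N, f 2%N 1%N = g 2%N 1%N & f 2%N 2%N = g 2%N 2%N] ->
  mx33 f = mx33 g.
Proof.
move=> [? ? ?] [? ? ?] [? ? ?]; apply/matrixP => i j; rewrite !mxE.
by case: i j => [[|[|[|i]]] Hi] [[|[|[|j]]] Hj].
Qed.

Lemma mx33_inj (f g : nat -> nat -> R) : mx33 f = mx33 g ->
  forall i j, (i < 3)%N -> (j < 3)%N -> f i j = g i j.
Proof.
move=> /matrixP E i j i3 j3; have := E (Ordinal i3) (Ordinal j3).
by rewrite !mxE.
Qed.

Lemma mx33_mul (f g : nat -> nat -> R) : mx33 f *m mx33 g =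
  mx33 (fun i j => f i 0%N * g 0%N j + f i 1%N * g 1%N j + f i 2%N * g 2%N j).
Proof.
by apply/matrixP => i j; rewrite !mxE !big_ord_recl big_ord0 !mxE /= addr0 addrA.
Qed.

Lemma mx33_tr (f : nat -> nat -> R) : (mx33 f)^T = mx33 (fun i j => f j i).
Proof. by apply/matrixP => i j; rewrite !mxE. Qed.

Lemma mx33_1 : 1%:M = mx33 (fun i j => (i == j)%:R).
Proof. by apply/matrixP => i j; rewrite !mxE. Qed.

Lemma mx33_det (f : nat -> nat -> R) : \det (mx33 f) =
  f 0%N 0%N * (f 1%N 1%N * f 2%N 2%N - f 1%N 2%N * f 2%N 1%N)
  - f 0%N 1%N * (f 1%N 0%N * f 2%N 2%N - f 1%N 2%N * f 2%N 0%N)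
  + f 0%N 2%N * (f 1%N 0%N * f 2%N 1%N - f 1%N 1%N * f 2%N 0%N).
Proof.
rewrite (expand_det_row _ ord0) !big_ord_recl big_ord0 /cofactor.
rewrite !(expand_det_row _ ord0) !big_ord_recl !big_ord0 /cofactor !det_mx11 !mxE /=.
by rewrite /bump /=; ring.
Qed.

(* The matrix of v |-> q v q^-1 on the imaginary quaternions. *)
Definition rotf (q0 q1 q2 q3 : R) (i j : nat) : R := nth 0 (nth [::]
  [:: [:: q0 ^+ 2 + q1 ^+ 2 - q2 ^+ 2 - q3 ^+ 2; 2 * (q1 * q2 - q0 * q3); 2 * (q1 * q3 + q0 * q2)];
      [:: 2 * (q1 * q2 + q0 * q3); q0 ^+ 2 - q1 ^+ 2 + q2 ^+ 2 - q3 ^+ 2; 2 * (q2 * q3 - q0 * q1)];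
      [:: 2 * (q1 * q3 - q0 * q2); 2 * (q2 * q3 + q0 * q1); q0 ^+ 2 - q1 ^+ 2 - q2 ^+ 2 + q3 ^+ 2]] i) j.

Definition rotm q0 q1 q2 q3 : M3 := mx33 (rotf q0 q1 q2 q3).

Lemma Ad_quat q0 q1 q2 q3 : Ad (quat q0 q1 q2 q3) = map_mx (real_complex R) (rotm q0 q1 q2 q3).
Proof.
have n2 : (2 : C) != 0 by rewrite pnatr_eq0.
have I := iC_sq R.
have cE (p q : R) : p +i* q = p%:C + iC R * q%:C.
  by apply/eqP; rewrite eq_complex /=; apply/andP; split; apply/eqP; ring.
have cD := (rmorphD (real_complex R), rmorphB (real_complex R), rmorphM (real_complex R),
  rmorphN (real_complex R), rmorph_nat (real_complex R), rmorphXn (real_complex R)).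
have c0 : (0 : R)%:C = 0 by []. have c1 : (1 : R)%:C = 1 by [].
apply/matrixP => j l; rewrite !mxE /crdE !sum2 !mxE !sum2 !mxE !sum2 /adj2 /quat /suE /crdE_coef.
case: j l => [[|[|[|j]]] Hj] [[|[|[|l]]] Hl] //=; rewrite !mxE /= !cE !rmorphN /= ?c0 ?c1
  /rotf /= !cD /=; move: (iC R) I q0%:C q1%:C q2%:C q3%:C => ii I p0 p1 p2 p3;
  by field: I.
Qed.

Lemma rotm_SO q0 q1 q2 q3 : q0 ^+ 2 + q1 ^+ 2 + q2 ^+ 2 + q3 ^+ 2 = 1 ->
  rotm q0 q1 q2 q3 *m (rotm q0 q1 q2 q3)^T = 1%:M /\ \det (rotm q0 q1 q2 q3) = 1.
Proof.
move=> H; pose n := q0 ^+ 2 + q1 ^+ 2 + q2 ^+ 2 + q3 ^+ 2.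
split.
  rewrite mx33_tr mx33_mul mx33_1.
  transitivity (mx33 (fun i j => n ^+ 2 * (i == j)%:R)).
    by apply: mx33P; split; rewrite /rotf /n /=; ring.
  by rewrite /n H; apply/matrixP => i j; rewrite !mxE expr1n mul1r.
rewrite mx33_det; transitivity (n ^+ 3); last by rewrite /n H expr1n.
by rewrite /rotf /n /=; ring.
Qed.

Lemma SU2_Ad (x : 'M[C]_2) : SU2 x -> SO3 (Ad x).
Proof.
move=> /SU2_quatP[q0 [q1 [q2 [q3 [H ->]]]]]; exists (rotm q0 q1 q2 q3).
by have [? ?] := rotm_SO H; rewrite Ad_quat.
Qed.

Lemma rotm_surj_pos y : y *m y^T = 1%:M -> \det y = 1 ->
  0 < 1 + (y i0 i0 + y i1 i1 + y i2 i2) ->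
  exists q0 q1 q2 q3, q0 ^+ 2 + q1 ^+ 2 + q2 ^+ 2 + q3 ^+ 2 = 1 /\ y = rotm q0 q1 q2 q3.
Proof.
move=> yy dy t0; have yy' := mulmx1C yy.
have : exists f, y = mx33 f by eexists; exact: mx33_eta.
move=> [f yE]; rewrite yE !mxE !inordK //= in yy yy' dy t0 *.
pose cof (i j : nat) : R := nth 0 (nth [::]
  [:: [:: f 1%N 1%N * f 2%N 2%N - f 1%N 2%N * f 2%N 1%N; f 1%N 2%N * f 2%N 0%N - f 1%N 0%N * f 2%N 2%N;
          f 1%N 0%N * f 2%N 1%N - f 1%N 1%N * f 2%N 0%N];
      [:: f 0%N 2%N * f 2%N 1%N - f 0%N 1%N * f 2%N 2%N; f 0%N 0%N * f 2%N 2%N - f 0%N 2%N * f 2%N 0%N;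
          f 0%N 1%N * f 2%N 0%N - f 0%N 0%N * f 2%N 1%N];
      [:: f 0%N 1%N * f 1%N 2%N - f 0%N 2%N * f 1%N 1%N; f 0%N 2%N * f 1%N 0%N - f 0%N 0%N * f 1%N 2%N;
          f 0%N 0%N * f 1%N 1%N - f 0%N 1%N * f 1%N 0%N]] i) j.
(* A rotation matrix equals its cofactor matrix. With the orthogonality relations this provides
   enough quadratic identities for those below to be linear combinations of them. *)
have cofE : mx33 f = mx33 cof.
  apply: trmx_inj; rewrite -[LHS]mulmx1.
  have <- : mx33 f *m (mx33 cof)^T = 1%:M.
    transitivity ((\det (mx33 f))%:M : M3); last by rewrite dy.
    rewrite mx33_tr mx33_mul; transitivity (mx33 (fun i j => \det (mx33 f) * (i == j)%:R)).
      by rewrite mx33_det; apply: mx33P; split; rewrite /cof /=; ring.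
    by apply/matrixP => i j; rewrite [LHS]mxE [RHS]mxE mulr_natr.
  by rewrite mulmxA yy' mul1mx.
have cf := mx33_inj cofE; have := yy; have := yy'.
rewrite mx33_tr !mx33_mul mx33_1 => /mx33_inj col /mx33_inj row.
have [c00 c01 c02] := And3 (cf 0%N 0%N isT isT) (cf 0%N 1%N isT isT) (cf 0%N 2%N isT isT).
have [c10 c11 c12] := And3 (cf 1%N 0%N isT isT) (cf 1%N 1%N isT isT) (cf 1%N 2%N isT isT).
have [c20 c21 c22] := And3 (cf 2%N 0%N isT isT) (cf 2%N 1%N isT isT) (cf 2%N 2%N isT isT).
have [r00 r11 r22] := And3 (row 0%N 0%N isT isT) (row 1%N 1%N isT isT) (row 2%N 2%N isT isT).
have [r01 r02 r12] := And3 (row 0%N 1%N isT isT) (row 0%N 2%N isT isT) (row 1%N 2%N isT isT).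
have [k00 k11 k22] := And3 (col 0%N 0%N isT isT) (col 1%N 1%N isT isT) (col 2%N 2%N isT isT).
have [k01 k02 k12] := And3 (col 0%N 1%N isT isT) (col 0%N 2%N isT isT) (col 1%N 2%N isT isT).
move: c00 c01 c02 c10 c11 c12 c20 c21 c22 r00 r11 r22 r01 r02 r12 k00 k11 k22 k01 k02 k12.
rewrite /cof /=; move: {cofE cf row col yy yy' dy cof} t0.
have fE : mx33 f = mx33 (fun i j => nth 0 (nth [::] [:: [:: f 0%N 0%N; f 0%N 1%N; f 0%N 2%N];
   [:: f 1%N 0%N; f 1%N 1%N; f 1%N 2%N]; [:: f 2%N 0%N; f 2%N 1%N; f 2%N 2%N]] i) j).
  by apply: mx33P.
rewrite fE; move: (f 0%N 0%N) (f 0%N 1%N) (f 0%N 2%N) (f 1%N 0%N) (f 1%N 1%N) (f 1%N 2%N)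
  (f 2%N 0%N) (f 2%N 1%N) (f 2%N 2%N) => y00 y01 y02 y10 y11 y12 y20 y21 y22 {fE f y yE}.
move=> t0 c00 c01 c02 c10 c11 c12 c20 c21 c22 r00 r11 r22 r01 r02 r12 k00 k11 k22 k01 k02 k12.
(* For the rotation of a unit quaternion, 1 + trace = 4 q0^2 and the antisymmetric differences are 4
   q0 q_i; so q0 = r / 2 and q_i = u_i / (2 r). *)
pose t := 1 + (y00 + y11 + y22); pose r := Num.sqrt t.
have r0 : 0 < r by rewrite sqrtr_gt0.
have rn : r != 0 by rewrite gt_eqF.
have r2 : r ^+ 2 = t by rewrite sqr_sqrtr // ltW.
pose u1 := y21 - y12; pose u2 := y02 - y20; pose u3 := y10 - y01.
have U11 : u1 ^+ 2 = t * (1 + y00 - y11 - y22) by rewrite /u1 /t; lra.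
have U22 : u2 ^+ 2 = t * (1 - y00 + y11 - y22) by rewrite /u2 /t; lra.
have U33 : u3 ^+ 2 = t * (1 - y00 - y11 + y22) by rewrite /u3 /t; lra.
have U12 : u1 * u2 = t * (y01 + y10) by rewrite /u1 /u2 /t; lra.
have U13 : u1 * u3 = t * (y02 + y20) by rewrite /u1 /u3 /t; lra.
have U23 : u2 * u3 = t * (y12 + y21) by rewrite /u2 /u3 /t; lra.
exists (r / 2), (u1 / (2 * r)), (u2 / (2 * r)), (u3 / (2 * r)).
have tn : t != 0 by rewrite gt_eqF.
have Q0 : (r / 2) ^+ 2 = t / 4 by rewrite -r2; field.
have Q p q z : p * q = t * z -> p / (2 * r) * (q / (2 * r)) = z / 4.
  by move=> H; transitivity ((p * q) / (4 * r ^+ 2)); [field|rewrite r2 H; field].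
have Q0i p : r / 2 * (p / (2 * r)) = p / 4 by field.
have Q1 := Q _ _ _ U11; have Q2 := Q _ _ _ U22; have Q3 := Q _ _ _ U33.
rewrite -!expr2 in Q1 Q2 Q3.
split; first by rewrite Q0 Q1 Q2 Q3 /t; field.
apply: mx33P; split; rewrite /rotf /= ?Q0 ?Q1 ?Q2 ?Q3 ?Q0i ?(Q _ _ _ U12) ?(Q _ _ _ U13)
  ?(Q _ _ _ U23) /t /u1 /u2 /u3; by field.
Qed.

(** Multiplying y by the identity or by a half-turn about an axis gives four matrices whose values
    of 1 + trace add up to 4, so one of them is positive. Half-turns are their own inverses and come
    from E_1, E_2, E_3. *)
Lemma rotm_surj y : y *m y^T = 1%:M -> \det y = 1 ->
  exists2 x : 'M[C]_2, SU2 x & Ad x = map_mx (real_complex R) y.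
Proof.
move=> yy dy.
have K q0 q1 q2 q3 : q0 ^+ 2 + q1 ^+ 2 + q2 ^+ 2 + q3 ^+ 2 = 1 ->
    rotm q0 q1 q2 q3 *m rotm q0 q1 q2 q3 = 1%:M ->
    0 < 1 + ((y *m rotm q0 q1 q2 q3) i0 i0 + (y *m rotm q0 q1 q2 q3) i1 i1
      + (y *m rotm q0 q1 q2 q3) i2 i2) ->
    exists2 x : 'M[C]_2, SU2 x & Ad x = map_mx (real_complex R) y.
  move=> H D t0; set e := rotm _ _ _ _ in D t0; have [ee de] := rotm_SO H.
  have [|| p0 [p1 [p2 [p3 [Hp E]]]]] := @rotm_surj_pos (y *m e) _ _ t0.
  - by rewrite trmx_mul mulmxA -(mulmxA y) ee mulmx1.
  - by rewrite det_mulmx dy de mulr1.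
  exists (quat p0 p1 p2 p3 *m quat q0 q1 q2 q3); first by apply: SU2_mul; apply: SU2_quat.
  by rewrite Ad_mul !Ad_quat -/e -map_mxM -E -mulmxA D mulmx1.
pose t (s0 s1 s2 : R) := 1 + (s0 * y i0 i0 + s1 * y i1 i1 + s2 * y i2 i2).
have T q0 q1 q2 q3 s0 s1 s2 : rotm q0 q1 q2 q3 = mx33 (fun i j => (i == j)%:R * nth 0 [:: s0; s1; s2] i) ->
  1 + ((y *m rotm q0 q1 q2 q3) i0 i0 + (y *m rotm q0 q1 q2 q3) i1 i1
      + (y *m rotm q0 q1 q2 q3) i2 i2) = t s0 s1 s2.
  move=> ->; have -> : y *m mx33 (fun i j => (i == j)%:R * nth 0 [:: s0; s1; s2] i) =
      mx33 (fun i j => y (inord i) (inord j) * nth 0 [:: s0; s1; s2] j).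
    rewrite {1}[y]mx33_eta mx33_mul; apply: mx33P; split; rewrite /=; ring.
  by rewrite !mxE !inordK //= /t inord0; ring.
have S q0 q1 q2 q3 s0 s1 s2 : rotm q0 q1 q2 q3 = mx33 (fun i j => (i == j)%:R * nth 0 [:: s0; s1; s2] i) ->
   s0 * s0 = 1 -> s1 * s1 = 1 -> s2 * s2 = 1 -> rotm q0 q1 q2 q3 *m rotm q0 q1 q2 q3 = 1%:M.
  by move=> -> h0 h1 h2; rewrite mx33_mul mx33_1; apply: mx33P; split; rewrite /= ?mul1r ?h0 ?h1 ?h2; ring.
have R0 : rotm 1 0 0 0 = mx33 (fun i j => (i == j)%:R * nth 0 [:: 1; 1; 1] i).
  by apply: mx33P; split; rewrite /rotf /=; ring.
have R1 : rotm 0 1 0 0 = mx33 (fun i j => (i == j)%:R * nth 0 [:: 1; -1; -1] i).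
  by apply: mx33P; split; rewrite /rotf /=; ring.
have R2 : rotm 0 0 1 0 = mx33 (fun i j => (i == j)%:R * nth 0 [:: -1; 1; -1] i).
  by apply: mx33P; split; rewrite /rotf /=; ring.
have R3 : rotm 0 0 0 1 = mx33 (fun i j => (i == j)%:R * nth 0 [:: -1; -1; 1] i).
  by apply: mx33P; split; rewrite /rotf /=; ring.
have Hm : (-1 : R) * -1 = 1 by ring. have H1 : (1 : R) * 1 = 1 by ring.
case: (ltrP 0 (t 1 1 1)) => t0.
  by apply: (K 1 0 0 0); [ring|exact: S R0 _ _ _|rewrite (T _ _ _ _ _ _ _ R0)].
case: (ltrP 0 (t 1 (-1) (-1))) => t1.
  by apply: (K 0 1 0 0); [ring|exact: S R1 _ _ _|rewrite (T _ _ _ _ _ _ _ R1)].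
case: (ltrP 0 (t (-1) 1 (-1))) => t2.
  by apply: (K 0 0 1 0); [ring|exact: S R2 _ _ _|rewrite (T _ _ _ _ _ _ _ R2)].
case: (ltrP 0 (t (-1) (-1) 1)) => t3.
  by apply: (K 0 0 0 1); [ring|exact: S R3 _ _ _|rewrite (T _ _ _ _ _ _ _ R3)].
by exfalso; move: t0 t1 t2 t3; rewrite /t; lra.
Qed.

Lemma SO3_Ad (x : 'M[C]_3) : SO3 x -> exists2 z : 'M[C]_2, SU2 z & Ad z = x.
Proof. by move=> [y [-> yy dy]]; apply: rotm_surj. Qed.

End Rotations.

(** * The two spectra *)

Section Spectra.
Variables (R : realType) (a b : R).
Hypotheses (a0 : 0 < a) (b0 : 0 < b).
Local Notation C := R[i].
Local Notation M2 := 'M[C]_2.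
Local Notation M3 := 'M[C]_3.
Local Notation G := (gSU2 a0 b0 b0).
Local Notation H := (gSO3 a0 b0 b0).
Local Notation even := (fun k => ~~ odd k).
Local Notation index := ((nat * nat) * (nat * nat))%type.
Local Notation base := (@eig_base R a b a0 b0).

Lemma SU2_opp (x : M2) : SU2 x -> SU2 (- x).
Proof.
move=> /SU2_quatP[q0 [q1 [q2 [q3 [E ->]]]]].
have -> : - quat q0 q1 q2 q3 = quat (- q0) (- q1) (- q2) (- q3).
  by apply/mx2P; rewrite !mxE /=; apply/eqP; rewrite eq_complex /= ?opprK !eqxx.
by apply: SU2_quat; rewrite !sqrrN.
Qed.

Lemma eig_index_even P lambda N r : r \in eig_list a b P lambda N ->
  [/\ P r.1.1, (r.1.1 < N)%N & (r.2.1 <= r.1.1)%N].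
Proof.
case: r => [[k J] [s l]]; rewrite mem_filter mem_eig_index /eig_select /=.
by move=> /andP[/and3P[-> _ _] /and4P[-> _ -> _]].
Qed.

Lemma Ad_pull_eigen lambda (w : form1 H) : eigenform lambda w -> eigenform lambda (Ad_pull w : form1 G).
Proof.
move=> [sw Ew]; split; first exact: smooth_Ad_pull.
by move=> x xS i; rewrite Ad_pull_Delta1 // Ew //; apply: SU2_Ad.
Qed.

(** The pullback is unchanged by x |-> - x, while eigenforms of weight k are multiplied by (-1)^k;
    by independence the coefficients of odd weight vanish. *)
Lemma eigen_even lambda N (w : form1 H) : eig_bounded a b lambda N -> eigenform lambda w ->
  exists c : index -> C, forall x, SU2 x -> forall i,
    w i (Ad x) = \sum_(r <- eig_list a b even lambda N) c r * base r i x.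
Proof.
move=> NP Ew; have [c wE] := eigenform_span NP (Ad_pull_eigen Ew); exists c.
have c0 r : r \in eig_list a b predT lambda N -> c r - (-1) ^+ r.1.1 * c r = 0.
  apply: (eig_list_independent (a0 := a0) (b0 := b0) (c := fun r => c r - (-1) ^+ r.1.1 * c r)) => x xS i.
  have E : Ad_pull (a0 := a0) (b0 := b0) w i x = Ad_pull (a0 := a0) (b0 := b0) w i (- x).
    by rewrite /Ad_pull Ad_opp.
  move: E; rewrite (wE x xS i) (wE _ (SU2_opp xS) i) => /eqP; rewrite -subr_eq0 -sumrB => /eqP E.
  rewrite -[RHS]E big_seq [RHS]big_seq; apply: eq_bigr => r1 /eig_index_even[_ _ sk].
  by rewrite /eig_base /eig_form bform_opp //; ring.
move=> x xS i; rewrite -/(Ad_pull (a0 := a0) (b0 := b0) w i x) (wE x xS i) /eig_list !big_filter.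
rewrite [LHS]big_seq_cond [RHS]big_seq_cond (bigID (fun r : index => ~~ odd r.1.1)) /=.
rewrite [X in _ + X]big1 ?addr0.
  by apply: eq_bigl => r; rewrite /eig_select /= -andbA; congr (_ && _); rewrite andbC.
move=> r /andP[/andP[rI rS] ok].
have := c0 r; rewrite mem_filter rS rI => /(_ isT).
rewrite negbK in ok; rewrite -signr_odd ok expr1 mulN1r opprK -mulr2n => /eqP.
by rewrite mulrn_eq0 /= => /eqP ->; rewrite mul0r.
Qed.

(** Eigenforms of even weight descend componentwise to forms on SO(3). As every rotation is some Ad
    x, the eigenvalue equation, independence and spanning are all checked after pullback. *)
Lemma eigenform_SO3_dim lambda N : eig_bounded a b lambda N ->
  has_dim (eigenform (G := H) lambda) (size (eig_list a b even lambda N)).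
Proof.
move=> NP.
have ex (t : index * 'I_3) : exists f : M3 -> C, ~~ odd t.1.1.1 -> (t.1.2.1 <= t.1.1.1)%N ->
    smooth f /\ forall x, SU2 x -> base t.1 t.2 x = f (Ad x).
  case: t => r i /=.
  case: (boolP (~~ odd r.1.1 && (r.2.1 <= r.1.1)%N)) => [/andP[ek sk]|ne].
    have [f sf fE] := @lifts_bform R r.1.1 r.2.1 r.1.2 (eig_vec a b r.1.1 r.2.2 r.1.2).1.1
      (eig_vec a b r.1.1 r.2.2 r.1.2).1.2 (eig_vec a b r.1.1 r.2.2 r.1.2).2 i ek sk.
    by exists f.
  by exists (fun=> 0) => e s; move: ne; rewrite e s.
have [g gP] := choice ex.
pose B (r : index) : form1 H := fun i => g (r, i).
have BP r : r \in eig_list a b even lambda N -> smooth1 (B r) /\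
    forall x, SU2 x -> forall i, base r i x = B r i (Ad x).
  move=> /eig_index_even[ek _ sk].
  by split=> [i|x xS i]; have [] := gP (r, i) ek sk => // _; apply.
apply: (has_dim_seq (B := B)).
- exact: uniq_eig_list.
- move=> r rL; have [sB BE] := BP r rL; have [sr Er] := eig_list_eigen a0 b0 rL; split=> //.
  move=> _ /SO3_Ad[x xS <-] i.
  have E1 := Ad_pull_Delta1 (a0 := a0) (b0 := b0) i x sB.
  have sP := smooth_Ad_pull (a0 := a0) (b0 := b0) sB.
  have E2 := Delta1_ext sP sr (fun y yS j => esym (BE y yS j)) xS i.
  have E3 := Er x xS i.
  exact: etrans (etrans (esym E1) E2) (etrans E3 (congr1 (fun z => lambda * z) (BE x xS i))).
- move=> c c0; apply: (eig_list_independent (a0 := a0) (b0 := b0)) => x xS i.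
  apply: etrans (c0 _ (SU2_Ad xS) i); rewrite big_seq [RHS]big_seq; apply: eq_bigr => r rL.
  by have [_ ->] := BP r rL.
- move=> w Ew; have [c wE] := eigen_even NP Ew; exists c => _ /SO3_Ad[x xS <-] i.
  rewrite wE // big_seq [RHS]big_seq; apply: eq_bigr => r rL.
  by have [_ ->] := BP r rL.
Qed.

(** Weights from [N] on do not contribute, so the partial sums of multiplicities are constant. *)
Lemma eig_bounded_count lambda N (P : pred nat) K : eig_bounded a b lambda N -> (N <= K)%N ->
  (\sum_(k < K | P k) count_mem lambda [seq r%:C | r <- spec1 a b k])%N =
  size (eig_list a b P lambda N).
Proof.
move=> NP NK; rewrite size_eig_list // -(big_mkord P (fun k => count_mem lambda [seq r%:C | r <- spec1 a b k])) (big_cat_nat _ NK) //=.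
suff -> : (\sum_(N <= k < K | P k) count_mem lambda [seq r%:C | r <- spec1 a b k] = 0)%N.
  by rewrite addn0.
rewrite big_nat_cond big1 // => k /andP[/andP[Nk _] _].
rewrite eig_count // big1 // => J _; rewrite big1 // => s _; rewrite big1 // => l _.
by case V: (eig_valid k l J) => //=; rewrite (negPf (NP k l J Nk V)).
Qed.

End Spectra.

Theorem corollary4p2 (R : realType) (a b : R) (ha : 0 < a) (hb : 0 < b) :
  [/\ forall k : nat, spectrum_on (@isotypic R a b b ha hb hb k) (spec1 a b k),
      spectrum_is_union (gSU2 ha hb hb) predT (spec1 a b) &
      spectrum_is_union (gSO3 ha hb hb) (fun k => ~~ odd k) (spec1 a b)].
Proof.
split.
- move=> k lambda; have [N [kN NP D]] := isotypic_eigenform_dim ha hb k lambda.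
  suff -> : count_mem lambda [seq r%:C | r <- spec1 a b k] = size (eig_list a b (pred1 k) lambda N) by [].
  by rewrite size_eig_list // (big_nat1_eq _ _ k 0 N) kN.
- move=> lambda; have [N NP] := eig_bound ha hb lambda; exists (size (eig_list a b predT lambda N)).
  split; first exact: eigenform_SU2_dim.
  by exists N => K NK; apply: eig_bounded_count.
- move=> lambda; have [N NP] := eig_bound ha hb lambda.
  exists (size (eig_list a b (fun k => ~~ odd k) lambda N)).
  split; first exact: eigenform_SO3_dim.
  by exists N => K NK; apply: eig_bounded_count.
Qed.
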